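(* Let $d\ge 3$, $s\ge 0$ and $n\ge d+s+1$ be integers. For every polytope $P\in\mathcal{P}(d,n,s)$ and every $0\le i\le d-1$, \[f_i(S(d,n,s))\le f_i(P)\le f_i(C(d,n,s)).\] Moreover, if $d\ge 4$ and $P\in\mathcal{P}(d,n,s)$ satisfies $f_i(P)=f_i(S(d,n,s))$ for some $1\le i\le d-1$, then $f_i(P)=f_i(S(d,n,s))$ for all $0\le i\le d-1$.
   Context: For a polytope $P$, $f_i(P)$ is the number of $i$-dimensional faces of $P$. $\mathcal{P}(d,n,s)$ is the family of $d$-dimensional polytopes $P$ with $n$ vertices having a facet $F$ with exactly $d+s$ vertices such that every facet of $P$ other than $F$ is a simplex (an ''almost simplicial polytope''; $(P,F)$ is called an ASP-pair). A simplicial polytope is stacked if it is obtained from a simplex by repeatedly adding a new vertex beyond a facet and taking the convex hull. $S(d,n,s)$ denotes any $d$-polytope obtained as follows: take a stacked $(d-1)$-polytope $F$ with $d+s$ vertices, form a pyramid over $F$, and then stack $n-d-s-1$ times over facets different from $F$. All such polytopes lie in $\mathcal{P}(d,n,s)$ and have the same $f$-vector: $f_0=n$, $f_k=\binom{d}{k}n-\binom{d+1}{k+1}k$ for $1\le k\le d-3$, $f_{d-2}=\binom{d}{d-2}n-\binom{d+1}{d-1}(d-2)-s$, and $f_{d-1}=(d-1)n-(d+1)(d-2)-s$. $C(d,n,s)$ is the convex hull of the points $y(t_1),\dots,y(t_n)$, where $t_i=-s-d+i$ for $i=1,\dots,n$, $y(t)=(t,t^2,\dots,t^{d-1},p(t))\in\mathbf{R}^d$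 and $p(t)=(n-1)^{(t-1)(d-1)}\,t(t+1)\cdots(t+d+s-1)$. *)

(* Defs.v *)
From HB Require Import structures.
From mathcomp Require Import all_boot all_order all_algebra finmap.
From mathcomp Require Import all_classical reals.

Set Implicit Arguments.
Unset Strict Implicit.
Unset Printing Implicit Defensive.

Import Order.TTheory GRing.Theory Num.Theory.
Local Open Scope classical_set_scope.
Local Open Scope ring_scope.

Section Polytopes.
Context {R : realType} {m : nat}.
Local Notation V := 'rV[R]_m.
Implicit Types (A P F G : set V) (u v x : V).

Definition affine_hull A : set V :=
  [set x | exists (k : nat) (p : 'I_k -> V) (a : 'I_k -> R),
     [/\ forall i, A (p i), \sum_i a i = 1 & x = \sum_i a i *: p i]].

Definition convex_hull A : set V :=
  [set x | exists (k : nat) (p : 'I_k -> V) (a : 'I_k -> R),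
     [/\ forall i, A (p i), forall i, 0 <= a i, \sum_i a i = 1
       & x = \sum_i a i *: p i]].

(* The empty set has no dimension in this sense (conventionally -1). *)
Definition has_dim A (k : nat) : Prop :=
  exists (x0 : V) (W : {vspace V}),
    \dim W = k /\ affine_hull A = [set x | x - x0 \in W].

Definition affinely_independent (k : nat) (p : 'I_k -> V) : Prop :=
  forall a : 'I_k -> R,
    \sum_i a i = 0 -> \sum_i a i *: p i = 0 -> forall i, a i = 0.

Definition is_polytope P : Prop :=
  exists2 X : set V, finite_set X & P = convex_hull X.

Definition is_simplex A : Prop :=
  exists (k : nat) (p : 'I_k -> V),
    affinely_independent p /\ A = convex_hull (range p).

Definition dot u v : R := \sum_i u 0 i * v 0 i.

(* With c = 0 this yields the improper faces P (b = 0) and set0 (b = 1). *)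
Definition supports P F (c : V) (b : R) : Prop :=
  (forall x, P x -> dot c x <= b) /\ F = [set x | P x /\ dot c x = b].

Definition is_face P F : Prop := exists c b, supports P F c b.

Definition is_facet P F : Prop :=
  is_face P F /\ exists2 k : nat, has_dim P k.+1 & has_dim F k.

(* fset_set returns the empty set on infinite sets, but a polytope has only
   finitely many faces. *)
Definition fnum (i : nat) P : nat :=
  #|` fset_set [set F | is_face P F /\ has_dim F i] |%fset.

Definition asp_pair (d n s : nat) P F : Prop :=
  [/\ is_polytope P, has_dim P d, fnum 0 P = n &
   [/\ is_facet P F, fnum 0 F = (d + s)%N
     & forall G, is_facet P G -> G <> F -> is_simplex G]].

Definition almost_simplicial (d n s : nat) P : Prop :=
  exists F, asp_pair d n s P F.

(* Restricting v to the affine hull of P makes the choice of the supporting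
   functional (c, b) of a facet irrelevant, up to positive scaling on that
   affine hull. *)
Definition beyond P F v : Prop :=
  affine_hull P v /\ exists c b, supports P F c b /\ b < dot c v.

Definition beneath P F v : Prop :=
  affine_hull P v /\ exists c b, supports P F c b /\ dot c v < b.

(* P' arises from P by stacking over the facet F: the new vertex is beyond F
   and beneath every other facet. *)
Definition stacking P F P' : Prop :=
  is_facet P F /\
  exists v, [/\ beyond P F v,
    forall G, is_facet P G -> G <> F -> beneath P G v
    & P' = convex_hull (P `|` [set v])].

Inductive stacked : set V -> Prop :=
| stacked_simplex P : is_simplex P -> stacked P
| stacked_step P F P' : stacked P -> stacking P F P' -> stacked P'.

Definition is_pyramid F P : Prop :=
  exists2 v, ~ affine_hull F v & P = convex_hull (F `|` [set v]).

Inductive stacked_away F : nat -> set V -> set V -> Prop :=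
| stacked_away0 P : stacked_away F 0 P P
| stacked_awayS k P G P' P'' :
    G <> F -> stacking P G P' -> stacked_away F k P' P'' ->
    stacked_away F k.+1 P P''.

(* P is an instance of S(d,n,s); meant for d >= 1 and n >= d + s + 1. *)
Definition is_S (d n s : nat) P : Prop :=
  exists F Q, [/\ [/\ stacked F, has_dim F d.-1 & fnum 0 F = (d + s)%N],
    is_pyramid F Q & stacked_away F (n - d - s - 1) Q P].

End Polytopes.

Section CyclicASP.
Variables (R : realType) (d n s : nat).

Definition C_height (t : int) : R :=
  (n.-1%:R : R) ^ ((t - 1) * (d.-1)%:Z) * \prod_(j < d + s) (t + j%:Z)%:~R.

(* y(t) = (t, t^2, ..., t^(d-1), p(t)). *)
Definition C_point (t : int) : 'rV[R]_d :=
  \row_(j < d) (if (j.+1 < d)%N then t%:~R ^+ j.+1 else C_height t).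

(* i : 'I_n ranges over 0, ..., n-1, so t_(i+1) = - s - d + (i + 1). *)
Definition C_param (i : 'I_n) : int := - s%:Z - d%:Z + (i.+1)%:Z.

Definition C_polytope : set 'rV[R]_d :=
  convex_hull (range (fun i => C_point (C_param i))).

End CyclicASP.

Arguments C_polytope : clear implicits.

(* Main.v *)
(* Let Delta be the simplicial complex generated by the facets of P other than F; all faces of P
   except P and F lie in Delta.

   Upper bound. Rotating a generic functional about a point splits Delta into intervals [R(G), G],
   one for each facet G, with F last. This gives an h-vector of Delta whose reversal is the h-vector
   of the faces not contained in F. McMullen's argument (sum over vertex links) bounds the h_i by
   those of a neighborly complex. C(d,n,s) attains the bounds: its last coordinate grows so fast that
   divided differences are positive, so Gale's evenness condition yields every face needed.

   Lower bound. If a vertex set W contains a facet of a link of dimension at least 2, attaching vertex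
   links one after another shows that each vertex outside W brings enough new edges; the two-dimensional base
   case follows from Euler's relation after a perturbation to general position. So vertex links have
   at least as many edges as those of S(d,n,s), and summing over links propagates the bound, and its
   equality case, from edges to all dimensions. S(d,n,s) itself attains it, because stacking adds
   exactly the edges from the new vertex to the stacked facet. *)
From HB Require Import structures.
From mathcomp Require Import all_boot all_order all_algebra finmap.
From mathcomp Require Import all_classical reals.
From mathcomp Require Import ring lra zify.
Require Import Defs.
From mathcomp.boot Require Import fintype finset.

Set Implicit Arguments.
Unset Strict Implicit.
Unset Printing Implicit Defensive.

Import Order.TTheory GRing.Theory Num.Theory.

(** * Cones and facets *)

(** The obstacle is the facet F. A set inside F is never an interior face, so the h-vector of Delta
    can be bounded sharply only for small indices. For large indices the reversed vector is bounded
    instead, with a correction term C(s+i-1, i) that accounts for the subsets of F. In McMullen's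
    sum, the link of a vertex outside F is a sphere and obeys the classical bound; for a vertex of F
    the sweep is chosen so that its link can be compared with Delta itself.

    In the lower bound, interior faces and faces inside F are estimated separately, because the
    links of vertices in F are balls, which have fewer edges per vertex than spheres. Summing over
    links yields an expression in the numbers of interior edges and of edges inside F, both with
    positive coefficients; this is why equality in one dimension comes back to the edges and spreads
    from there. For d = 3 all face numbers are determined by n and s. *)

Section Pairing.
Local Open Scope ring_scope.
Variables (R : realFieldType) (N : nat).
Implicit Types (x y : 'rV[R]_N) (l k : 'cV[R]_N).

Definition pr x l : R := (x *m l) 0 0.

Lemma prDl x y l : pr (x + y) l = pr x l + pr y l.
Proof. by rewrite /pr mulmxDl mxE. Qed.
Lemma prDr x l k : pr x (l + k) = pr x l + pr x k.
Proof. by rewrite /pr mulmxDr mxE. Qed.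
Lemma prZl a x l : pr (a *: x) l = a * pr x l.
Proof. by rewrite /pr -scalemxAl mxE. Qed.
Lemma prZr a x l : pr x (a *: l) = a * pr x l.
Proof. by rewrite /pr -scalemxAr mxE. Qed.
Lemma prNl x l : pr (- x) l = - pr x l.
Proof. by rewrite -scaleN1r prZl mulN1r. Qed.
Lemma prNr x l : pr x (- l) = - pr x l.
Proof. by rewrite -scaleN1r prZr mulN1r. Qed.
Lemma pr0l l : pr 0 l = 0.
Proof. by rewrite /pr mul0mx mxE. Qed.
Lemma pr0r x : pr x 0 = 0.
Proof. by rewrite /pr mulmx0 mxE. Qed.
Lemma pr_suml (I : Type) (r : seq I) (P : pred I) (f : I -> 'rV[R]_N) l :
  pr (\sum_(i <- r | P i) f i) l = \sum_(i <- r | P i) pr (f i) l.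
Proof. exact: (big_morph (fun x => pr x l) (fun x y => prDl x y l) (pr0l l)). Qed.

Definition prE := (prDl, prDr, prZl, prZr, prNl, prNr, pr0l, pr0r).

Lemma pr_eq0 x : (forall l, pr x l = 0) -> x = 0.
Proof.
move=> h; apply/rowP => j; rewrite mxE.
have := h (delta_mx j 0); rewrite /pr mxE (bigD1 j) //= big1 ?addr0.
  by rewrite mxE !eqxx mulr1.
by move=> i ij; rewrite mxE (negbTE ij) mulr0.
Qed.

Lemma pr_nz l : l != 0 -> exists z, pr z l != 0.
Proof.
move=> l0; have /existsP[j hj] : [exists j, l j 0 != 0].
  apply: contraNT l0; rewrite negb_exists => /forallP h.
  by apply/eqP/colP => j; rewrite mxE; apply/eqP; have := h j; rewrite negbK.
exists (delta_mx 0 j); rewrite /pr mxE (bigD1 j) //= big1 ?addr0.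
  by rewrite mxE !eqxx mul1r.
by move=> i ij; rewrite mxE (negbTE ij) andbF mul0r.
Qed.

Definition samesgn (w0 w : 'rV[R]_N) l :=
  (0 < pr w0 l -> 0 < pr w l) /\ (pr w0 l < 0 -> pr w l < 0).

Lemma small_step (K : seq 'cV[R]_N) (w0 z : 'rV[R]_N) :
  exists2 e : R, 0 < e & forall l, l \in K -> samesgn w0 (w0 + e *: z) l.
Proof.
elim: K => [|k K [e e0 IH]]; first by exists 1.
set a := `|pr w0 k|; set b := `|pr z k|.
have [a0|a0] := eqVneq a 0.
  exists e => // l; rewrite inE => /orP[/eqP->|/IH//].
  by move/normr0_eq0: a0 => a0; split; rewrite a0 ltxx.
have {}a0 : 0 < a by rewrite lt_def a0 normr_ge0.
have b0 : 0 <= b by apply: normr_ge0.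
pose e1 := Num.min e (a / (b + 1)).
have e10 : 0 < e1 by rewrite lt_min e0 divr_gt0 // ltr_wpDl.
have le1 : e1 <= e by rewrite ge_min lexx.
have le2 : e1 * (b + 1) <= a by rewrite -ler_pdivlMr ?ltr_wpDl // ge_min lexx orbT.
exists e1 => // l; rewrite inE => /orP[/eqP->|/IH].
  rewrite /samesgn !prE.
  have h : `|e1 * pr z k| < a.
    rewrite normrM (gtr0_norm e10) -/b; apply: lt_le_trans le2.
    by rewrite ltr_pM2l // ltrDl.
  move: h; rewrite ltr_norml /a => /andP[h1 h2].
  by split => h; [rewrite gtr0_norm // in h1|rewrite ltr0_norm // in h2]; lra.
rewrite /samesgn !prE => -[h1 h2]; split => h.
  have {h1}h1 := h1 h.
  have [zl|zl] := leP 0 (pr z l); first by rewrite ltr_wpDr // mulr_ge0 // ltW.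
  by apply: lt_le_trans h1 _; rewrite lerD2l ler_wnM2r // ltW.
have {h2}h2 := h2 h.
have [zl|zl] := leP 0 (pr z l).
  by apply: le_lt_trans h2; rewrite lerD2l ler_wpM2r.
have hz : e1 * pr z l <= 0 by apply: mulr_ge0_le0; exact: ltW.
by lra.
Qed.

(** One functional at a time is made nonzero, by a step so small that no strict sign already present
    on [K] is lost. Both the sweep directions and the moves to general position come from this. *)
Lemma generic (K : seq 'cV[R]_N) (w0 : 'rV[R]_N) :
  exists w, forall l, l \in K -> (l != 0 -> pr w l != 0) /\ samesgn w0 w l.
Proof.
suff h (K' : seq 'cV[R]_N) : {subset K' <= K} ->
    exists w, (forall l, l \in K' -> l != 0 -> pr w l != 0) /\
              (forall l, l \in K -> samesgn w0 w l).
  have [w [h1 h2]] := h K (fun _ => id).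
  by exists w => l lK; split; [exact: h1|exact: h2].
elim: K' => [|k K' IH] sub; first by exists w0.
have [|w [h1 h2]] := IH; first by move=> x xK; apply: sub; rewrite inE xK orbT.
have [k0|k0] := eqVneq k 0.
  exists w; split => // l; rewrite inE => /orP[/eqP->|]; last exact: h1.
  by rewrite k0 eqxx.
have [wk|wk] := eqVneq (pr w k) 0; last first.
  exists w; split => // l; rewrite inE => /orP[/eqP->|]; last exact: h1.
  by [].
have [z zk] := pr_nz k0.
have [e e0 he] := small_step K w z.
exists (w + e *: z); split => l.
  rewrite inE => /orP[/eqP->|lK'] l0.
    by rewrite !prE wk add0r mulf_neq0 // gt_eqF.
  have [s1 s2] := he l (sub _ (mem_behead (s:=k::K') lK')).
  have := h1 l lK' l0; rewrite neq_lt => /orP[/s2|/s1] h; first by rewrite lt_eqF.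
  by rewrite gt_eqF.
move=> lK; have [s1 s2] := he l lK; have [r1 r2] := h2 l lK.
by split => h; [exact/s1/r1|exact/s2/r2].
Qed.

Lemma farkas (T : finType) (S : {set T}) (a : T -> 'rV[R]_N) (b : 'rV[R]_N) :
  (exists c : T -> R, (forall t, 0 <= c t) /\ b = \sum_(t in S) c t *: a t) \/
  (exists l, (forall t, t \in S -> pr (a t) l <= 0) /\ 0 < pr b l).
Proof.
have [n] := ubnP #|S|; elim: n S a b => // n IH S a b Sn.
have [->|[s sS]] := set_0Vmem S.
  have [->|b0] := eqVneq b 0.
    by left; exists (fun=> 0); split => //; rewrite big_set0.
  right; have [l bl] : exists l, pr b l != 0.
    apply: contrapT => h; move/eqP: b0; apply; apply: pr_eq0 => l.
    by apply: contrapT => /eqP h'; apply: h; exists l.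
  exists (pr b l *: l); split; first by move=> t; rewrite inE.
  by rewrite prZr lt_def mulf_neq0 //= -expr2 sqr_ge0.
have cS : (#|S :\ s| < n)%N.
  by move: Sn; rewrite (cardsD1 s) sS.
have [[c [c0 bE]]|[l [lS lb]]] := IH (S :\ s) a b cS.
  left; exists (fun t => if t == s then 0 else c t); split.
    by move=> t; case: ifP.
  rewrite (big_setD1 s) //= eqxx scale0r add0r bE; apply: eq_bigr => t.
  by rewrite !inE => /andP[/negbTE->].
have [als|als] := leP (pr (a s) l) 0.
  right; exists l; split => // t tS; have [->//|ts] := eqVneq t s.
  by apply: lS; rewrite !inE ts.
pose A := pr (a s) l.
have A0 : A != 0 by rewrite gt_eqF.
(* Project along [a s] onto the kernel of [l]. In the first alternative the coefficient of [a s] is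
   recovered as [cs], which is nonnegative because [l] is nonpositive on the other generators and
   positive on [a s] and [b]. *)
pose a' t := a t - (pr (a t) l / A) *: a s.
pose b' := b - (pr b l / A) *: a s.
have [[c [c0 bE]]|[k [kS kb]]] := IH (S :\ s) a' b' cS.
  left.
  pose cs := pr b l / A - \sum_(t in S :\ s) c t * (pr (a t) l / A).
  exists (fun t => if t == s then cs else c t); split.
    move=> t; case: ifP => // _; rewrite /cs subr_ge0.
    apply: le_trans (_ : 0 <= _); last by rewrite divr_ge0 // ltW.
    by apply: sumr_le0 => u uS; rewrite mulr_ge0_le0 // pmulr_lle0 ?invr_gt0 // lS.
  rewrite (big_setD1 s) //= eqxx.
  have -> : b = b' + (pr b l / A) *: a s by rewrite /b' subrK.
  rewrite bE /cs scalerBl.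
  rewrite [X in _ = _ + X](eq_bigr (fun t => c t *: a' t + (c t * (pr (a t) l / A)) *: a s)).
    by rewrite big_split /= -scaler_suml [X in _ = _ + X]addrC addrA subrK addrC.
  move=> t; rewrite !inE => /andP[/negbTE-> _].
  by rewrite /a' scalerBr scalerA subrK.
right; exists (k - (pr (a s) k / A) *: l); split; last first.
  by move: kb; rewrite /b' !prE; congr (_ < _); field.
move=> t tS; have [->|ts] := eqVneq t s.
  by rewrite !prE -/A divfK // subrr.
have := kS t; rewrite !inE ts tS /a' !prE => /(_ isT).
by congr (_ <= _); field.
Qed.

End Pairing.

Section Config.
Local Open Scope ring_scope.
Variables (R : realFieldType) (N : nat) (T : finType) (v : T -> 'rV[R]_N).
Implicit Types (A B G H S : {set T}) (l k : 'cV[R]_N) (t u : T).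

(* A polytope is handled as the cone over its homogenized vertices [v t]. Its faces are the sets
   of vertices where a functional that is nonpositive on the cone vanishes; ranks are linear,
   hence one more than affine dimensions. *)
Definition ev t l := pr (v t) l.
Definition spanm A := (\sum_(t in A) <<v t>>)%MS.
Definition rk A := \rank (spanm A).
Definition valid S l := forall t, t \in S -> ev t l <= 0.
Definition zs S l := [set t in S | ev t l == 0].
Definition facet S G := exists l, [/\ valid S l, zs S l = G & (rk G).+1 = rk S].

Lemma zsP S l t : reflect (t \in S /\ ev t l = 0) (t \in zs S l).
Proof. by rewrite inE; apply: (iffP andP) => -[h /eqP]. Qed.

Lemma zs_sub S l : zs S l \subset S.
Proof. by apply/subsetP => t /zsP[]. Qed.

Lemma facet_sub S G : facet S G -> G \subset S.
Proof. by case=> l [_ <- _]; apply: zs_sub. Qed.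

Lemma pr_mem A l (x : 'rV_N) : (forall t, t \in A -> ev t l = 0) ->
  (x <= spanm A)%MS -> pr x l = 0.
Proof.
move=> h xA; have : (spanm A <= kermx l)%MS.
  apply/sumsmx_subP => t tA; rewrite genmxE; apply/sub_kermxP.
  by apply/matrixP => i j; rewrite !ord1 [RHS]mxE; exact: h.
by move/(submx_trans xA)/sub_kermxP; rewrite /pr => ->; rewrite mxE.
Qed.

Lemma mem_spanm A t : t \in A -> (v t <= spanm A)%MS.
Proof. by move=> tA; rewrite -(genmxE (v t)); apply: sumsmx_sup (submx_refl _). Qed.

Lemma sepfun A (x : 'rV_N) : ~~ (x <= spanm A)%MS ->
  exists2 l, (forall t, t \in A -> ev t l = 0) & pr x l != 0.
Proof.
rewrite submxE => h; have /existsP[j hj] : [exists j, (x *m cokermx (spanm A)) 0 j != 0].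
  apply: contraNT h; rewrite negb_exists => /forallP h.
  by apply/eqP/rowP => j; rewrite [RHS]mxE; apply/eqP; have := h j; rewrite negbK.
have E (y : 'rV_N) : pr y (col j (cokermx (spanm A))) = (y *m cokermx (spanm A)) 0 j.
  by rewrite /pr !mxE; apply: eq_bigr => i _; rewrite mxE.
exists (col j (cokermx (spanm A))); last by rewrite E.
move=> t /mem_spanm; rewrite submxE /ev E => /eqP ->; by rewrite mxE.
Qed.

Lemma span_sub A B : A \subset B -> (spanm A <= spanm B)%MS.
Proof.
move=> AB; apply/sumsmx_subP => t tA; rewrite genmxE.
by apply: mem_spanm; apply: (subsetP AB).
Qed.

Lemma rkS A B : A \subset B -> (rk A <= rk B)%N.
Proof. by move=> AB; apply/mxrankS/span_sub. Qed.

Lemma exfun A B : (rk A < rk B)%N ->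
  exists l, (forall t, t \in A -> ev t l = 0) /\ exists2 t, t \in B & ev t l != 0.
Proof.
move=> lt; have : ~~ (spanm B <= spanm A)%MS.
  by apply/negP => /mxrankS; rewrite leqNgt lt.
case/boolP: [exists t in B, ~~ (v t <= spanm A)%MS].
  case/existsP => t /andP[tB /sepfun[l h1 h2]] _.
  by exists l; split => //; exists t.
rewrite negb_exists => /forallP h /negP[]; apply/sumsmx_subP => t tB.
by have := h t; rewrite tB negbK genmxE.
Qed.

Lemma rk0 : rk set0 = 0%N.
Proof. by rewrite /rk /spanm big_set0 mxrank0. Qed.

Lemma rkU1_le t A : (rk (t |: A) <= (rk A).+1)%N.
Proof.
have [tA|tA] := boolP (t \in A).
  by rewrite (setUidPr _) ?sub1set.
rewrite /rk /spanm big_setU1 //=; apply: leq_trans (mxrank_adds_leqif _ _) _.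
by rewrite genmxE; have := rank_leq_row (v t); lia.
Qed.

Lemma rk_card A : (rk A <= #|A|)%N.
Proof.
have [n] := ubnP #|A|; elim: n A => // n IH A An.
have [->|[t tA]] := set_0Vmem A; first by rewrite rk0.
rewrite -(setD1K tA); apply: leq_trans (rkU1_le _ _) _.
rewrite cardsU1 !inE eqxx add1n ltnS; apply: IH.
by move: An; rewrite (cardsD1 t) tA.
Qed.

Lemma rk_add t A l : (forall s, s \in A -> ev s l = 0) -> ev t l != 0 ->
  rk (t |: A) = (rk A).+1.
Proof.
move=> h1 h2; apply/eqP; rewrite eqn_leq rkU1_le /= ltnNge; apply/negP => le.
have sub : (spanm A <= spanm (t |: A))%MS by apply/span_sub/subsetUr.
have : (spanm (t |: A) <= spanm A)%MS.
  by have := mxrank_leqif_sup sub; move=> /geq_leqif <-.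
move=> /(submx_trans (mem_spanm (setU11 t A))) /(pr_mem h1) /eqP.
by rewrite -/(ev t l) (negbTE h2).
Qed.

Lemma vanish_rk A B l : A \subset B -> (rk B <= rk A)%N ->
  (forall t, t \in A -> ev t l = 0) -> forall t, t \in B -> ev t l = 0.
Proof.
move=> AB le h t tB; apply/eqP/negPn/negP => nz.
have := rk_add h nz; have : t |: A \subset B by rewrite subUset sub1set tB.
by move/rkS => h1 h2; move: h1; rewrite h2 ltnNge le.
Qed.

Lemma facet_inj S G H : facet S G -> facet S H -> G \subset H -> G = H.
Proof.
move=> [l [vl lG rG]] [k [vk kH rH]] GH; apply/eqP; rewrite eqEsubset GH /=.
apply/subsetP => t tH; rewrite -lG; apply/zsP.
have HS : H \subset S by rewrite -kH zs_sub.
split; first exact: (subsetP HS).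
apply: (vanish_rk GH) => //; last first.
  by move=> s; rewrite -lG => /zsP[].
by rewrite -ltnS rH -rG.
Qed.

(** Used to perturb a supporting functional [g] by an arbitrary [f]: after scaling, [f] decides only
    where [g] vanishes. *)
Lemma large_mult (S : {set T}) (f g : T -> R) :
  exists2 c, 0 <= c & forall t, t \in S -> g t < 0 -> f t + c * g t < 0.
Proof.
pose c := \sum_(t in S) `|f t / g t| + 1.
have c0 : 0 <= c by rewrite addr_ge0 // sumr_ge0.
exists c => // t tS gt.
have le : `|f t / g t| < c.
  rewrite /c (bigD1 t) //= -addrA ltrDl ltr_wpDl // sumr_ge0 //.
have := le; rewrite ltr_norml => /andP[h _].
have : c * g t < - (f t / g t) * g t by rewrite ltr_nM2r //; lra.
by rewrite mulNr divfK ?lt_eqF //; lra.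
Qed.

(* Rotating [l] around its values on [H] until it meets a new point. *)
Lemma swap S l k : valid S l -> valid S k -> (exists2 t, t \in S & ev t k != 0) ->
  exists l', [/\ valid S l', forall t, ev t k = 0 -> ev t l' = ev t l,
    (exists c, 0 <= c /\ l' = l - c *: k) &
    exists2 t, t \in S & ev t k != 0 /\ ev t l' = 0].
Proof.
move=> vl vk [t0 t0S k0].
pose Pt t := (t \in S) && (ev t k != 0).
have Pt0 : Pt t0 by rewrite /Pt t0S.
case: (Order.TotalTheory.arg_minP (fun t => ev t l / ev t k) Pt0) => t /andP[tS kt] min.
have neg s : s \in S -> ev s k != 0 -> ev s k < 0 by move=> sS; rewrite lt_neqAle vk // => ->.
set c := ev t l / ev t k in min.
have c0 : 0 <= c.
  have kn := neg _ tS kt; have := vl _ tS => ln.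
  by rewrite /c -divrNN divr_ge0 // oppr_ge0 // ltW.
exists (l - c *: k); split.
- move=> s sS; rewrite /ev !prE -/(ev s l) -/(ev s k).
  have [->|ks] := eqVneq (ev s k) 0; first by rewrite mulr0 subr0 vl.
  have := min s; rewrite /Pt sS ks => /(_ isT); rewrite ler_ndivlMr ?neg //.
  by rewrite subr_le0.
- by move=> s; rewrite /ev !prE => ->; rewrite mulr0 subr0.
- by exists c.
- exists t => //; split => //; rewrite /ev !prE -/(ev t l) -/(ev t k).
  by rewrite /c divfK // subrr.
Qed.

Lemma zs_rk S l : (exists2 t, t \in S & ev t l != 0) -> (rk (zs S l) < rk S)%N.
Proof.
move=> [t tS lt]; have : t |: zs S l \subset S by rewrite subUset sub1set tS zs_sub.
by move/rkS; rewrite (rk_add (l := l)) // => s /zsP[].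
Qed.

(** A proper face lies in a facet: tilting its functional until a new point is reached raises the
    rank of the zero set. *)
Lemma ext_facet S l : valid S l -> (exists2 t, t \in S & ev t l != 0) ->
  exists2 G, facet S G & zs S l \subset G.
Proof.
have [n] := ubnP (rk S - rk (zs S l)); elim: n l => // n IH l ln vl nz.
have lt := zs_rk nz.
have [eq|neq] := eqVneq (rk (zs S l)).+1 (rk S).
  by exists (zs S l) => //; exists l.
have {neq}lt2 : ((rk (zs S l)).+1 < rk S)%N by rewrite ltn_neqAle neq.
have [t tS lt0] := nz.
have tl : ev t l < 0 by rewrite lt_neqAle lt0 vl.
(* The tilt [m] also vanishes at [t], where [l] is negative, so the tilted functional stays nonzero
   at [t]. *)
have [m [m0 [s sS ms]]] : exists m, (forall t', t' \in t |: zs S l -> ev t' m = 0) /\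
    exists2 s, s \in S & ev s m != 0.
  by apply: exfun; apply: leq_ltn_trans (rkU1_le _ _) lt2.
wlog {ms} ms : m m0 / 0 < ev s m.
  move=> W; have [?|?|/eqP] := ltgtP (ev s m) 0; last by rewrite (negbTE ms).
    apply: (W (- m)); rewrite /ev ?prE ?oppr_gt0 // => t' /m0.
    by rewrite /ev prE => ->; rewrite oppr0.
  exact: (W m).
pose Pt t := (t \in S) && (0 < ev t m).
have Ps : Pt s by rewrite /Pt sS ms.
case: (Order.TotalTheory.arg_minP (fun t => - ev t l / ev t m) Ps) => r /andP[rS mr] min.
set c := - ev r l / ev r m in min.
have rl : ev r l != 0.
  apply/eqP => h; have : r \in t |: zs S l by rewrite !inE rS h eqxx orbT.
  by move/m0 => h'; rewrite h' ltxx in mr.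
have c0 : 0 <= c by rewrite divr_ge0 ?oppr_ge0 ?vl // ltW.
have E u : ev u (l + c *: m) = ev u l + c * ev u m by rewrite /ev !prE.
have z0 : zs S l \subset zs S (l + c *: m).
  apply/subsetP => u /zsP[uS u0]; apply/zsP; split => //.
  by rewrite E u0 m0 ?mulr0 ?addr0 // !inE uS u0 eqxx orbT.
have [|||G fG zG] := IH (l + c *: m).
- suff : (rk (zs S l) < rk (zs S (l + c *: m)))%N by move=> lt3; apply: leq_trans (ltn_sub2l lt lt3) _; rewrite -ltnS.
  have : r |: zs S l \subset zs S (l + c *: m).
    rewrite subUset z0 andbT sub1set; apply/zsP; split => //.
    by rewrite E /c divfK ?gt_eqF // subrr.
  by move/rkS; rewrite (rk_add (l := l)) // => u /zsP[].
- move=> u uS; rewrite E.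
  have [mu|mu] := leP (ev u m) 0.
    by have := vl u uS; have := mulr_ge0_le0 c0 mu; lra.
  have := min u; rewrite /Pt uS mu => /(_ isT); rewrite ler_pdivlMr //; lra.
- by exists t => //; rewrite E m0 ?mulr0 ?addr0 // setU11.
by exists G => //; apply: subset_trans zG.
Qed.

Lemma facet_nz S G k : zs S k = G -> (rk G).+1 = rk S ->
  exists2 t, t \in S & ev t k != 0.
Proof.
move=> <- h; apply: contrapT => h'.
have : zs S k = S.
  apply/eqP; rewrite eqEsubset zs_sub /=; apply/subsetP => t tS; apply/zsP; split => //.
  by apply/eqP; apply: contrapT => /negP nz; apply: h'; exists t.
by move=> E; move: h; rewrite E => /eqP; rewrite eqn_leq ltnn.
Qed.

(** If the facet found is [F], rotating [l] about its values on [F] until it vanishes at a point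
    outside [F] gives a larger face not contained in [F]. It is still proper, since a point of [F]
    off the original face keeps its negative value. *)
Lemma ext_facet_neq S l F : valid S l -> (exists2 t, t \in S & ev t l != 0) ->
  ((rk (zs S l)).+1 < rk S)%N -> exists2 G, facet S G & zs S l \subset G /\ G != F.
Proof.
move=> vl nz lt.
have [G fG zG] := ext_facet vl nz.
have [E|] := eqVneq G F; last by exists G.
subst G.
have [k [vk kF rF]] := fG.
have [t tF tz] : exists2 t, t \in F & t \notin zs S l.
  apply: contrapT => h; have : F \subset zs S l.
    by apply/subsetP => t tF; apply: contrapT => /negP tz; apply: h; exists t.
  by move/rkS; rewrite leqNgt -ltnS rF lt.
have [l' [vl' ev' _ [s sS [ks ls]]]] := swap vl vk (facet_nz kF rF).
have tS : t \in S by apply: (subsetP (zs_sub S k)); rewrite kF.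
have zsub : zs S l \subset zs S l'.
  apply/subsetP => u uz; have := subsetP zG u uz; rewrite -kF => /zsP[uS ku].
  by apply/zsP; split => //; rewrite ev' //; case/zsP: uz.
have [|G fG' zG'] := ext_facet vl'.
  exists t => //; rewrite ev'; last by move: tF; rewrite -kF => /zsP[].
  by apply: contra tz => /eqP h; apply/zsP.
exists G => //; split; first exact: subset_trans zG'.
apply: contra ks => /eqP GF; have : s \in zs S l' by apply/zsP.
by move/(subsetP zG'); rewrite GF -kF => /zsP[_ ->].
Qed.

Lemma indepD1 G t : rk G = #|G| -> t \in G -> rk (G :\ t) = #|G|.-1.
Proof.
move=> h tG; apply/eqP; rewrite eqn_leq; apply/andP; split.
  by apply: leq_trans (rk_card _) _; rewrite [#|G|](cardsD1 t) tG.
by have := rkU1_le t (G :\ t); rewrite setD1K // h; lia.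
Qed.

Lemma indepS G A : rk G = #|G| -> A \subset G -> rk A = #|A|.
Proof.
have [n] := ubnP (#|G :\: A|); elim: n G => // n IH G Gn h AG.
have [GA|[t tGA]] := set_0Vmem (G :\: A).
  have -> : A = G by apply/eqP; rewrite eqEsubset AG -setD_eq0 GA eqxx.
  exact: h.
have [tG tA] := setDP tGA.
apply: (IH (G :\ t)).
- move: Gn; rewrite (cardsD1 t (G :\: A)) tGA add1n ltnS; apply: leq_trans.
  rewrite ltnS; apply/subset_leq_card/subsetP => u; rewrite !inE.
  by move=> /andP[-> /andP[-> ->]].
- by rewrite indepD1 // (cardsD1 t G) tG.
- by rewrite subsetD1 AG.
Qed.

Lemma dualfun G t : rk G = #|G| -> t \in G ->
  exists2 m, (forall s, s \in G :\ t -> ev s m = 0) & ev t m = 1.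
Proof.
move=> h tG; have [m [m0 [s sG ms]]] : exists m, (forall s, s \in G :\ t -> ev s m = 0) /\
    exists2 s, s \in G & ev s m != 0.
  by apply: exfun; rewrite indepD1 // h (cardsD1 t) tG.
have st : s = t.
  by apply/eqP; apply: contraNT ms => st; rewrite m0 // !inE st.
subst s; exists ((ev t m)^-1 *: m); last by rewrite /ev prE mulVf.
by move=> s /m0; rewrite /ev prE => ->; rewrite mulr0.
Qed.

(** The functional [- m + c *: l], with [m] dual to [t] on [G], exposes the ridge [G :\ t]. Rotating
    it about its values on [G] until it meets a point outside [G] produces the neighbouring
    facet. *)
Lemma adj_facet S G t : facet S G -> rk G = #|G| -> t \in G ->
  exists2 H, facet S H & (G :\ t \subset H) /\ (t \notin H).
Proof.
move=> fG h tG; have GS := facet_sub fG; have [l [vl lG rG]] := fG.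
have [m m0 mt] := dualfun h tG.
have lz s : s \in G -> ev s l = 0 by rewrite -lG => /zsP[].
have [c c0 hc] := large_mult S (fun s => - ev s m) (fun s => ev s l).
have E s : ev s (- m + c *: l) = - ev s m + c * ev s l by rewrite /ev !prE.
have vl0 : valid S (- m + c *: l).
  move=> s sS; rewrite E; have [ls|] := eqVneq (ev s l) 0; last first.
    by move=> ls; apply/ltW/hc => //; rewrite lt_neqAle ls vl.
  rewrite ls mulr0 addr0; have sG : s \in G by rewrite -lG; apply/zsP.
  have [->|st] := eqVneq s t; first by rewrite mt oppr_le0.
  by rewrite m0 ?oppr0 // !inE st.
have [k [vk ek _ [s sS [ls ks]]]] := swap vl0 vl (facet_nz lG rG).
have kt : ev t k != 0 by rewrite ek ?lz // E mt lz // mulr0 addr0 oppr_eq0 oner_eq0.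
have zsub : s |: (G :\ t) \subset zs S k.
  rewrite subUset sub1set; apply/andP; split; first exact/zsP.
  apply/subsetP => u ut; have [_ uG] := setD1P ut.
  apply/zsP; split; first exact: (subsetP GS).
  by rewrite ek ?lz // E m0 // lz // mulr0 addr0 oppr0.
exists (zs S k); last first.
  split; first by apply: subset_trans zsub; apply: subsetUr.
  by apply/zsP => -[_ h0]; rewrite h0 eqxx in kt.
exists k; split => //; apply/eqP; rewrite eqn_leq zs_rk /=; last first.
  by exists t => //; apply: (subsetP GS).
have := rkS zsub; rewrite (rk_add (l := l)) //; last first.
  by move=> u /setD1P[_ /lz].
by rewrite indepD1 // -rG h; have := cardsD1 t G; rewrite tG => ->.
Qed.

End Config.

(** * Restriction maps and h-vectors *)

Lemma setDDK (T : finType) (t G : {set T}) : t \subset G -> G :\: (G :\: t) = t.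
Proof. by move=> tG; rewrite setDDr setDv set0U (setIidPr tG). Qed.

Lemma card_interval (T : finType) (A G : {set T}) k : A \subset G -> k <= #|G| ->
  #|[set t : {set T} | [&& A \subset t, t \subset G & #|t| == k]]| = 'C(#|G| - #|A|, #|G| - k).
Proof.
move=> AG kG; rewrite -(cardsDS AG) -cards_draws.
have inj : {in [set t : {set T} | (t \subset G :\: A) && (#|t| == #|G| - k)] &,
    injective (fun t => G :\: t)}.
  move=> s t; rewrite !inE => /andP[/subsetDP[sG _] _] /andP[/subsetDP[tG _] _] E.
  by rewrite -(setDDK sG) E setDDK.
rewrite -(card_in_imset inj); apply: eq_card => t; apply/idP/imsetP.
  rewrite inE => /and3P[At tG /eqP tk]; exists (G :\: t); last by rewrite setDDK.
  by rewrite inE cardsDS // tk eqxx andbT setDS.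
move=> [s]; rewrite !inE => /andP[/subsetDP[sG dis] /eqP sk] ->.
rewrite cardsDS // sk subKn // eqxx andbT subsetDl andbT.
by rewrite subsetD AG disjoint_sym.
Qed.

Lemma bin_bump q (i : 'I_q) : 'C(q - bump 0 i, q) = 0.
Proof. by rewrite bin_small // ltn_subrL /=; apply: leq_ltn_trans (ltn_ord i). Qed.

(** The matrix is unitriangular. Stopping at [J] matters: neighborliness gives the face numbers only
    up to half the dimension, and these already fix half of the h-vector. *)
Lemma binomial_transform_inj q (a b : nat -> nat) J : J <= q ->
  (forall j, j <= J -> \sum_(i < q.+1) a i * 'C(q - i, q - j) =
                       \sum_(i < q.+1) b i * 'C(q - i, q - j)) ->
  forall i, i <= J -> a i = b i.
Proof.
move=> Jq h i; have [n] := ubnP i; elim: n i => // n IH i; rewrite ltnS => le iJ.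
have iq : i < q.+1 by rewrite ltnS (leq_trans iJ).
have := h i iJ; rewrite (bigD1 (Ordinal iq)) //= [X in _ = X](bigD1 (Ordinal iq)) //= binn !muln1.
rewrite (eq_bigr (fun k : 'I_q.+1 => b k * 'C(q - k, q - i))) => [/addIn //|k].
rewrite -val_eqE /= neq_ltn => /orP[ki|ik].
  by rewrite IH // ?(leq_trans ki) // ltnW // (leq_trans ki).
by rewrite bin_small ?muln0 // ltn_sub2l // (leq_trans ik) // -ltnS.
Qed.

Lemma cardsU_D (T : finType) (A B : {set T}) : #|A :|: B| = #|A| + #|B :\: A|.
Proof.
rewrite cardsU cardsD addnBA ?subset_leq_card ?subsetIl //.
  by rewrite setIC.
Qed.

Section Complex.
Variables (T : finType) (fs : {set {set T}}) (F : {set T}) (d : nat).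
Hypothesis fsd : forall G, G \in fs -> #|G| = d.
Implicit Types (G H s t : {set T}) (u : T) (P : {set T} -> {set T}).

Definition Dl t := [exists G in fs, t \subset G].
(** These stand for the [j]-element faces of the link of [s], kept as full faces containing [s] so
    that no second complex is needed. *)
Definition faces s j := [set t | [&& Dl t, s \subset t & #|t| == #|s| + j]].
Definition ifaces s j := [set t in faces s j | ~~ (t \subset F)].
(* The h-vector of the link of [s], read off the sizes of the minimal new faces [P G :\: s]. *)
Definition hn P s i := #|[set G in fs | (s \subset G) && (#|P G :\: s| == i)]|.

(* The restriction map of a shelling-like order in which [F] comes last. *)
Definition sweep s P :=
  [/\ forall G, G \in fs -> P G \subset G,
      forall t, s \subset t -> Dl t ->
        #|[set G in fs | (P G \subset t) && (t \subset G)]| = 1 &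
      forall t, s \subset t -> Dl t ->
        #|[set G in fs | (G :\: P G \subset t) && (t \subset G)]| = ~~ (t \subset F)].

Lemma DlP t : reflect (exists2 G, G \in fs & t \subset G) (Dl t).
Proof. exact: exists_inP. Qed.

Lemma Dl_sub s t : s \subset t -> Dl t -> Dl s.
Proof. by move=> st /DlP[G Gf tG]; apply/DlP; exists G => //; apply: subset_trans tG. Qed.

(** Double counting: the facet [G] contributes the sets of the right size between [s :|: P G] and
    [G]. *)
Lemma sum_intervals P s q j : (forall G, G \in fs -> P G \subset G) ->
  #|s| + q = d -> j <= q ->
  \sum_(t in faces s j) #|[set G in fs | (P G \subset t) && (t \subset G)]| =
  \sum_(i < q.+1) hn P s i * 'C(q - i, q - j).
Proof.
move=> PG sq jq.
pose g t G : nat := [&& t \in faces s j, P G \subset t & t \subset G].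
transitivity (\sum_(G in fs) \sum_(t : {set T}) g t G).
  rewrite exchange_big /= [LHS]big_mkcond /=; apply: eq_bigr => t _.
  rewrite -sum1_card big_mkcond /=; case: ifP => tf; last first.
    by rewrite big1 // => G _; rewrite /g tf.
  rewrite [RHS]big_mkcond /=; apply: eq_bigr => G _; rewrite /g tf !inE.
  by case: (G \in fs) => //=; case: ifP.
transitivity (\sum_(G in fs | s \subset G) 'C(q - #|P G :\: s|, q - j)).
  rewrite big_mkcondr /=; apply: eq_bigr => G Gf; case: ifP => sG; last first.
    rewrite big1 // => t _; apply/eqP; rewrite eqb0; apply/negP => /and3P[].
    by rewrite inE => /and3P[_ st _] _ tG; rewrite (subset_trans st tG) in sG.
  have sPG : s :|: P G \subset G by rewrite subUset sG PG.
  have := card_interval sPG (k := #|s| + j).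
  rewrite (fsd Gf) -{1}sq leq_add2l jq => /(_ isT).
  rewrite cardsU_D. rewrite -sq subnDl subnDl => <-.
  rewrite -sum1_card [RHS]big_mkcond /=; apply: eq_bigr => t _.
  rewrite /g !inE subUset -!andbA; case tG: (t \subset G); rewrite ?andbF //= !andbT.
  have -> : Dl t by apply/DlP; exists G.
  by case: (s \subset t); case: (P G \subset t); case: (_ == _).
rewrite [LHS](eq_bigr (fun G => \sum_(i < q.+1 | #|P G :\: s| == i) 'C(q - i, q - j))).
  rewrite (exchange_big_dep xpredT) //=; apply: eq_bigr => i _.
  rewrite sum_nat_const /hn; congr (_ * _); apply: eq_card => G.
  by rewrite !inE andbA.
move=> G /andP[Gf sG].
have le : #|P G :\: s| < q.+1.
  rewrite ltnS; apply: leq_trans (subset_leq_card (setSD s (PG G Gf))) _.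
  by rewrite cardsDS // (fsd Gf) -sq addKn.
by rewrite (bigD1 (Ordinal le)) //= big1 ?addn0 // => k /andP[/eqP E]; rewrite -val_eqE /= E eqxx.
Qed.

Section Sweep.
Variables (P : {set T} -> {set T}) (s0 : {set T}) (q : nat).
Hypothesis sw : sweep s0 P.

Lemma sweep_sub s : s0 \subset s -> sweep s P.
Proof.
by case: sw => h1 h2 h3 ss; split => // t st; [apply: h2|apply: h3]; apply: subset_trans st.
Qed.

Hypothesis sq : #|s0| + q = d.

Lemma faces_hn j : j <= q -> #|faces s0 j| = \sum_(i < q.+1) hn P s0 i * 'C(q - i, q - j).
Proof.
case: sw => h1 h2 h3 jq; rewrite -(sum_intervals h1 sq jq) -sum1_card.
by apply: eq_bigr => t; rewrite inE => /and3P[Dt st _]; rewrite h2.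
Qed.

Lemma hn_compl i : i <= q -> hn (fun G => G :\: P G) s0 i = hn P s0 (q - i).
Proof.
case: sw => h1 _ _ iq; apply: eq_card => G; rewrite !inE.
case Gf: (G \in fs) => //=; case sG: (s0 \subset G) => //=.
have -> : (G :\: P G) :\: s0 = (G :\: s0) :\: (P G :\: s0).
  by apply/setP => u; rewrite !inE; case: (u \in s0); rewrite ?andbF //= andbT.
rewrite cardsDS; last by rewrite setSD // h1.
rewrite cardsDS // (fsd Gf) -sq addKn.
have : #|P G :\: s0| <= q.
  apply: leq_trans (subset_leq_card (setSD s0 (h1 G Gf))) _.
  by rewrite cardsDS // (fsd Gf) -sq addKn.
by move=> le; apply/eqP/eqP; move: le iq; lia.
Qed.

Lemma ifaces_hn j : j <= q ->
  #|ifaces s0 j| = \sum_(i < q.+1) hn P s0 (q - i) * 'C(q - i, q - j).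
Proof.
case: (sw) => h1 h2 h3 jq.
transitivity (\sum_(i < q.+1) hn (fun G => G :\: P G) s0 i * 'C(q - i, q - j)); last first.
  by apply: eq_bigr => i _; rewrite hn_compl // -ltnS.
rewrite -(sum_intervals _ sq jq) => [|G _]; last exact: subsetDl.
rewrite -sum1_card big_mkcond [RHS]big_mkcond /=; apply: eq_bigr => t _.
rewrite inE; case: (boolP (t \in _)) => //=; rewrite inE => /and3P[Dt st _].
by rewrite h3 //; case: (t \subset F).
Qed.

(** Dehn-Sommerville relations: every face containing [s0] is interior, so [faces_hn] and
    [ifaces_hn] express the same numbers through the h-vector and through its reversal. *)
Lemma hn_sym i : ~~ (s0 \subset F) -> i <= q -> hn P s0 i = hn P s0 (q - i).
Proof.
move=> sF iq; apply: (@binomial_transform_inj q (hn P s0) (fun k => hn P s0 (q - k)) q _ _ i) => // j jq.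
rewrite -faces_hn // -(ifaces_hn jq); apply: eq_card => t.
rewrite [RHS]inE; case: (boolP (t \in faces _ _)) => //=; rewrite inE => /and3P[Dt st _].
by apply/esym; apply: contra sF => tF; apply: subset_trans tF.
Qed.

Lemma hn0_sphere : Dl s0 -> hn P s0 0 = 1.
Proof.
move=> Ds; have := faces_hn (leq0n q); rewrite big_ord_recl /= subn0 binn muln1 big1.
  rewrite addn0 => <-; rewrite -(cards1 s0); apply: eq_card => t; rewrite !inE addn0.
  apply/and3P/eqP => [[_ st /eqP ts]|->]; last by rewrite Ds subxx.
  by apply/esym/eqP; rewrite eqEcard st ts leqnn.
by move=> i _; rewrite bin_bump muln0.
Qed.

(** McMullen's identity. If [P G :\: s0] has [r] elements, then removing one of these [r] vertices
    leaves a restriction set of size [r - 1] in its link, and each of the other [q - r] vertices of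
    [G :\: s0] leaves one of size [r]. *)
Lemma hn_sum i : i < q -> \sum_(u | u \notin s0) hn P (u |: s0) i =
  i.+1 * hn P s0 i.+1 + (q - i) * hn P s0 i.
Proof.
case: (sw) => h1 _ _ iq.
pose r G := #|P G :\: s0|.
transitivity (\sum_(G in fs | s0 \subset G) \sum_(u in G :\: s0 | #|P G :\: (u |: s0)| == i) 1).
  rewrite (eq_bigr (fun u => \sum_(G in fs | (u |: s0 \subset G) && (#|P G :\: (u |: s0)| == i)) 1)).
    rewrite (exchange_big_dep (fun G => (G \in fs) && (s0 \subset G))) /=.
      apply: eq_bigr => G /andP[Gf sG]; apply: eq_bigl => u.
      by rewrite Gf subUset sub1set sG andbT in_setD /= andbA.
    by move=> u G us /and3P[-> ]; rewrite subUset => /andP[_ ->].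
  move=> u us; rewrite /hn -sum1_card; apply: eq_bigl => G; by rewrite !inE.
transitivity (\sum_(G in fs | s0 \subset G) (i.+1 * (r G == i.+1) + (q - i) * (r G == i))).
  apply: eq_bigr => G /andP[Gf sG]; rewrite sum1_card.
  have PG := h1 G Gf; have cG : #|G :\: s0| = q by rewrite cardsDS // (fsd Gf) -sq addKn.
  have E u : u \in G :\: s0 -> #|P G :\: (u |: s0)| = r G - (u \in P G).
    rewrite inE => /andP[us uG]; rewrite setUC -setDDl /r.
    by rewrite [#|P G :\: s0|](cardsD1 u) inE us /= addKn.
  have rq : r G <= q by rewrite -cG; apply/subset_leq_card/setSD.
  have [ri|ri] := eqVneq (r G) i.+1.
    have ne : (r G == i) = false by rewrite ri; apply/negbTE; lia.
    rewrite muln1 ne muln0 addn0 -ri.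
    rewrite /r; apply: eq_card => u; rewrite unfold_in /= !inE.
    case: (boolP (u \in s0)) => us //=.
    case: (boolP (u \in G)) => uG /=; last by apply/esym/negbTE; apply: contra uG; apply: (subsetP PG).
    by rewrite E ?inE ?us // ri; case: (u \in P G); rewrite ?subn1 ?subn0 ?eqxx //=; lia.
  rewrite muln0 add0n; have [ri'|ri'] := eqVneq (r G) i.
    rewrite muln1 -cG -[in RHS]ri' /r -cardsDS ?setSD //; apply: eq_card => u.
    rewrite unfold_in /= !inE; case: (boolP (u \in s0)) => us /=; first by rewrite ?andbF.
    case: (boolP (u \in G)) => uG /=; last by rewrite ?andbF.
    rewrite E ?inE ?us // ri' andbT; case: (boolP (u \in P G)) => uP /=; last by rewrite subn0 eqxx.
    have : 0 < r G by rewrite /r card_gt0; apply/set0Pn; exists u; rewrite inE us.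
    by rewrite ri'; lia.
  rewrite muln0; apply: eq_card0 => u; apply/negP => /andP[ug].
  by rewrite E //; case: (u \in P G); move: ri ri'; lia.
rewrite big_split /= -!big_distrr /=; congr (_ * _ + _ * _);
  rewrite -big_mkcondr /= sum1_card; apply: eq_card => G; by rewrite !inE andbA.
Qed.
End Sweep.

(** Since the h-numbers do not depend on the sweep, a different sweep may be chosen for each vertex
    in the inequalities below. *)
Lemma hn_unique P P' s q i : sweep s P -> sweep s P' -> #|s| + q = d -> i <= q ->
  hn P s i = hn P' s i.
Proof.
move=> w w' sq iq; apply: (@binomial_transform_inj q (hn P s) (hn P' s) q _ _ i) => // j jq.
by rewrite -!faces_hn.
Qed.

End Complex.

(* Locked, so that unfolding membership in finite sets stops at [fs]. *)
HB.lock Definition fs (R : realFieldType) (N : nat) (T : finType) (v : T -> 'rV[R]_N)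
  (S F : {set T}) : {set {set T}} := [set G | `[< facet v S G >] && (G != F)].

Lemma fsP (R : realFieldType) (N : nat) (T : finType) (v : T -> 'rV[R]_N) (S F G : {set T}) :
  reflect (facet v S G /\ G <> F) (G \in fs v S F).
Proof.
by rewrite fs.unlock inE; apply: (iffP andP) => -[/asboolP fG /eqP GF].
Qed.

(** * Sweeping the facets by a linear objective on the polar polytope *)

Section SweepGeometry.
Local Open Scope ring_scope.
Variables (R : realFieldType) (d : nat) (T : finType) (v : T -> 'rV[R]_d.+1).
Variables (S F : {set T}).
Hypothesis full : rk v S = d.+1.
Hypothesis simp : forall G, facet v S G -> G <> F -> #|G| = d.
Implicit Types (A B G H s t : {set T}) (l k : 'cV[R]_d.+1) (u : T).
Local Notation ev := (ev v).

Local Notation fs := (fs v S F).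

Lemma fs_card G : G \in fs -> #|G| = d.
Proof. by move/fsP => [/simp h /h]. Qed.

Lemma facet_rk G : facet v S G -> rk v G = d.
Proof. by case=> l [_ _]; rewrite full => -[]. Qed.

Lemma fs_indep G : G \in fs -> rk v G = #|G|.
Proof. by move=> Gf; rewrite fs_card // facet_rk //; case/fsP: Gf. Qed.

Definition interior (O : 'rV[R]_d.+1) := forall l, valid v S l ->
  (exists2 t, t \in S & ev t l != 0) -> pr O l < 0.

(** Facet functionals normalized to [-1] at the interior point [O] are the vertices of the polar
    polytope, on which [w] is a linear objective. The condition puts [F] strictly above all other
    facets through [s]. *)
Definition topF s (O w : 'rV[R]_d.+1) := forall k l G, facet v S F -> s \subset F ->
  G \in fs -> s \subset G -> valid v S k -> zs v S k = G -> pr O k = -1 ->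
  valid v S l -> zs v S l = F -> pr O l = -1 -> pr w k < pr w l.

Section Fixed.
Variables (s0 : {set T}) (O w0 : 'rV[R]_d.+1).
Hypothesis intO : interior O.
Hypothesis top0 : topF s0 O w0.
Hypothesis s0F : s0 \subset F -> facet v S F.

Lemma ex_lf : exists lf : {set T} -> 'cV[R]_d.+1, forall G, facet v S G ->
  [/\ valid v S (lf G), zs v S (lf G) = G & pr O (lf G) = -1].
Proof.
suff : forall G, exists l, facet v S G -> [/\ valid v S l, zs v S l = G & pr O l = -1].
  by move/choice => [f fP]; exists f.
move=> G; have [fG|] := pselect (facet v S G); last by exists 0.
have [l [vl lG rG]] := fG.
have nO : pr O l < 0 by apply: intO => //; apply: facet_nz lG rG.
exists (- (pr O l)^-1 *: l) => _; split.
- move=> t tS; rewrite /ev prE mulNr oppr_le0 nmulr_rge0 ?invr_lt0 //; exact: vl.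
- rewrite -lG; apply/setP => t; rewrite !inE /ev prE mulf_eq0 oppr_eq0 invr_eq0.
  by rewrite (lt_eqF nO).
- by rewrite prE mulNr mulVf // lt_eqF.
Qed.

(** In the polar polytope, [- k] is the direction of the edge that leaves the vertex [G] across the
    ridge [G :\ u]. *)
Lemma ex_kappa G u : G \in fs -> u \in G -> exists k,
  [/\ forall r, r \in G :\ u -> ev r k = 0, pr O k = 0 & ev u k = 1].
Proof.
move=> Gf uG; have [fG _] := fsP _ _ _ _ Gf; have [l [vl lG rG]] := fG.
have nO : pr O l < 0 by apply: intO => //; apply: facet_nz lG rG.
have lz r : r \in G -> ev r l = 0 by rewrite -lG => /zsP[].
have [m m0 mu] := dualfun (fs_indep Gf) uG.
exists (m - (pr O m / pr O l) *: l).
have E r : ev r (m - (pr O m / pr O l) *: l) = ev r m - (pr O m / pr O l) * ev r l.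
  by rewrite /ev !prE.
split.
- move=> r ru; rewrite E m0 // lz ?mulr0 ?subr0 //; by case/setD1P: ru.
- by rewrite !prE divfK ?subrr // lt_eqF.
- by rewrite E mu lz // mulr0 subr0.
Qed.

Lemma ex_kf : exists kf : {set T} -> T -> 'cV[R]_d.+1, forall G, G \in fs -> forall u, u \in G ->
  [/\ forall r, r \in G :\ u -> ev r (kf G u) = 0, pr O (kf G u) = 0 & ev u (kf G u) = 1].
Proof.
suff : forall Gu : {set T} * T, exists k, Gu.1 \in fs -> Gu.2 \in Gu.1 ->
  [/\ forall r, r \in Gu.1 :\ Gu.2 -> ev r k = 0, pr O k = 0 & ev Gu.2 k = 1].
  by move/choice => [f fP]; exists (fun G u => f (G, u)) => G Gf u uG; apply: (fP (G, u)).
move=> [G u] /=; have [Gf|Gf] := boolP (G \in fs); last by exists 0.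
have [uG|uG] := boolP (u \in G); last by exists 0.
by have [k kP] := ex_kappa Gf uG; exists k.
Qed.

Variables (lf : {set T} -> 'cV[R]_d.+1) (kf : {set T} -> T -> 'cV[R]_d.+1).
Hypothesis lfP : forall G, facet v S G ->
  [/\ valid v S (lf G), zs v S (lf G) = G & pr O (lf G) = -1].
Hypothesis kfP : forall G, G \in fs -> forall u, u \in G ->
  [/\ forall r, r \in G :\ u -> ev r (kf G u) = 0, pr O (kf G u) = 0 & ev u (kf G u) = 1].

Lemma lf_mem G r : facet v S G -> r \in G -> ev r (lf G) = 0.
Proof. by move=> /lfP[_ {2}<- _] /zsP[]. Qed.

Lemma lf_neg G r : facet v S G -> r \in S -> r \notin G -> ev r (lf G) < 0.
Proof.
move=> /lfP[vl lG _] rS; rewrite -{1}lG => rG; rewrite lt_neqAle vl // andbT.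
by apply: contra rG => /eqP h; apply/zsP.
Qed.

(** The vectors [v u] for [u] in [G], together with [O], form a basis whose dual basis consists of
    the [kf G u] and [- lf G]; the right-hand side is the pairing in these coordinates. *)
Lemma expand G x l : G \in fs ->
  pr x l = - pr x (lf G) * pr O l + \sum_(u in G) pr x (kf G u) * ev u l.
Proof.
move=> Gf; have [fG _] := fsP _ _ _ _ Gf; have [vl lG lO] := lfP fG.
pose y := x + pr x (lf G) *: O - \sum_(u in G) pr x (kf G u) *: v u.
have kk u (t : T) : u \in G -> t \in G -> ev t (kf G u) = (t == u)%:R.
  move=> uG tG; have [h1 _ h2] := kfP Gf uG.
  by have [->|tu] := eqVneq t u; [rewrite h2|rewrite h1 // !inE tu].
have sumE k : pr (\sum_(u in G) pr x (kf G u) *: v u) k = \sum_(u in G) pr x (kf G u) * ev u k.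
  by rewrite pr_suml; apply: eq_bigr => u _; rewrite prZl.
have yl : pr y (lf G) = 0.
  rewrite /y !prE sumE lO mulrN1 subrr sub0r big1 ?oppr0 // => u uG.
  by rewrite lf_mem // mulr0.
have yk u : u \in G -> pr y (kf G u) = 0.
  move=> uG; have [_ h _] := kfP Gf uG.
  rewrite /y !prE sumE h mulr0 addr0 (bigD1 u) //= kk // eqxx mulr1 big1 ?addr0 ?subrr //.
  by move=> t /andP[tG tu]; rewrite kk // (negbTE tu) mulr0.
have yG : (y <= spanm v G)%MS.
  have l0 : lf G != 0.
    by apply/eqP => h; move: lO; rewrite h pr0r => /eqP; rewrite eq_sym oppr_eq0 oner_eq0.
  have sub : (spanm v G <= kermx (lf G))%MS.
    apply/sumsmx_subP => t tG; rewrite genmxE; apply/sub_kermxP/matrixP => i j.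
    by rewrite !ord1 [RHS]mxE; exact: lf_mem.
  have rl : \rank (lf G) = 1%N.
    by apply/eqP; rewrite eqn_leq rank_leq_col lt0n mxrank_eq0.
  have : (kermx (lf G) <= spanm v G)%MS.
    have := mxrank_leqif_sup sub; move=> /geq_leqif <-.
    by rewrite mxrank_ker rl subn1 /= -[\rank (spanm v G)]/(rk v G) facet_rk.
  apply: submx_trans; apply/sub_kermxP/matrixP => i j.
  by rewrite !ord1 [RHS]mxE; exact: yl.
have y0 : y = 0.
  case/sub_sumsmxP: yG => c yE.
  have {}yE : exists a : T -> R, y = \sum_(u in G) a u *: v u.
    have : forall u, exists a : R, c u *m <<v u>>%MS = a *: v u.
      move=> u; have /sub_rVP[a h] : (c u *m <<v u>>%MS <= v u)%MS.
        by apply: submx_trans (submxMl _ _) _; rewrite genmxE.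
      by exists a.
    move/choice => [a aP]; exists a; rewrite yE; apply: eq_bigr => u _; exact: aP.
  case: yE => a yE.
  have a0 u : u \in G -> a u = 0.
    move=> uG; have := yk u uG; rewrite yE pr_suml (bigD1 u) //= prZl -/(ev _ _) kk // eqxx mulr1.
    rewrite big1 ?addr0 // => t /andP[tG tu]; by rewrite prZl -/(ev _ _) kk // (negbTE tu) mulr0.
  by rewrite yE big1 // => u /a0->; rewrite scale0r.
have : pr y l = 0 by rewrite y0 pr0l.
rewrite /y !prE sumE => /eqP; rewrite subr_eq0 => /eqP <-.
by rewrite mulNr addrC addrK.
Qed.

(** By [step_phi], [u] belongs to this set exactly when the neighbour of [G] across [G :\ u] has a
    smaller objective value, that is, comes earlier. *)
Definition res x G := [set u in G | 0 < pr x (kf G u)].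
Definition gen x := forall G, G \in fs -> forall u, u \in G -> pr x (kf G u) != 0.

Lemma step_phi x G H : G \in fs -> facet v S H ->
  pr x (lf H) = pr x (lf G) + \sum_(u in G) pr x (kf G u) * ev u (lf H).
Proof.
by move=> Gf fH; rewrite (expand x (lf H) Gf); case: (lfP fH) => _ _ ->; rewrite mulrN1 opprK.
Qed.

(** A local minimum of a linear objective is global: if no edge inside the polar face of [t]
    improves on [G], then every summand in [step_phi] is nonnegative, and genericity gives
    uniqueness. The competitor [H] may be [F]. *)
Lemma res_min x t G H : gen x -> G \in fs -> facet v S H -> res x G \subset t ->
  t \subset G -> t \subset H ->
  pr x (lf G) <= pr x (lf H) /\ (pr x (lf G) = pr x (lf H) -> G = H).
Proof.
move=> gx Gf fH Pt tG tH; have [fG _] := fsP _ _ _ _ Gf.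
have GS := facet_sub fG.
have term u : u \in G -> 0 <= pr x (kf G u) * ev u (lf H).
  move=> uG; have [ut|ut] := boolP (u \in t).
    by rewrite (lf_mem fH) ?mulr0 // (subsetP tH).
  apply: mulr_le0; last by case: (lfP fH) => vl _ _; apply: vl; apply: (subsetP GS).
  rewrite leNgt; apply: contra ut => h; apply: (subsetP Pt); by rewrite inE uG.
rewrite (step_phi x Gf fH); split; first by rewrite lerDl sumr_ge0.
move/eqP; rewrite -subr_eq0 opprD addNKr oppr_eq0 => /eqP E.
apply: (facet_inj fG fH); apply/subsetP => u uG.
have /eqP := psumr_eq0P term E uG.
rewrite mulf_eq0 (negbTE (gx _ Gf _ uG)) /= => h.
apply: contraT => uH; have := lf_neg fH (subsetP GS u uG) uH.
by rewrite (eqP h) ltxx.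
Qed.

Lemma fs_adj x G u : G \in fs -> u \in res x G -> exists H,
  [/\ facet v S H, G :\ u \subset H, u \notin H & pr x (lf H) < pr x (lf G)].
Proof.
move=> Gf; rewrite inE => /andP[uG xu]; have [fG _] := fsP _ _ _ _ Gf.
have [H fH [GH uH]] := adj_facet fG (fs_indep Gf) uG.
exists H; split => //; rewrite (step_phi x Gf fH) -ltrBrDl subrr (bigD1 u) //= big1.
  by rewrite addr0 pmulr_rlt0 //; apply: lf_neg => //; apply: (subsetP (facet_sub fG)).
move=> t /andP[tG tu]; rewrite (lf_mem fH) ?mulr0 //; apply: (subsetP GH).
by rewrite !inE tu.
Qed.

(** With [C] all facets through [t] this is the existence half of the interval partition. Allowing
    any [C] closed under adjacency across ridges off [F] makes it yield connectedness as well. *)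
Lemma sweep_ex x t (C : {set {set T}}) : gen x -> (t \subset F -> facet v S F) ->
  (facet v S F -> t \subset F -> forall G, G \in fs -> t \subset G -> pr x (lf G) < pr x (lf F)) ->
  (exists G, G \in C) -> (forall G, G \in C -> G \in fs /\ t \subset G) ->
  (forall G H, G \in C -> H \in fs -> t \subset H -> #|G :&: H| = d.-1 ->
    ~~ (G :&: H \subset F) -> H \in C) ->
  exists2 G, G \in C & res x G \subset t.
Proof.
move=> gx tF top [G0 G0C] Cs Cc.
case: (Order.TotalTheory.arg_minP (fun G => pr x (lf G)) G0C) => G GC min.
have [Gf tG] := Cs G GC.
exists G => //; apply/subsetP => u uG; apply: contraT => ut.
have [H [fH GH uH lt]] := fs_adj Gf uG.
(* Otherwise the neighbour across this ridge would be [F], which lies above [G], whereas crossing at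
   a vertex of [res x G] goes down. *)
have GF : ~~ (G :\ u \subset F).
  apply: contraL uG => GF; have tF' : t \subset F by apply: subset_trans GF; rewrite subsetD1 tG.
  have fF := tF tF'; have := top fF tF' G Gf tG; rewrite (step_phi x Gf fF) ltrDl inE.
  apply: contraL => /andP[uG xu]; rewrite -leNgt (bigD1 u) //= big1 ?addr0 => [|r /andP[rG ru]].
    by rewrite pmulr_rle0 //; case: (lfP fF) => vF _ _; apply: vF; apply: (subsetP (facet_sub (fsP _ _ _ _ Gf).1)).
  by rewrite (lf_mem fF) ?mulr0 //; apply: (subsetP GF); rewrite !inE ru.
have {}uG : u \in G by move: uG; rewrite inE => /andP[].
have tH : t \subset H by apply: subset_trans GH; rewrite subsetD1 tG.
have HF : H <> F by move=> E; subst H; have := top fH tH G Gf tG; rewrite ltNge ltW.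
have HC : H \in C.
  have E : G :&: H = G :\ u.
    apply/eqP; rewrite eqEsubset subsetI GH subsetDl subsetD1 subsetIl inE (negbTE uH) andbF.
    by [].
  apply: (Cc G); rewrite ?E //; first exact/fsP.
  by have := cardsD1 u G; rewrite uG fs_card // => ->.
by have := min H HC; rewrite leNgt lt.
Qed.

Lemma sweep_cnt x t : gen x -> (t \subset F -> facet v S F) ->
  (facet v S F -> t \subset F -> forall G, G \in fs -> t \subset G -> pr x (lf G) < pr x (lf F)) ->
  Dl fs t -> #|[set G in fs | (res x G \subset t) && (t \subset G)]| = 1%N.
Proof.
move=> gx tF top /DlP[G0 G0f tG0].
have [|||G] := @sweep_ex x t [set G in fs | t \subset G] gx tF top.
- by exists G0; rewrite inE G0f.
- by move=> G; rewrite inE => /andP[].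
- by move=> G H _ Hf tH _ _; rewrite inE Hf.
rewrite inE => /andP[Gf tG] PG; rewrite -(cards1 G); apply: eq_card => H; rewrite in_set1 in_set.
apply/and3P/eqP => [[Hf PH tH]|->//].
have [fG _] := fsP _ _ _ _ Gf; have [fH _] := fsP _ _ _ _ Hf.
have [h1 h2] := res_min gx Gf fH PG tG tH; have [h3 _] := res_min gx Hf fG PH tH tG.
by apply/esym/h2/eqP; rewrite eq_le h1 h3.
Qed.

Lemma ex_w : exists w, [/\ gen w,
  (forall G, G \in fs -> forall u, u \in G -> samesgn w0 w (kf G u)) &
  facet v S F -> s0 \subset F -> forall G, G \in fs -> s0 \subset G -> pr w (lf G) < pr w (lf F)].
Proof.
(* The differences [lf F - lf G] are included so that the perturbation leaves [F] on top. *)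
pose K := [seq kf p.1 p.2 | p <- enum [set: {set T} * T]] ++
          [seq lf F - lf G | G <- enum [set: {set T}]].
have [w wP] := generic K w0.
have Kk G u : kf G u \in K.
  by rewrite mem_cat; apply/orP; left; apply/mapP; exists (G, u); rewrite // mem_enum inE.
have Kl G : lf F - lf G \in K.
  by rewrite mem_cat; apply/orP; right; apply/mapP; exists G; rewrite // mem_enum inE.
exists w; split.
- move=> G Gf u uG; apply: (wP _ (Kk G u)).1.
  have [_ _ h] := kfP Gf uG; apply/eqP => h0; move: h; rewrite h0 /ev pr0r => /eqP.
  by rewrite eq_sym oner_eq0.
- by move=> G Gf u uG; apply: (wP _ (Kk G u)).2.
- move=> fF sF G Gf sG; have [fG _] := fsP _ _ _ _ Gf.
  have [a1 a2 a3] := lfP fG; have [b1 b2 b3] := lfP fF.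
  have h := top0 fF sF Gf sG a1 a2 a3 b1 b2 b3.
  have := (wP _ (Kl G)).2.1; rewrite !prE !subr_gt0; exact.
Qed.

Lemma fixed_sweep : exists P, [/\ sweep fs F s0 P,
  forall G u k, G \in fs -> u \in G -> (forall r, r \in G :\ u -> ev r k = 0) ->
     pr O k = 0 -> ev u k = 1 ->
     (0 < pr w0 k -> u \in P G) /\ (pr w0 k < 0 -> u \notin P G) &
  forall C : {set {set T}}, (exists G, G \in C) -> (forall G, G \in C -> G \in fs /\ s0 \subset G) ->
    (forall G H, G \in C -> H \in fs -> s0 \subset H -> #|G :&: H| = d.-1 ->
    ~~ (G :&: H \subset F) -> H \in C) ->
    exists2 G, G \in C & P G \subset s0].
Proof.
have [w [gw sw top]] := ex_w.
exists (res w); split; last 1 first.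
- by move=> C; apply: sweep_ex.
- split.
  + by move=> G _; apply/subsetP => u; rewrite inE => /andP[].
  + move=> t st Dt; apply: sweep_cnt => // [tF|fF tF G Gf tG].
      exact/s0F/(subset_trans st).
    by apply: top => //; apply: subset_trans st _.
  + move=> t st Dt.
    have gNw : gen (- w) by move=> G Gf u uG; rewrite prE oppr_eq0 gw.
    have resN G : G \in fs -> G :\: res w G = res (- w) G.
      move=> Gf; apply/setP => u; rewrite !inE; case uG: (u \in G); rewrite ?andbF //= andbT.
      rewrite prE oppr_gt0 -leNgt le_eqVlt; have := gw G Gf u uG.
      by move/negbTE => ->.
    have -> : [set G in fs | (G :\: res w G \subset t) && (t \subset G)] =
              [set G in fs | (res (- w) G \subset t) && (t \subset G)].
      by apply/setP => G; rewrite [LHS]in_set [RHS]in_set; case Gf: (G \in fs) => //=; rewrite resN.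
    case tF: (t \subset F) => /=; last first.
      by apply: sweep_cnt => //; rewrite tF.
    (* For the objective [- w], [F] is the strict minimum among the facets through a subset of [F]
       that contains [s0], so by [res_min] no other facet can own such a set. *)
    apply/eqP; rewrite cards_eq0; apply/eqP/setP => G; rewrite in_set in_set0.
    apply/negP => /and3P[Gf PG tG].
    have sF := subset_trans st tF; have fF := s0F sF.
    have [h _] := res_min gNw Gf fF PG tG tF.
    have := top fF sF G Gf (subset_trans st tG).
    by move: h; rewrite !prE lerN2 ltNge => ->.
- move=> G u k Gf uG k0 kO ku.
  have E x : pr x k = pr x (kf G u).
    rewrite (expand x k Gf) kO mulr0 add0r (bigD1 u) //= ku mulr1 big1 ?addr0 //.
    by move=> t /andP[tG tu]; rewrite k0 ?mulr0 // !inE tu.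
  have [s1 s2] := sw G Gf u uG; rewrite !E !inE uG /=; split => //.
  by move/s2 => h; rewrite -leNgt ltW.
Qed.

End Fixed.

Lemma sweep_exists s0 O w0 : interior O -> topF s0 O w0 -> (s0 \subset F -> facet v S F) ->
  exists P, [/\ sweep fs F s0 P,
  forall G u k, G \in fs -> u \in G -> (forall r, r \in G :\ u -> ev r k = 0) ->
     pr O k = 0 -> ev u k = 1 ->
     (0 < pr w0 k -> u \in P G) /\ (pr w0 k < 0 -> u \notin P G) &
  forall C : {set {set T}}, (exists G, G \in C) -> (forall G, G \in C -> G \in fs /\ s0 \subset G) ->
    (forall G H, G \in C -> H \in fs -> s0 \subset H -> #|G :&: H| = d.-1 ->
    ~~ (G :&: H \subset F) -> H \in C) ->
    exists2 G, G \in C & P G \subset s0].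
Proof.
move=> iO top sF; have [lf lfP] := ex_lf iO; have [kf kfP] := ex_kf iO.
exact: (fixed_sweep top sF lfP kfP).
Qed.

End SweepGeometry.

Section SpecialSweeps.
Local Open Scope ring_scope.
Variables (R : realFieldType) (d : nat) (T : finType) (v : T -> 'rV[R]_d.+1).
Variables (S F : {set T}).
Hypothesis full : rk v S = d.+1.
Hypothesis simp : forall G, facet v S G -> G <> F -> #|G| = d.
Local Notation ev := (ev v).
Local Notation fs := (fs v S F).
Local Notation facet := (facet v).
Implicit Types (G H s : {set T}) (u : T).

Let z := \sum_(t in S) v t.
(** As a direction, [b] pairs to zero with the functional of [F] and negatively with that of any
    other facet, which places [F] last. *)
Let b := \sum_(t in F) v t.

Lemma interior_sum : interior v S z.
Proof.
move=> l vl [t tS lt]; rewrite /z pr_suml (bigD1 t) //=.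
have : \sum_(i in S | i != t) pr (v i) l <= 0 by apply: sumr_le0 => i /andP[iS _]; exact: vl.
have : ev t l < 0 by rewrite lt_neqAle lt vl.
by rewrite -/(ev t l); lra.
Qed.

Lemma interior_add M u : 0 <= M -> u \in S -> interior v S (M *: v u + z).
Proof.
move=> M0 uS l vl nz; rewrite !prE; have := interior_sum vl nz.
by have := mulr_ge0_le0 M0 (vl u uS); rewrite /ev; lra.
Qed.

Lemma sumF_facet l : zs v S l = F -> pr b l = 0.
Proof. by move=> lF; rewrite pr_suml big1 // => t; rewrite -{1}lF => /zsP[]. Qed.

Lemma sumF_other k G : facet S F -> G \in fs -> valid v S k -> zs v S k = G -> pr b k < 0.
Proof.
move=> fF /fsP[fG GF] vk kG; have FS := facet_sub fF.
have [t tF tG] : exists2 t, t \in F & t \notin G.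
  apply: contrapT => h; apply: GF; apply/esym/(facet_inj fF fG)/subsetP => t tF.
  by apply: contraT => tG; case: h; exists t.
have kt : ev t k < 0.
  rewrite lt_neqAle vk ?(subsetP FS) // andbT; apply: contra tG => /eqP h.
  by rewrite -kG; apply/zsP; split => //; apply: (subsetP FS).
have : \sum_(i in F | i != t) pr (v i) k <= 0.
  by apply: sumr_le0 => i /andP[iF _]; apply: vk; apply: (subsetP FS).
by move: kt; rewrite pr_suml (bigD1 t tF) /= /ev; lra.
Qed.

Lemma topF_sum s O : topF v S F s O b.
Proof.
move=> k l G fF sF Gf sG vk kG _ vl lF _.
by rewrite (sumF_facet lF); apply: sumF_other kG.
Qed.

Lemma topF_none s O w : ~~ (s \subset F) -> topF v S F s O w.
Proof. by move=> /negP sF k l G fF sF'. Qed.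

Lemma sweep0 s : (s \subset F -> facet S F) -> exists P, sweep fs F s P.
Proof.
move=> sF; have [P [h _ _]] := sweep_exists full simp interior_sum (@topF_sum s z) sF.
by exists P.
Qed.

(** If [C] missed a facet, both [C] and its complement would be closed under adjacency and each
    would contain a facet whose restriction set lies in [s]; a sweep has only one such facet through
    [s]. *)
Lemma fs_connected s (C : {set {set T}}) : (s \subset F -> facet S F) ->
  (exists G, G \in C) -> (forall G, G \in C -> G \in fs /\ s \subset G) ->
  (forall G H, G \in C -> H \in fs -> s \subset H -> #|G :&: H| = d.-1 ->
    ~~ (G :&: H \subset F) -> H \in C) ->
  forall G, G \in fs -> s \subset G -> G \in C.
Proof.
move=> sF C0 Cs Cc G Gf sG; apply: contraT => GC.
have [P [[P1 P2 P3] _ h]] := sweep_exists full simp interior_sum (@topF_sum s z) sF.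
have [G1 G1C P1s] := h C C0 Cs Cc.
have [|||G2 G2C P2s] := h [set G in fs | (s \subset G) && (G \notin C)].
- by exists G; rewrite in_set Gf sG.
- by move=> H; rewrite in_set => /and3P[].
- move=> H K; rewrite in_set => /and3P[Hf sH HC] Kf sK HK HKF.
  rewrite in_set Kf sK /=; apply: contra HC => KC.
  by apply: (Cc K) => //; rewrite setIC.
have [G1f sG1] := Cs G1 G1C; move: G2C; rewrite in_set => /and3P[G2f sG2 G2C].
have /eqP/cards1P[K KE] := P2 s (subxx _) (introT (DlP _ _) (ex_intro2 _ _ G Gf sG)).
have : G1 \in [set K] by rewrite -KE in_set G1f P1s.
have : G2 \in [set K] by rewrite -KE in_set G2f P2s.
by rewrite !in_set1 => /eqP E2 /eqP E1; rewrite E2 -E1 G1C in G2C.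
Qed.

(** The direction [- v u] puts the facets through [u] first. As [s] is not inside [F], the position
    of [F] is free. *)
Lemma sweep_avoid s u : ~~ (s \subset F) -> exists2 P, sweep fs F s P &
  forall G, G \in fs -> u \in G -> u \notin P G.
Proof.
move=> sF; have sF' : s \subset F -> facet S F by rewrite (negbTE sF).
have [P [h1 h2 _]] := sweep_exists full simp interior_sum
  (@topF_none s z (- v u) sF) sF'.
exists P => // G Gf uG; have [k [k0 kO ku]] := ex_kappa full simp interior_sum Gf uG.
by apply: (h2 G u k Gf uG k0 kO ku).2; rewrite prE -/(ev u k) ku; lra.
Qed.

(** Adding a large multiple of [v u] to [b] puts the facets through [u] after all the others, with
    [F] still at the very end because [v u] vanishes on its functional. *)
Lemma sweep_F_in u : facet S F -> u \in F -> exists2 P, sweep fs F set0 P &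
  forall G, G \in fs -> u \in G -> u \in P G.
Proof.
move=> fF uF; have uS := subsetP (facet_sub fF) u uF.
have [lf lfP] := ex_lf interior_sum; have [kf kfP] := ex_kf full simp interior_sum.
have [M M0 hM] := large_mult [set: {set T} * T] (fun p => - pr b (kf p.1 p.2)) (fun p => -1).
have top : topF v S F set0 z (M *: v u + b).
  move=> k l G _ _ Gf _ vk kG kO vl lF lO; rewrite !prE (sumF_facet lF).
  have -> : pr (v u) l = 0 by move: uF; rewrite -lF => /zsP[].
  have := sumF_other fF Gf vk kG; have := mulr_ge0_le0 M0 (vk u uS); rewrite /ev; lra.
have [P [h1 h2 _]] := sweep_exists full simp interior_sum top (fun _ => fF).
exists P => // G Gf uG; have [k0 kO ku] := kfP G Gf u uG.
apply: (h2 G u _ Gf uG k0 kO ku).1; rewrite !prE -/(ev u (kf G u)) ku.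
by have := hM (G, u); rewrite inE ltrN10 /= => /(_ isT isT); lra.
Qed.

(* Seen from an origin close to [u], the facets at [u] other than [F] come first
   while [F] still comes last. *)
Lemma sweep_F_notin u : facet S F -> u \in F -> exists2 P, sweep fs F set0 P &
  forall G, G \in fs -> u \in G -> u \notin P G.
Proof.
move=> fF uF; have uS := subsetP (facet_sub fF) u uF.
have [lf lfP] := ex_lf interior_sum; have [kf kfP] := ex_kf full simp interior_sum.
have [M M0 hM] := large_mult [set: {set T} * T] (fun p => pr b (kf p.1 p.2))
  (fun p => pr b (lf p.1)).
have [P [h1 h2 _]] := sweep_exists full simp (interior_add M0 uS)
  (@topF_sum set0 (M *: v u + z)) (fun _ => fF).
exists P => // G Gf uG; have [k [k0 kO ku]] := ex_kappa full simp (interior_add M0 uS) Gf uG.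
apply: (h2 G u _ Gf uG k0 kO ku).2.
(* Expand with respect to the old origin [z]. Since [k] vanishes at the new origin, [pr z k = - M],
   and for large [M] the negative number [pr b (lf G)] determines the sign. *)
rewrite (expand full lfP kfP b k Gf) (bigD1 u) //= ku mulr1 big1 => [|t /andP[tG tu]].
  have -> : pr z k = - M by move: kO; rewrite !prE -/(ev u k) ku; lra.
  have [fG _] := fsP _ _ _ _ Gf; have [vl lG lO] := lfP G fG.
  have := hM (G, u); rewrite inE /= => /(_ isT (sumF_other fF Gf vl lG)); lra.
by rewrite k0 ?mulr0 // !inE tu.
Qed.

End SpecialSweeps.

(** * The upper bound *)

(** With [m = n - d], the numbers C(n-d+i-1, i) are the h-numbers that correspond to the face
    numbers C(n, j). Truncated subtraction acts only at [m = i = 0], where the coefficient is 1. *)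
Lemma sum_multiset_binomial m d j : j <= d ->
  \sum_(i < d.+1) 'C(m + i - 1, i) * 'C(d - i, d - j) = 'C(m + d, j).
Proof.
elim: m d j => [|m IHm] d j jd.
  rewrite big_ord_recl /= big1 => [|i _]; last by rewrite bin_small // /bump /=; lia.
  by rewrite bin0 mul1n addn0 subn0 bin_sub.
elim: d j jd => [|d IHd] j jd.
  by move: jd; rewrite leqn0 => /eqP->; rewrite big_ord1 /= !bin0.
case: j jd => [_|j jd].
  rewrite big_ord_recl /= big1 => [|i _]; last by rewrite [X in _ * X]bin_small ?muln0 // /bump /=; lia.
  by rewrite !bin0 subn0 binn.
have -> : 'C(m.+1 + d.+1, j.+1) = 'C(m + d.+1, j.+1) + 'C(m.+1 + d, j) by rewrite addSn binS addnS addSn.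
rewrite -(IHm d.+1 j.+1) //.
rewrite -(IHd j) // [LHS]big_ord_recl [X in _ = X + _]big_ord_recl -addnA; congr (_ + _).
  by rewrite -[nat_of_ord ord0]/0 !bin0.
rewrite -big_split; apply: eq_bigr => i _; rewrite lift0 !(subSS _ d); apply: etrans (mulnDl _ _ _).
congr (_ * _); have -> : m.+1 + i.+1 - 1 = (m + i).+1 by lia.
have -> : m + i.+1 - 1 = m + i by lia.
have -> : m.+1 + i - 1 = m + i by lia.
by rewrite binS.
Qed.

Section UpperBound.
Variables (R : realFieldType) (d : nat) (T : finType) (v : T -> 'rV[R]_d.+1).
Variables (S F : {set T}).
Hypothesis full : rk v S = d.+1.
Hypothesis simp : forall G, facet v S G -> G <> F -> #|G| = d.
Hypothesis d_le : d <= #|T|.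
Local Notation fs := (fs v S F).
Local Notation facet := (facet v).
Local Notation hn := (hn fs).
Local Notation sweep := (sweep fs F).
Implicit Types (G H s : {set T}) (u : T) (P : {set T} -> {set T}).

Let fsd : forall G, G \in fs -> #|G| = d := @fs_card _ _ _ _ _ _ simp.

Lemma hn_le1 P s : sweep s P -> hn P s 0 <= 1.
Proof.
case=> h1 h2 _; have [Ds|Ds] := boolP (Dl fs s); last first.
  rewrite leqW // leqn0 cards_eq0; apply/eqP/setP => G; rewrite in_set in_set0.
  by apply/negP => /and3P[Gf sG _]; case/DlP: Ds; exists G.
rewrite -(h2 s (subxx _) Ds); apply/subset_leq_card/subsetP => G.
by rewrite !in_set => /and3P[-> -> /eqP/cards0_eq h]; rewrite -setD_eq0 h eqxx.
Qed.

(** When [u] is never in the restriction set of a facet containing it, the restriction size of that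
    facet is the same in the link of [u |: s] as in the link of [s]. *)
Lemma hn_link_avoid P s u i : sweep s P -> u \notin s -> i < d - #|s| ->
  (exists2 P', sweep s P' & forall G, G \in fs -> u \in G -> u \notin P' G) ->
  hn P (u |: s) i <= hn P s i.
Proof.
move=> sw us iq [P' sw' hP'].
have E : u |: s = [set u] :|: s by [].
have c1 : #|u |: s| = #|s|.+1 by rewrite cardsU1 us.
rewrite (hn_unique fsd (sweep_sub sw (subsetUr _ s)) (sweep_sub sw' (subsetUr [set u] s)) (q := d - #|u |: s|));
  [|by rewrite c1; lia|by rewrite c1; lia].
rewrite (hn_unique fsd sw sw' (q := d - #|s|)); [|lia|lia].
apply/subset_leq_card/subsetP => G; rewrite !in_set => /and3P[Gf].
rewrite subUset sub1set => /andP[uG sG] /eqP c; rewrite Gf sG /=; apply/eqP.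
by rewrite -c setUC -setDDl [LHS](cardsD1 u) in_setD (negbTE (hP' G Gf uG)) andbF.
Qed.

(** Bounding each of the [#|T| - #|s|] terms of [hn_sum] by [hn P s i] gives (i+1) h_{i+1} <=
    (n-d+i) h_i, the recursion satisfied with equality by C(n-d+i-1, i). *)
Lemma sphere_ubt P s q i : ~~ (s \subset F) -> #|s| + q = d -> sweep s P -> i <= q ->
  hn P s i <= 'C(#|T| - d + i - 1, i).
Proof.
move=> sF sq sw; elim: i => [|i IH] iq; first by rewrite bin0 hn_le1.
have key : i.+1 * hn P s i.+1 <= (#|T| - d + i) * hn P s i.
  have := hn_sum fsd sw sq iq.
  have : \sum_(u | u \notin s) hn P (u |: s) i <= \sum_(u | u \notin s) hn P s i.
    apply: leq_sum => u us; apply: hn_link_avoid => //; first by lia.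
    exact: sweep_avoid.
  rewrite sum_nat_const => le E; move: le; rewrite E.
  have -> : #|[pred u | u \notin s]| = #|T| - #|s| by rewrite -(cardsC s) addKn; apply: eq_card => u; rewrite !inE.
  have -> : #|T| - #|s| = (#|T| - d + i) + (q - i) by lia.
  by rewrite mulnDl leq_add2r.
rewrite -(leq_pmul2l (ltn0Sn i)); apply: leq_trans key _.
have [m0|m0] := posnP (#|T| - d + i); first by rewrite m0 mul0n.
have -> : #|T| - d + i.+1 - 1 = #|T| - d + i by lia.
rewrite -mul_bin_diag leq_pmul2l //; apply: leq_trans (IH (ltnW iq)) _.
by rewrite subn1.
Qed.

Section ASP.
Variable (s : nat).
Hypothesis fF : facet S F.
Hypothesis Fs : #|F| = d + s.
Variable P : {set T} -> {set T}.
Hypothesis sw : sweep set0 P.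
Local Notation n := #|T|.

Let s0 : #|@set0 T| + d = d. Proof. by rewrite cards0. Qed.

Lemma sum_split_F (f : T -> nat) a b : (forall u, u \in F -> f u <= a) ->
  (forall u, u \notin F -> f u <= b) ->
  \sum_(u | u \notin set0) f u <= (d + s) * a + (n - (d + s)) * b.
Proof.
move=> h1 h2; rewrite (eq_bigl xpredT) => [|u]; last by rewrite in_set0.
rewrite (bigID (mem F)) /=; apply: leq_add.
  by rewrite -Fs -sum_nat_const; apply: leq_sum.
have -> : n - (d + s) = #|[pred u | u \notin F]|.
  by rewrite -Fs -(cardsC F) addKn; apply: eq_card => u; rewrite !inE.
by rewrite -sum_nat_const; apply: leq_sum.
Qed.

Lemma link_bound u i : u \notin F -> i < d -> hn P [set u] i <= 'C(n - d + i - 1, i).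
Proof.
move=> uF id; apply: (@sphere_ubt _ _ d.-1); rewrite ?sub1set ?cards1 //; try lia.
exact: (sweep_sub sw (sub0set _)).
Qed.

Lemma FleT : d + s <= n. Proof. by rewrite -Fs max_card. Qed.

(** For [u] in [F] the link is compared with the whole complex through [sweep_F_notin]; for [u]
    outside [F] the link is a sphere and is bounded outright by [sphere_ubt]. *)
Lemma asp_ubt i : i <= d -> hn P set0 i <= 'C(n - d + i - 1, i).
Proof.
elim: i => [|i IH] id; first by rewrite bin0 hn_le1.
set C := 'C(n - d + i - 1, i) in IH.
have key : i.+1 * hn P set0 i.+1 <= (n - d + i) * C.
  have := hn_sum fsd sw s0 id.
  have : \sum_(u | u \notin set0) hn P (u |: set0) i <= (d + s) * hn P set0 i + (n - (d + s)) * C.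
    apply: sum_split_F => u uF.
      apply: hn_link_avoid; rewrite ?in_set0 ?cards0 ?subn0 //.
      exact: sweep_F_notin.
    by rewrite setU0; apply: link_bound.
  move=> le E; move: le; rewrite E; have le := IH (ltnW id); have := FleT.
  move: le; move: (hn P set0 i) (hn P set0 i.+1) => x y xC nds le.
  (* Of the [d + s] copies of [x], [d - i] cancel against [hn_sum]; the other [s + i] are bounded by
     [C] and complete the factor [n - d + i]. *)
  have : (s + i) * x <= (s + i) * C by rewrite leq_mul2l xC orbT.
  have -> : n - d + i = (s + i) + (n - (d + s)) by lia.
  rewrite mulnDl; have : (d + s) * x = (d - i) * x + (s + i) * x by rewrite -mulnDl; congr (_ * _); lia.
  by move: le; lia.
rewrite -(leq_pmul2l (ltn0Sn i)); apply: leq_trans key _.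
have [m0|m0] := posnP (n - d + i); first by rewrite m0 mul0n.
have -> : n - d + i.+1 - 1 = n - d + i by lia.
by rewrite -mul_bin_diag leq_pmul2l // /C subn1.
Qed.

Lemma hn_last : hn P set0 d = 0.
Proof.
have := ifaces_hn fsd sw s0 (leq0n d); rewrite big_ord_recl /= subn0 binn muln1 big1.
  rewrite addn0 => <-; apply/eqP; rewrite cards_eq0; apply/eqP/setP => t.
  rewrite !in_set cards0; apply/negP => /andP[/and3P[_ _ /eqP/cards0_eq->]].
  by rewrite sub0set.
by move=> i _; rewrite bin_bump muln0.
Qed.

(** The summand C(s+i-1, i) is the h-number corresponding to all subsets of the [d + s] vertices of
    [F], none of which is interior. For [u] in [F], [sweep_F_in] makes the restriction size drop by
    exactly one in the link; for [u] outside [F], [hn_sym] turns the index [d - i.+1] of the link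
    into [i]. *)
Lemma asp_ubt_interior i : i <= d ->
  hn P set0 (d - i) + 'C(s + i - 1, i) <= 'C(n - d + i - 1, i).
Proof.
elim: i => [|i IH] id; first by rewrite !bin0 subn0 hn_last.
set C := 'C(n - d + i - 1, i) in IH.
have id' : d - i.+1 < d by lia.
have E1 : (d - i.+1).+1 = d - i by lia.
have E2 : d - (d - i.+1) = i.+1 by lia.
have key : i.+1 * hn P set0 (d - i.+1) + (s + i) * 'C(s + i - 1, i) <= (n - d + i) * C.
  have := hn_sum fsd sw s0 id'; rewrite E1 E2.
  have : \sum_(u | u \notin set0) hn P (u |: set0) (d - i.+1) <=
      (d + s) * hn P set0 (d - i) + (n - (d + s)) * C.
    apply: sum_split_F => u uF; rewrite setU0.
      have [P' sw' hP'] := sweep_F_in full simp fF uF.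
      rewrite (hn_unique fsd (sweep_sub sw (sub0set [set u])) (sweep_sub sw' (sub0set [set u])) (q := d.-1));
        [|rewrite cards1; lia|lia].
      rewrite (hn_unique fsd sw sw' (q := d)) ?cards0 //; last by lia.
      apply/subset_leq_card/subsetP => G; rewrite !in_set sub1set => /and3P[Gf uG /eqP c].
      by rewrite Gf sub0set setD0 (cardsD1 u) (hP' G Gf uG) c /= -E1.
    rewrite (hn_sym fsd (sweep_sub sw (sub0set [set u])) (q := d.-1)) ?sub1set ?cards1 //; try lia.
    by rewrite (_ : d.-1 - (d - i.+1) = i); [apply: link_bound|lia].
  move=> le E; move: le; rewrite E; have le := IH (ltnW id); have := FleT.
  move: le; move: (hn P set0 (d - i)) (hn P set0 (d - i.+1)) ('C(s + i - 1, i)) => x y c xC nds le.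
  have : (s + i) * (x + c) <= (s + i) * C by rewrite leq_mul2l xC orbT.
  have -> : n - d + i = (s + i) + (n - (d + s)) by lia.
  rewrite mulnDl mulnDr; have : (d + s) * x = (d - i) * x + (s + i) * x by rewrite -mulnDl; congr (_ * _); lia.
  by move: le; lia.
rewrite -(leq_pmul2l (ltn0Sn i)) mulnDr.
have -> : s + i.+1 - 1 = s + i by lia.
have -> : n - d + i.+1 - 1 = n - d + i by lia.
rewrite -!mul_bin_diag; move: key; rewrite /C.
by rewrite !subn1.
Qed.

Lemma neighborly_hn J : J <= d -> (forall j, j <= J -> #|faces fs set0 j| = 'C(n, j)) ->
  forall i, i <= J -> hn P set0 i = 'C(n - d + i - 1, i).
Proof.
move=> Jd h i iJ; apply: (@binomial_transform_inj d (hn P set0) (fun i => 'C(n - d + i - 1, i)) J) => // j jJ.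
have jd := leq_trans jJ Jd.
by rewrite -(faces_hn fsd sw s0 jd) h // sum_multiset_binomial // subnK.
Qed.

Lemma neighborly_interior_hn J : J <= d ->
  (forall j, j <= J -> #|ifaces fs F set0 j| + 'C(d + s, j) = 'C(n, j)) ->
  forall i, i <= J -> hn P set0 (d - i) + 'C(s + i - 1, i) = 'C(n - d + i - 1, i).
Proof.
move=> Jd h i iJ.
apply: (@binomial_transform_inj d (fun i => hn P set0 (d - i) + 'C(s + i - 1, i))
  (fun i => 'C(n - d + i - 1, i)) J) => // j jJ.
have jd := leq_trans jJ Jd.
rewrite sum_multiset_binomial // subnK // -h // (ifaces_hn fsd sw s0 jd) addnC.
rewrite addnC (addnC d) -sum_multiset_binomial // -big_split /=.
by apply: eq_bigr => k _; rewrite mulnDl.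
Qed.

End ASP.
End UpperBound.

(** Face numbers are nonnegative combinations of h-numbers, so these are compared one by one. For 2i
    < d the reference complex attains [asp_ubt]; otherwise h_i is read as the entry at distance
    [d - i] from the top, where it attains [asp_ubt_interior]. *)
Lemma asp_upper_bound (R R' : realFieldType) d s (T T' : finType)
  (v : T -> 'rV[R]_d.+1) (v' : T' -> 'rV[R']_d.+1) (S F : {set T}) (S' F' : {set T'}) :
  rk v S = d.+1 -> rk v' S' = d.+1 ->
  (forall G, facet v S G -> G <> F -> #|G| = d) ->
  (forall G, facet v' S' G -> G <> F' -> #|G| = d) ->
  facet v S F -> facet v' S' F' -> #|F| = d + s -> #|F'| = d + s -> #|T| = #|T'| ->
  (forall j, j.*2 < d -> #|faces (fs v' S' F') set0 j| = 'C(#|T'|, j)) ->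
  (forall j, j.*2 <= d -> #|ifaces (fs v' S' F') F' set0 j| + 'C(d + s, j) = 'C(#|T'|, j)) ->
  forall j, j <= d -> #|faces (fs v S F) set0 j| <= #|faces (fs v' S' F') set0 j|.
Proof.
move=> full full' simp simp' fF fF' Fs Fs' TT nb nbi j jd.
have [P sw] := sweep0 full simp (fun _ : set0 \subset F => fF).
have [P' sw'] := sweep0 full' simp' (fun _ : set0 \subset F' => fF').
have s0 (U : finType) : #|@set0 U| + d = d by rewrite cards0.
have dT : d <= #|T| by apply: leq_trans (leq_addr s d) _; rewrite -Fs max_card.
have dT' : d <= #|T'| by rewrite -TT.
have fsd := @fs_card _ _ _ _ _ _ simp; have fsd' := @fs_card _ _ _ _ _ _ simp'.
rewrite (faces_hn fsd sw (s0 T) jd) (faces_hn fsd' sw' (s0 T') jd).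
apply: leq_sum => -[i /= id] _; rewrite ltnS in id; apply: leq_mul => //.
have [i2|i2] := ltnP i.*2 d.
  rewrite (neighborly_hn simp' dT' sw' (J := i) id) // => [|k ki]; last by apply: nb; lia.
  by rewrite -TT; apply: asp_ubt sw _ id => //; exact: Fs.
have E : i = d - (d - i) by lia.
have id' : d - i <= d by lia.
have := neighborly_interior_hn simp' dT' (s := s) sw' (J := d - i) id' _ (leqnn (d - i)).
rewrite -E -TT => h; have := asp_ubt_interior full simp dT fF Fs sw id'.
by rewrite -E -h ?leq_add2r // => k ki; rewrite TT; apply: nbi; lia.
Qed.

(** * Rigidity and edge counts *)

Lemma exists_subset_card (T : finType) (S : {set T}) k : k <= #|S| ->
  exists2 A : {set T}, A \subset S & #|A| = k.
Proof.
case/card_geqP => s [us ss sub]; exists [set x in s].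
  by apply/subsetP => x; rewrite inE => /sub.
by rewrite cardsE (card_uniqP us).
Qed.

(** * Moving vertices to general position while keeping simplex facets *)

Section GeneralPosition.
Local Open Scope ring_scope.
Variables (R : realFieldType) (d : nat) (T : finType).
Implicit Types (v w : T -> 'rV[R]_d.+1) (S A G U : {set T}) (t u : T).

Definition genpos v U := forall A, A \subset U -> (#|A| <= d.+1)%N -> rk v A = #|A|.

(** Fixing the rank at [d] frees the notion from the rank of [S], which is recovered only at the end
    of the perturbation. *)
Definition facet_of_rank v S G := exists l, [/\ valid v S l, zs v S l = G & rk v G = d].

Lemma eq_rk v w A : {in A, v =1 w} -> rk v A = rk w A.
Proof. by move=> h; rewrite /rk /spanm; congr (\rank _); apply: eq_bigr => t /h->. Qed.

Lemma nonzero_vanish v A : (rk v A < d.+1)%N -> exists2 l, l != 0 & forall t, t \in A -> ev v t l = 0.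
Proof.
move=> lt; have : cokermx (spanm v A) != 0.
  by rewrite -mxrank_eq0 mxrank_coker subn_eq0 -ltnNge.
move=> nz; have /existsP[j hj] : [exists j, col j (cokermx (spanm v A)) != 0].
  apply: contraNT nz; rewrite negb_exists => /forallP h; apply/eqP/matrixP => i j.
  by have := h j; rewrite negbK => /eqP/colP/(_ i); rewrite !mxE.
exists (col j (cokermx (spanm v A))) => // t tA; have := mem_spanm v tA; rewrite submxE => /eqP h.
rewrite /ev /pr; transitivity ((v t *m cokermx (spanm v A)) 0 j); last by rewrite h mxE.
by rewrite !mxE; apply: eq_bigr => i _; rewrite mxE.
Qed.

(** Only [t] moves. That every facet of [fam] survives, and that [t] leaves the spans of the small
    subsets of [U], are sign conditions on finitely many functionals at its new position; [K] lists
    them. *)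
Lemma genpos_step v S (fam : {set {set T}}) U t :
  (forall G, G \in fam -> facet_of_rank v S G /\ #|G| = d) ->
  genpos v U -> t \notin U ->
  exists w, (forall G, G \in fam -> facet_of_rank w S G) /\ genpos w (t |: U).
Proof.
move=> vfam gU tU.
have [lf lfP] : exists lf : {set T} -> 'cV[R]_d.+1, forall G, G \in fam ->
    [/\ valid v S (lf G), zs v S (lf G) = G & rk v G = d].
  suff : forall G, exists l, G \in fam -> [/\ valid v S l, zs v S l = G & rk v G = d].
    by move/choice => [f fP]; exists f.
  move=> G; have [Gf|] := boolP (G \in fam); last by exists 0.
  by have [[l lP] _] := vfam G Gf; exists l.
have [kf kfP] : exists kf : {set T} -> 'cV[R]_d.+1, forall G, G \in fam -> t \in G ->
    (forall s, s \in G :\ t -> ev v s (kf G) = 0) /\ ev v t (kf G) = 1.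
  suff : forall G, exists k, G \in fam -> t \in G ->
      (forall s, s \in G :\ t -> ev v s k = 0) /\ ev v t k = 1.
    by move/choice => [f fP]; exists f.
  move=> G; have [Gf|] := boolP (G \in fam); last by exists 0.
  have [tG|] := boolP (t \in G); last by exists 0.
  have [[l [_ _ rG]] cG] := vfam G Gf; have [k k0 kt] := @dualfun _ _ _ v G t (etrans rG (esym cG)) tG.
  by exists k.
have [mf mfP] : exists mf : {set T} -> 'cV[R]_d.+1, forall A, (rk v A < d.+1)%N ->
    mf A != 0 /\ forall s, s \in A -> ev v s (mf A) = 0.
  suff : forall A, exists m, (rk v A < d.+1)%N -> m != 0 /\ forall s, s \in A -> ev v s m = 0.
    by move/choice => [f fP]; exists f.
  move=> A; have [lt|] := boolP (rk v A < d.+1)%N; last by exists 0.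
  by have [m m0 h] := nonzero_vanish lt; exists m.
(* Up to the positive factor [pr x (kf G)], the pairing of the new position [x] with [mix G s] is
   the value at [s] of the corrected functional [l'] of [G]. At the old position it is
   [ev v s (lf G)], which is negative off [G]. *)
pose mix G s := ev v s (lf G) *: kf G - ev v s (kf G) *: lf G.
pose K := [seq lf G | G <- enum fam] ++ [seq kf G | G <- enum fam] ++
  [seq mf A | A <- enum [set: {set T}]] ++ [seq mix p.1 p.2 | p <- enum [set: {set T} * T]].
have [x xP] := generic K (v t).
have Kl G : G \in fam -> lf G \in K.
  by move=> Gf; rewrite mem_cat (map_f lf) // mem_enum.
have Kk G : G \in fam -> kf G \in K.
  by move=> Gf; rewrite !mem_cat [kf G \in map kf _](map_f kf) ?orbT // mem_enum.
have Km A : mf A \in K.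
  by rewrite !mem_cat [mf A \in map mf _](map_f mf) ?orbT // mem_enum inE.
have Kx G s : mix G s \in K.
  by rewrite !mem_cat; apply/orP; right; apply/orP; right; apply/orP; right;
     apply/mapP; exists (G, s); rewrite // mem_enum inE.
pose w s := if s == t then x else v s.
have wt : w t = x by rewrite /w eqxx.
have wn s : s != t -> w s = v s by rewrite /w => /negbTE->.
have rkw A : t \notin A -> rk w A = rk v A.
  by move=> tA; apply: eq_rk => s sA; apply: wn; apply: contraNneq tA => <-.
exists w; split.
  move=> G Gf; have [vl lG rG] := lfP G Gf; have [_ cG] := vfam G Gf.
  have [tG|tG] := boolP (t \in G); last first.
    exists (lf G); rewrite rkw //.
    have tl : t \in S -> pr x (lf G) < 0.
      move=> tS; apply: (xP _ (Kl G Gf)).2.2; rewrite lt_neqAle [_ <= _]vl // andbT.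
      by apply: contra tG => /eqP h; rewrite -lG; apply/zsP.
    split => //.
      move=> s sS; rewrite /ev /w; case: eqP => [E|_]; last exact: vl.
      by apply/ltW/tl; rewrite -E.
    apply/setP => s; transitivity (s \in zs v S (lf G)); last by rewrite lG.
    rewrite !inE /ev /w; have [->|//] := eqVneq s t.
    case tS: (t \in S) => //=; rewrite (lt_eqF (tl tS)); apply/esym/negP => /eqP h.
    by case/negP: tG; rewrite -lG; apply/zsP.
  have [k0 kt] := kfP G Gf tG.
  have kx : 0 < pr x (kf G) by apply: (xP _ (Kk G Gf)).2.1; rewrite -/(ev v t _) kt.
  have lt0 : ev v t (lf G) = 0 by move: tG; rewrite -{1}lG => /zsP[].
  pose l' := lf G - (pr x (lf G) / pr x (kf G)) *: kf G.
  have tl' : ev w t l' = 0 by rewrite /ev wt !prE divfK ?subrr // gt_eqF.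
  have Gl' s : s \in G -> ev w s l' = 0.
    move=> sG; have [->//|st] := eqVneq s t; rewrite /ev wn // !prE.
    rewrite -!/(ev v s _) k0 ?inE ?st // mulr0 subr0.
    by move: sG; rewrite -{1}lG => /zsP[].
  have nl' s : s \in S -> s \notin G -> ev w s l' < 0.
    move=> sS sG; have st : s != t by apply: contraNneq sG => ->.
    have sl : ev v s (lf G) < 0.
      by rewrite lt_neqAle vl // andbT; apply: contra sG => /eqP h; rewrite -lG; apply/zsP.
    have : pr x (mix G s) < 0.
      apply: (xP _ (Kx G s)).2.2; rewrite /mix !prE -!/(ev v t _) kt lt0; lra.
    rewrite /mix !prE /ev wn // !prE -!/(ev v s _) => h.
    have -> : ev v s (lf G) - pr x (lf G) / pr x (kf G) * ev v s (kf G) =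
        (ev v s (lf G) * pr x (kf G) - ev v s (kf G) * pr x (lf G)) / pr x (kf G).
      by field; rewrite gt_eqF.
    by rewrite pmulr_llt0 // invr_gt0.
  exists l'; split.
  - move=> s sS; have [sG|sG] := boolP (s \in G); first by rewrite Gl'.
    exact/ltW/nl'.
  - apply/setP => s; apply/zsP/idP => [[sS /eqP h]|sG].
      by apply: contraLR h => sG; rewrite lt_eqF // nl'.
    split; last exact: Gl'.
    by move: sG; rewrite -{1}lG => /zsP[].
  - rewrite -(setD1K tG) (rk_add (l := kf G)).
    + rewrite rkw ?setD11 // indepD1 ?rG ?cG //.
      by case: (d) cG => // c0; move: tG; rewrite (cards0_eq c0) inE.
    + by move=> s st; rewrite /ev wn; [exact: k0|case/setD1P: st].
    + by rewrite /ev wt gt_eqF.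
move=> A; have [tA|tA] := boolP (t \in A) => AU cA; last first.
  rewrite rkw // gU //; apply/subsetP => s sA; have := subsetP AU s sA.
  by rewrite in_setU1 => /orP[/eqP E|//]; rewrite -E sA in tA.
have AD : A :\ t \subset U.
  by apply/subsetP => s /setD1P[st /(subsetP AU)]; rewrite !inE (negbTE st).
have cAD : #|A| = #|A :\ t|.+1 by rewrite (cardsD1 t) tA.
have rA : rk v (A :\ t) = #|A :\ t| by apply: gU => //; rewrite ltnW // -cAD.
have [m0 mA] : mf (A :\ t) != 0 /\ forall s, s \in A :\ t -> ev v s (mf (A :\ t)) = 0.
  by apply: mfP; rewrite rA -cAD.
rewrite -{1}(setD1K tA) (rk_add (l := mf (A :\ t))).
- by rewrite rkw ?setD11 // rA cAD.
- by move=> s st; rewrite /ev wn; [exact: mA|case/setD1P: st].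
- by rewrite /ev wt; apply: (xP _ (Km _)).1.
Qed.

Lemma genpos_exists v S (fam : {set {set T}}) : (d < #|S|)%N ->
  (forall G, G \in fam -> facet_of_rank v S G /\ #|G| = d) ->
  exists w, genpos w setT /\ forall G, G \in fam -> facet w S G.
Proof.
move=> dS vfam; suff [w [gw wf]] : exists w, genpos w [set x in enum T] /\
    forall G, G \in fam -> facet_of_rank w S G.
  have gw' : genpos w setT by move=> A _; apply: gw; apply/subsetP => s _; rewrite inE mem_enum.
  exists w; split => // G /wf[l [h1 h2 h3]]; exists l; split => //; rewrite h3.
  have [A AS cA] := exists_subset_card dS.
  have le : (d.+1 <= rk w S)%N.
    by apply: leq_trans (rkS w AS); rewrite gw' ?subsetT ?cA.
  by apply/anti_leq/andP; split; [exact: le|exact: rank_leq_col].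
elim: (enum T) => [|t s [w [gw wf]]].
  exists v; split; last by move=> G /vfam[].
  move=> A; rewrite (_ : [set x in [::]] = set0); last by apply/setP => x; rewrite !inE.
  by rewrite subset0 => /eqP->; rewrite rk0 cards0.
have E : [set x in t :: s] = t |: [set x in s] by apply/setP => x; rewrite !inE.
rewrite E; have [ts|ts] := boolP (t \in [set x in s]).
  by exists w; rewrite (setUidPr _) // sub1set.
have [|w' [h1 h2]] := genpos_step (v := w) (S := S) (fam := fam) _ gw ts.
  by move=> G Gf; split; [exact: wf|case: (vfam G Gf)].
by exists w'.
Qed.

End GeneralPosition.

Lemma pred_split (T : finType) (A : {set {set T}}) (p : pred {set T}) :
  #|A| = #|[set t in A | ~~ p t]| + #|[set t in A | p t]|.
Proof.
rewrite -(cardsID [set t : {set T} | p t] A) addnC; congr (_ + _); apply: eq_card => t.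
  by rewrite in_setD [RHS]in_set [X in ~~ X]in_set andbC.
by rewrite in_setI [RHS]in_set [X in _ && X]in_set.
Qed.

Lemma sum4 (f : nat -> nat) :
  [/\ \sum_(i < 4) f i * 'C(3 - i, 3 - 1) = 3 * f 0 + f 1,
      \sum_(i < 4) f i * 'C(3 - i, 3 - 2) = 3 * f 0 + 2 * f 1 + f 2 &
      \sum_(i < 4) f i * 'C(3 - i, 3 - 3) = f 0 + f 1 + f 2 + f 3].
Proof.
split; rewrite !big_ord_recr big_ord0 /= add0n.
- by rewrite -['C(_, _)]/3 -['C(3 - 1, _)]/1 -['C(3 - 2, _)]/0 -['C(3 - 3, _)]/0; lia.
- by rewrite -['C(_, _)]/3 -['C(3 - 1, _)]/2 -['C(3 - 2, _)]/1 -['C(3 - 3, _)]/0; lia.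
- by rewrite !bin0 !muln1.
Qed.

Lemma sum4z (f : nat -> nat) : \sum_(i < 4) f i * 'C(3 - i, 3 - 0) = f 0.
Proof.
rewrite !big_ord_recr big_ord0 /= add0n.
by rewrite -['C(_, _)]/1 -['C(3 - 1, _)]/0 -['C(3 - 2, _)]/0 -['C(3 - 3, _)]/0; lia.
Qed.

(** * Vertices and edges of links *)

Section Links.
Variables (T : finType) (fs : {set {set T}}).
Implicit Types (G H s t W : {set T}) (u x y : T).
Local Notation Dl := (Dl fs).
Local Notation faces := (faces fs).

Definition lk s := [set u | (u \notin s) && Dl (u |: s)].

Lemma lkP s u : reflect (u \notin s /\ Dl (u |: s)) (u \in lk s).
Proof. by rewrite inE; apply: andP. Qed.

Lemma facesP s j t : reflect [/\ Dl t, s \subset t & #|t| = #|s| + j] (t \in faces s j).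
Proof. by rewrite inE; apply: (iffP and3P) => -[? ? /eqP]. Qed.

Lemma faces1 s : #|faces s 1| = #|lk s|.
Proof.
have inj : {in lk s &, injective (fun u => u |: s)}.
  move=> x y /lkP[xs _] /lkP[ys _] E; have : x \in y |: s by rewrite -E setU11.
  by rewrite in_setU1 (negbTE xs) orbF => /eqP.
rewrite -(card_in_imset inj); apply: eq_card => t; apply/idP/imsetP.
  move=> /facesP[Dt st c]; have : 0 < #|t :\: s| by rewrite cardsDS // c; lia.
  case/card_gt0P => u /setDP[ut us].
  have E : t = u |: s.
    apply/esym/eqP; rewrite eqEcard subUset sub1set ut st cardsU1 us c; lia.
  by exists u => //; apply/lkP; rewrite -E.
move=> [u /lkP[us Du] ->]; apply/facesP; split => //; first exact: subsetUr.
by rewrite cardsU1 us addnC.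
Qed.

Lemma lk_mem s t u : Dl t -> s \subset t -> u \in t -> u \notin s -> u \in lk s.
Proof. by move=> Dt st ut us; apply/lkP; split => //; apply: Dl_sub Dt; rewrite subUset sub1set ut. Qed.

Lemma lk_add s u : lk (u |: s) \subset lk s.
Proof.
apply/subsetP => x /lkP[]; rewrite in_setU1 negb_or => /andP[xu xs] D.
by apply/lkP; split => //; apply: Dl_sub D; apply/setUS/subsetUr.
Qed.

(** The predicate [pr] is later either trivial or selects the interior edges. *)
Definition newedges (pr : pred {set T}) s W := [set t in faces s 2 | pr t && ~~ (t \subset W)].

(* Adding the star of [u] to [W]: each new neighbour [x] of [u] contributes the edge [ux],
   and each new edge of the link of [u] is new. *)
Lemma star_count_gen (pr : pred {set T}) s u W W' : u \notin s -> s \subset W -> u \in W ->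
  W \subset W' ->
  #|[set x in lk (u |: s) :\: W | pr (x |: (u |: s))]| +
  #|[set t in newedges xpredT (u |: s) W' | pr (t :\ u)]| <=
  #|[set t in faces s 2 | [&& pr t, ~~ (t \subset W) & t \subset W :|: lk (u |: s)]]|.
Proof.
move=> us sW uW WW'.
set N := [set x in _ | _]; set D := [set t in newedges _ _ _ | _].
have cus : #|u |: s| = #|s|.+1 by rewrite cardsU1 us.
have usW : u |: s \subset W by rewrite subUset sub1set uW.
have inj1 : {in N &, injective (fun x => x |: (u |: s))}.
  move=> x y /setIdP[/setDP[/lkP[xs _] _] _] /setIdP[/setDP[/lkP[ys _] _] _] E.
  have : x \in y |: (u |: s) by rewrite -E setU11.
  by rewrite in_setU1 (negbTE xs) orbF => /eqP.
have inD t : t \in D -> [/\ t \in faces (u |: s) 2, ~~ (t \subset W'), u \in t & s \subset t].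
  case/setIdP => /setIdP[tf tW] _; split => //; case/facesP: tf => _ st _.
    by apply: (subsetP st); rewrite setU11.
  by apply: subset_trans st; apply: subsetUr.
have inj2 : {in D &, injective (fun t => t :\ u)}.
  by move=> t t' /inD[_ _ ut _] /inD[_ _ ut' _] E; rewrite -(setD1K ut) E setD1K.
rewrite -(card_in_imset inj1) -(card_in_imset inj2).
rewrite -cardsUI (_ : _ :&: _ = set0) ?cards0 ?addn0; last first.
  apply/setP => t; rewrite !inE; apply/negP => /andP[/imsetP[x _ ->] /imsetP[t' _ E]].
  by have := setD11 u t'; rewrite -E !inE eqxx orbT.
apply/subset_leq_card/subsetP => t; rewrite in_setU in_set => /orP[/imsetP[x]|/imsetP[t']].
  move=> /setIdP[/setDP[xl xW] pr1] ->; have [xus Dx] := lkP _ _ xl; rewrite pr1 /=.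
  apply/and3P; split.
  - apply/facesP; split => //; last by rewrite cardsU1 xus cus add1n addn2.
    by rewrite setUA; apply: subsetUr.
  - by apply: contra xW => /subsetP; apply; rewrite setU11.
  - by rewrite subUset sub1set inE xl orbT /= (subset_trans usW) // subsetUl.
move=> t'D ->; have [tf tW ut st] := inD t' t'D; have [Dt ust ct] := facesP _ _ _ tf.
have [_ ->] := setIdP t'D; rewrite /=; apply/and3P; split.
- apply/facesP; split; first exact: Dl_sub (subsetDl _ _) Dt.
    by rewrite subsetD1 st.
  by have := cardsD1 u t'; rewrite ut ct cus add1n addSn => -[<-].
- apply: contra tW => tW; rewrite -(setD1K ut) subUset sub1set.
  by rewrite (subsetP WW') //= (subset_trans tW).
- apply/subsetP => x /setD1P[xu xt]; rewrite inE; have [xs|xs] := boolP (x \in s).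
    by rewrite (subsetP sW).
  by apply/orP; right; apply: (lk_mem Dt ust xt); rewrite in_setU1 negb_or xu.
Qed.

Lemma star_count (pr : pred {set T}) s u W W' : u \notin s -> s \subset W -> u \in W ->
  W \subset W' ->
  (forall x, pr (x |: (u |: s))) ->
  (forall t, t \in faces (u |: s) 2 -> ~~ (t \subset W') -> pr (t :\ u)) ->
  #|lk (u |: s) :\: W| + #|newedges xpredT (u |: s) W'| <=
  #|[set t in faces s 2 | [&& pr t, ~~ (t \subset W) & t \subset W :|: lk (u |: s)]]|.
Proof.
move=> us sW uW WW' pr1 pr2; apply: leq_trans (star_count_gen pr us sW uW WW').
apply: leq_add; apply/subset_leq_card/subsetP => t ht; apply/setIdP; split => //.
by case/setIdP: ht => tf tW; apply: pr2.
Qed.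

End Links.

Section Rigidity.
Variables (R : realFieldType) (d : nat) (T : finType) (v : T -> 'rV[R]_d.+1).
Variables (S F : {set T}).
Hypothesis full : rk v S = d.+1.
Hypothesis simp : forall G, facet v S G -> G <> F -> #|G| = d.
Local Notation fs := (fs v S F).
Local Notation facet := (facet v).
Local Notation Dl := (Dl fs).
Local Notation faces := (faces fs).
Local Notation lk := (lk fs).
Implicit Types (G H s t W : {set T}) (u : T).

Let fsd : forall G, G \in fs -> #|G| = d := @fs_card _ _ _ _ _ _ simp.

Lemma faces3 P s : sweep fs F s P -> #|s| + 3 = d ->
  [/\ #|faces s 1| = 3 * hn fs P s 0 + hn fs P s 1,
      #|faces s 2| = 3 * hn fs P s 0 + 2 * hn fs P s 1 + hn fs P s 2 &
      #|faces s 3| = hn fs P s 0 + hn fs P s 1 + hn fs P s 2 + hn fs P s 3].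
Proof.
by move=> sw sq; rewrite !(faces_hn fsd sw sq) //; apply: sum4.
Qed.

Lemma ifaces3 P s : sweep fs F s P -> #|s| + 3 = d ->
  [/\ #|ifaces fs F s 1| = 3 * hn fs P s 3 + hn fs P s 2,
      #|ifaces fs F s 2| = 3 * hn fs P s 3 + 2 * hn fs P s 2 + hn fs P s 1 &
      #|ifaces fs F s 3| = hn fs P s 3 + hn fs P s 2 + hn fs P s 1 + hn fs P s 0].
Proof.
by move=> sw sq; rewrite !(ifaces_hn fsd sw sq) //; apply: (sum4 (fun i => hn fs P s (3 - i))).
Qed.

Lemma sphere2_count s : ~~ (s \subset F) -> #|s| + 3 = d -> Dl s ->
  #|faces s 2| + 6 = 3 * #|lk s|.
Proof.
move=> sF sq Ds; have [|P sw] := sweep0 full simp (s := s); first by rewrite (negbTE sF).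
have [f1 f2 _] := faces3 sw sq; have h0 := hn0_sphere fsd sw sq Ds.
have h12 : hn fs P s 1 = hn fs P s 2 := hn_sym fsd sw sq sF (isT : 1 <= 3).
by rewrite -faces1 f1 f2 h0 h12; lia.
Qed.

Lemma fs_sub G : G \in fs -> G \subset S.
Proof. by case/fsP => fG _; apply: facet_sub fG. Qed.

End Rigidity.

Section RigidityBase.
Variables (R : realFieldType) (d : nat) (T : finType) (v : T -> 'rV[R]_d.+1).
Variables (S F : {set T}).
Hypothesis full : rk v S = d.+1.
Hypothesis simp : forall G, facet v S G -> G <> F -> #|G| = d.
Implicit Types (G H s t W : {set T}) (u : T).

Let fsd : forall G, G \in fs v S F -> #|G| = d := @fs_card _ _ _ _ _ _ simp.

(** The link is a 2-sphere with 3V-6 edges, so it suffices that the set [B] of its vertices in [W]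
    spans at most 3|B|-6 of them. For |B| = 3 this is a triangle. Otherwise the points of [s :|: B],
    in general position, span a simplicial polytope that still has all faces of Delta inside this
    set, and Euler's relation for the link of [s] in it gives the bound. *)
Lemma rigid_base s W G : #|s| + 3 = d -> ~~ (s \subset F) -> G \in (fs v S F) -> s \subset G -> G \subset W ->
  3 * #|lk (fs v S F) s :\: W| <= #|newedges (fs v S F) xpredT s W|.
Proof.
move=> sq sF Gf sG GW; have Ds : Dl (fs v S F) s by apply/DlP; exists G.
have E1 := sphere2_count full simp sF sq Ds;
pose I := [set t in faces (fs v S F) s 2 | t \subset W].
have E2 : #|faces (fs v S F) s 2| = #|newedges (fs v S F) xpredT s W| + #|I|.
  exact: pred_split (faces (fs v S F) s 2) (fun t => t \subset W).
pose B := lk (fs v S F) s :&: W.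
have E3 : #|lk (fs v S F) s| = #|B| + #|lk (fs v S F) s :\: W| by rewrite cardsID.
suff : #|I| + 6 <= 3 * #|B| by move: E1 E2 E3; lia.
have GB : G :\: s \subset B.
  apply/subsetP => x /setDP[xG xs]; rewrite in_setI (subsetP GW) // andbT.
  by apply: (lk_mem _ sG xG xs); apply/DlP; exists G.
have cG : #|G :\: s| = 3 by rewrite cardsDS // (fsd Gf) -sq addKn.
have B3 : 3 <= #|B| by rewrite -cG subset_leq_card.
have IB t : t \in I -> t \subset s :|: B.
  rewrite in_set => /andP[/facesP[Dt st _] tW]; apply/subsetP => x xt.
  rewrite in_setU in_setI (subsetP tW x xt) andbT.
  by have [//|xs] := boolP (x \in s); rewrite (lk_mem Dt st xt xs).
have sB : #|s :|: B| = #|s| + #|B|.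
  rewrite cardsU_D; congr (_ + _); apply: eq_card => x; rewrite in_setD.
  by case xB: (x \in B); rewrite ?andbF // andbT; case/setIP: xB => /lkP[].
have [B4|] := ltnP 3 #|B|; last first.
  move=> B3'; have BG : B = G :\: s by apply/esym/eqP; rewrite eqEcard GB cG.
  have sBG : s :|: B = G by apply/setP => x; rewrite BG !inE; case: (boolP (x \in s)) => //= /(subsetP sG).
  have := card_interval sG (k := #|s| + 2); rewrite (fsd Gf) -sq leq_add2l => /(_ isT).
  rewrite addKn subnDl => c3.
  have : #|I| <= 3.
    rewrite -[X in _ <= X]/('C(3, 3 - 2)) -c3; apply/subset_leq_card/subsetP => t tI.
    have := IB t tI; rewrite sBG => tG; move: tI; rewrite /I in_set => /andP[/facesP[_ st ct] _].
    by rewrite in_set st tG ct eqxx.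
  by move: B3; lia.
have dQ : d < #|s :|: B| by rewrite sB -sq ltn_add2l.
have dS : d < #|S|.
  have : rk v S <= #|S| := rk_card v S.
  by rewrite full.
have [|w [gw wf]] := @genpos_exists _ _ _ v S (fs v S F) dS.
  move=> H Hf; split; last exact: fsd.
  by case/fsP: (Hf) => -[l [vl lH _]] _; exists l; split => //; rewrite (fs_indep full simp Hf) fsd.
set Q := s :|: B.
have rQ : rk w Q = d.+1.
  have [A AQ cA] := exists_subset_card dQ.
  apply/anti_leq/andP; split; first exact: rank_leq_col.
  by apply: leq_trans (rkS w AQ); rewrite gw ?subsetT ?cA.
(* General position makes every facet of [Q] a simplex; [set0], whose rank is too small for a facet,
   takes the place of the exceptional one. *)
have simpQ H : facet w Q H -> H <> set0 -> #|H| = d.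
  move=> [l [_ _]]; rewrite rQ => -[rH] _.
  apply/anti_leq/andP; split; last by apply: leq_trans (rk_card w H); rewrite rH.
  rewrite leqNgt; apply/negP => dH; have [A AH cA] := exists_subset_card dH.
  have : rk w A <= d by apply: leq_trans (rkS w AH) _; rewrite rH.
  by rewrite gw ?subsetT ?cA // ltnn.
have QS t : t \subset Q -> Dl (fs v S F) t -> Dl (fs w Q set0) t.
  move=> tQ /DlP[H Hf tH]; have [l [vl lH rH]] := wf H Hf.
  have QS : Q \subset S.
    rewrite subUset (subset_trans sG (@fs_sub _ _ _ _ _ _ _ Gf)) /=; apply/subsetP => x /setIP[/lkP[_ /DlP[K Kf]]].
    by rewrite subUset sub1set => /andP[/(subsetP (@fs_sub _ _ _ _ _ _ _ Kf))].
  have [||K fK zK] := @ext_facet _ _ _ w Q l.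
  - by move=> x xQ; apply: vl; apply: (subsetP QS).
  - apply: contrapT => h; have : Q \subset H.
      apply/subsetP => x xQ; rewrite -lH; apply/zsP; split; first exact: (subsetP QS).
      by apply/eqP/negPn/negP => nz; apply: h; exists x.
    by move/subset_leq_card; rewrite (fsd Hf) leqNgt dQ.
  apply/DlP; exists K; last first.
    apply: subset_trans zK; apply/subsetP => x xt; apply/zsP; split; first exact: (subsetP tQ).
    by have := subsetP tH x xt; rewrite -lH => /zsP[].
  apply/fsP; split => // K0; have [k [_ _]] := fK; rewrite K0 rk0 rQ => -[d0].
  by move: sq; rewrite -d0 addn3.
have s0 : ~~ (s \subset set0).
  by apply: contra sF; rewrite subset0 => /eqP->; apply: sub0set.
have := @sphere2_count _ _ _ w Q set0 rQ simpQ s s0 sq (QS s (subsetUl _ _) Ds).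
have : #|I| <= #|faces (fs w Q set0) s 2|.
  apply/subset_leq_card/subsetP => t tI; have tQ := IB t tI.
  move: tI; rewrite /I in_set => /andP[/facesP[Dt st ct] _]; apply/facesP; split => //.
  exact: QS.
have : #|lk (fs w Q set0) s| <= #|B|.
  apply/subset_leq_card/subsetP => x /lkP[xs /DlP[H /fsP[/facet_sub HQ _]]].
  rewrite subUset sub1set => /andP[/(subsetP HQ)].
  by rewrite in_setU (negbTE xs).
lia.
Qed.

End RigidityBase.

(** * Rigidity inequalities by attaching vertex links *)

Section Gluing.
Variables (R : realFieldType) (d : nat) (T : finType) (v : T -> 'rV[R]_d.+1).
Variables (S F : {set T}).
Hypothesis full : rk v S = d.+1.
Hypothesis simp : forall G, facet v S G -> G <> F -> #|G| = d.
Local Notation fs := (fs v S F).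
Local Notation Dl := (Dl fs).
Local Notation faces := (faces fs).
Local Notation lk := (lk fs).
Implicit Types (G H s t W : {set T}) (u : T).

Let fsd : forall G, G \in fs -> #|G| = d := @fs_card _ _ _ _ _ _ simp.

(** As long as some facet through [s] is not inside [W], connectedness yields one adjacent to a
    facet inside [W] across a ridge off [F]. That ridge has a vertex [u] outside [s] with [u |: s]
    not inside [F], and [W] grows by the link of [u |: s]. Edges gained at different moments are
    distinct, as those gained at one moment lie in the enlarged [W]. *)
Lemma glue s q (pr : pred {set T}) (om : T -> nat) : #|s| + q = d -> 2 <= q ->
  (s \subset F -> facet v S F) ->
  (forall u W G, u \notin s -> ~~ (u |: s \subset F) -> G \in fs -> u |: s \subset G ->
    G \subset W ->
    \sum_(x in lk (u |: s) :\: W) om x <=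
    #|[set t in faces s 2 | [&& pr t, ~~ (t \subset W) & t \subset W :|: lk (u |: s)]]|) ->
  forall W G, G \in fs -> s \subset G -> G \subset W ->
  \sum_(x in lk s :\: W) om x <= #|newedges fs pr s W|.
Proof.
move=> sq q2 sF step W; have [n] := ubnP #|lk s :\: W|; elim: n W => // n IH W Wn G Gf sG GW.
have [/forall_inP all|] := boolP [forall H in fs, (s \subset H) ==> (H \subset W)].
  rewrite big1 // => x /setDP[/lkP[xs /DlP[H Hf]]]; rewrite subUset sub1set => /andP[xH sH].
  by have := all H Hf; rewrite sH => /subsetP/(_ x xH) ->.
rewrite negb_forall_in => /exists_inP[K Kf]; rewrite negb_imply => /andP[sK KW].
pose C := [set H in fs | (s \subset H) && (H \subset W)].
have [G1 [H [G1C Hf sH GH [GHF HC]]]] : exists G1 H, [/\ G1 \in C, H \in fs, s \subset H,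
    #|G1 :&: H| = d.-1 & ~~ (G1 :&: H \subset F) /\ H \notin C].
  apply: contrapT => h; have : K \in C.
    apply: (fs_connected full simp sF) => //.
    - by exists G; rewrite in_set Gf sG.
    - by move=> H; rewrite in_set => /and3P[].
    - move=> G1 H G1C Hf sH c nF; apply/negPn/negP => HC; apply: h; exists G1, H.
      by split.
  by rewrite in_set (negbTE KW) !andbF.
have HW : ~~ (H \subset W) by move: HC; rewrite in_set Hf sH.
move: G1C; rewrite in_set => /and3P[G1f sG1 G1W].
have [u [uG1 uH us uF]] : exists u, [/\ u \in G1, u \in H, u \notin s & ~~ (u |: s \subset F)].
  have [sF'|sF'] := boolP (s \subset F).
    have /subsetPn[u /setIP[uG uH] uF] := GHF.
    exists u; split => //; first by apply: contra uF; apply: (subsetP sF').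
    by rewrite subUset sub1set (negbTE uF).
  have : 0 < #|(G1 :&: H) :\: s|.
    rewrite cardsDS ?subsetI ?sG1 // GH subn_gt0 -sq; case: (q) q2 => [//|k] k2.
    by rewrite addnS /= -addn1 leq_add2l.
  case/card_gt0P => u /setDP[/setIP[uG uH] us]; exists u; split => //.
  by apply: contra sF'; apply: subset_trans; apply: subsetUr.
have usH : u |: s \subset H by rewrite subUset sub1set uH.
have usG : u |: s \subset G1 by rewrite subUset sub1set uG1.
have st := step u W G1 us uF G1f usG G1W.
set L := lk (u |: s) in st *.
have Ls : L \subset lk s by apply: lk_add.
have /subsetPn[h hH hW] := HW.
have hL : h \in L.
  apply: (lk_mem _ usH hH); first by apply/DlP; exists H.
  by apply: contra hW => /(subsetP usG)/(subsetP G1W).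
have := IH (W :|: L) _ G Gf sG (subset_trans GW (subsetUl _ _)).
have E : lk s :\: W = (lk s :\: (W :|: L)) :|: (L :\: W).
  apply/setP => x; apply/idP/idP.
    move=> /setDP[xs xW]; rewrite in_setU !in_setD in_setU xs (negbTE xW) /=.
    by case: (x \in L).
  rewrite in_setU => /orP[/setDP[xs]|/setDP[xL xW]].
    by rewrite in_setU negb_or => /andP[xW _]; rewrite in_setD xs xW.
  by rewrite in_setD xW (subsetP Ls).
have dis : [disjoint (lk s :\: (W :|: L)) & (L :\: W)].
  rewrite -setI_eq0; apply/eqP/setP => x; rewrite in_set0; apply/negP => /setIP[/setDP[_ h1] /setDP[h2 _]].
  by rewrite in_setU h2 orbT in h1.
rewrite E (eq_bigl _ _ (fun x => in_setU x _ _)) bigU //= => ih.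
have {}ih : \sum_(i in lk s :\: (W :|: L)) om i <= #|newedges fs pr s (W :|: L)|.
  apply: ih; rewrite ltnS in Wn; apply: leq_trans _ Wn; rewrite E cardsU_D.
  have -> : (L :\: W) :\: (lk s :\: (W :|: L)) = L :\: W.
    apply/setDidPl; rewrite disjoint_sym; exact: dis.
  rewrite -addn1 leq_add2l card_gt0; apply/set0Pn; exists h; by rewrite in_setD hW.
apply: leq_trans (leq_add ih st) _.
rewrite -cardsUI (_ : _ :&: _ = set0) ?cards0 ?addn0; last first.
  apply/setP => t; rewrite in_set0; apply/negP => /setIP[]; rewrite !in_set.
  by case/and3P=> _ _ /negbTE h0 /and4P[_ _ _]; rewrite h0.
apply/subset_leq_card/subsetP => t /setUP[/setIdP[tf /andP[p h0]]|/setIdP[tf /and3P[p h0 _]]];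
  apply/setIdP; split => //; rewrite p //=.
by apply: contra h0 => h0; apply: subset_trans h0 (subsetUl _ _).
Qed.

(** Each new neighbour of the attached vertex [u] brings the edge to [u] and, by induction in the
    link of [u |: s], [q - 1] further edges. For [q = 3] and [s] inside [F] the link is a disk,
    which is too flexible; for larger [q] only links not inside [F] enter the induction. *)
Lemma rigid s q : #|s| + q = d -> 3 <= q -> (s \subset F -> facet v S F) ->
  (q = 3 -> ~~ (s \subset F)) -> forall W G, G \in fs -> s \subset G -> G \subset W ->
  q * #|lk s :\: W| <= #|newedges fs xpredT s W|.
Proof.
elim: q s => // q IH s sq q3 sF q3F W G Gf sG GW.
have [q2|q2] := eqVneq q 2.
  by subst q; apply: (rigid_base full simp sq (q3F erefl) Gf).
rewrite mulnC -sum_nat_const; apply: (glue sq (ltnW q3) sF _ Gf sG GW).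
move=> u {sG GW}W {Gf}G us uF Gf usG GW.
rewrite sum_nat_const; have sG : s \subset G by apply: subset_trans usG; apply: subsetUr.
have uG : u \in G by apply: (subsetP usG); rewrite setU11.
have := star_count (fs := fs) (pr := xpredT) us (subset_trans sG GW) (subsetP GW u uG) (subxx W)
  (fun _ => isT) (fun _ _ _ => isT).
apply: leq_trans; rewrite mulnC mulSn leq_add2l.
apply: (IH _ _ _ _ _ W G) => //.
- by rewrite cardsU1 us add1n addSnnS.
- by rewrite ltn_neqAle eq_sym q2.
- by move=> h; rewrite h in uF.
Qed.

(** The attached vertex [u] lies outside [F], so its edge to any new vertex is interior, whence
    weight 1 for vertices of [F]. The [q - 1] further edges are counted only for vertices outside
    [F]. *)
Lemma rigid_interior s q : #|s| + q = d -> 4 <= q -> s \subset F -> facet v S F ->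
  forall W G, G \in fs -> s \subset G -> G \subset W ->
  \sum_(x in lk s :\: W) (if x \in F then 1 else q) <=
  #|newedges fs (fun t => ~~ (t \subset F)) s W|.
Proof.
move=> sq q4 sF fF; apply: (glue sq) => //; first by apply: ltn_trans q4.
move=> u W G us uF Gf usG GW.
have sG : s \subset G by apply: subset_trans usG; apply: subsetUr.
have uG : u \in G by apply: (subsetP usG); rewrite setU11.
have uF' : u \notin F by apply: contra uF => uF; rewrite subUset sub1set uF.
(* Rigidity of the link of [u |: s] is applied relative to the complement of [NA]: the edges counted
   there contain a vertex outside [F] and are therefore interior even after [u] is removed. *)
set N := lk (u |: s) :\: W; pose NA := N :\: F.
have WN : W \subset ~: NA.
  by apply/subsetP => x xW; rewrite in_setC in_setD in_setD xW andbF.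
have r := @rigid (u |: s) q.-1 _ _ _ _ (~: NA) G Gf usG (subset_trans GW WN).
have E : lk (u |: s) :\: ~: NA = NA.
  by apply/setP => x; rewrite in_setD in_setC negbK in_setD in_setD; case: (x \in lk _); rewrite ?andbF // !andbT.
have := star_count (fs := fs) (pr := fun t => ~~ (t \subset F)) us (subset_trans sG GW)
  (subsetP GW u uG) WN _ _.
rewrite -/N => sc.
have {}sc := sc _ _; apply: leq_trans (sc _ _).
- have {}r : q.-1 * #|NA| <= #|newedges fs xpredT (u |: s) (~: NA)|.
    rewrite -{1}E; apply: r.
    + by rewrite cardsU1 us add1n addSnnS prednK // (leq_trans _ q4).
    + by rewrite -ltnS prednK // (leq_trans _ q4).
    + by move=> h; rewrite h in uF.
    + by move=> _.
  apply: leq_trans (leq_add (leqnn _) r).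
  rewrite (bigID (mem F)) /= -(cardsID F N) -addnA; apply: leq_add.
    rewrite (eq_bigr (fun=> 1)) => [|x /andP[_ ->]//].
    rewrite sum1_card; apply/subset_leq_card/subsetP => x; rewrite unfold_in /= => /andP[xN xF].
    by rewrite in_setI xN.
  rewrite (eq_bigr (fun=> q)) => [|x /andP[_ /negbTE->]//].
  rewrite sum_nat_const -/NA mulnC; have -> : #|[pred x | x \in N & x \notin F]| = #|NA|.
    by apply: eq_card => x; rewrite in_setD unfold_in /= andbC.
  by case: (q) q4 => // k _; rewrite mulSn.
- by move=> x; apply: contra uF => h; apply: subset_trans h; apply: subsetUr.
- move=> t tf /subsetPn[x xt]; rewrite in_setC negbK => /setDP[xN xF].
  apply/subsetPn; exists x => //; rewrite in_setD1 xt andbT.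
  by case/setDP: xN => /lkP[]; rewrite in_setU1 negb_or => /andP[].
Qed.

End Gluing.

Section Counting.
Variables (T : finType) (fs : {set {set T}}) (F : {set T}).
Implicit Types (G s t W : {set T}) (u x : T).
Local Notation Dl := (Dl fs).
Local Notation faces := (faces fs).
Local Notation ifaces := (ifaces fs F).
Local Notation lk := (lk fs).

Lemma link_faces_sum (pr : pred {set T}) s j :
  \sum_(u in lk s) #|[set t in faces (u |: s) j | pr t]| = j.+1 * #|[set t in faces s j.+1 | pr t]|.
Proof.
transitivity (\sum_(t in [set t in faces s j.+1 | pr t]) \sum_(u in lk s | t \in faces (u |: s) j) 1).
  rewrite [RHS](exchange_big_dep (fun u => u \in lk s)) /=; last by move=> t u _ /andP[].
  apply: eq_bigr => u ul; rewrite -sum1_card; apply: eq_bigl => t; rewrite ul.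
  apply/setIdP/andP => [[tf pt]|[/setIdP[tf pt] tf']]; last by split.
  split => //; apply/setIdP; split => //; have [Dt st ct] := facesP _ _ _ _ tf.
  have [us _] := lkP _ _ _ ul; apply/facesP; split => //.
    by apply: subset_trans st; apply: subsetUr.
  by rewrite ct cardsU1 us add1n addSnnS.
rewrite (eq_bigr (fun=> j.+1)) => [|t /setIdP[tf pt]]; first by rewrite sum_nat_const mulnC.
have [Dt st ct] := facesP _ _ _ _ tf.
rewrite sum1_card; transitivity #|t :\: s|; last by rewrite cardsDS // ct addKn.
apply: eq_card => u; rewrite unfold_in /=; apply/andP/setDP.
  move=> [/lkP[us _] /facesP[_ ust _]]; split => //.
  by apply: (subsetP ust); rewrite setU11.
move=> [ut us]; split; first exact: lk_mem ut us.
apply/facesP; split => //; first by rewrite subUset sub1set ut.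
by rewrite ct cardsU1 us add1n addSnnS.
Qed.

Lemma link_faces_sumT s j : \sum_(u in lk s) #|faces (u |: s) j| = j.+1 * #|faces s j.+1|.
Proof.
have E r k : #|faces r k| = #|[set t in faces r k | xpredT t]|.
  by apply: eq_card => t; rewrite [RHS]in_set andbT.
by rewrite E -(link_faces_sum xpredT); apply: eq_bigr => u _; exact: E.
Qed.

Lemma ifaces_link_sum s j : \sum_(u in lk s) #|ifaces (u |: s) j| = j.+1 * #|ifaces s j.+1|.
Proof. exact: (link_faces_sum (fun t => ~~ (t \subset F))). Qed.

Lemma ifaces_out s j : ~~ (s \subset F) -> ifaces s j = faces s j.
Proof.
move=> sF; apply/setP => t; apply/setIdP/idP => [[]//|tf]; split => //.
by have [_ st _] := facesP _ _ _ _ tf; apply: contra sF; apply: subset_trans.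
Qed.

Lemma ifaces1 s : s \subset F -> #|ifaces s 1| = #|lk s :\: F|.
Proof.
move=> sF.
have inj : {in lk s :\: F &, injective (fun u => u |: s)}.
  move=> x y /setDP[/lkP[xs _] _] /setDP[/lkP[ys _] _] E; have : x \in y |: s by rewrite -E setU11.
  by rewrite in_setU1 (negbTE xs) orbF => /eqP.
rewrite -(card_in_imset inj); apply: eq_card => t; apply/setIdP/imsetP.
  move=> [/facesP[Dt st c] /subsetPn[u ut uF]].
  have us : u \notin s by apply: contra uF; apply: (subsetP sF).
  exists u; first by apply/setDP; split => //; apply: lk_mem ut us.
  by apply/esym/eqP; rewrite eqEcard subUset sub1set ut st cardsU1 us c addnC leqnn.
move=> [u /setDP[/lkP[us Du] uF] ->]; split.
  by apply/facesP; split => //; [apply: subsetUr|rewrite cardsU1 us addnC].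
by rewrite subUset sub1set (negbTE uF).
Qed.

Definition bfaces s j := [set t in faces s j | t \subset F].

Lemma faces_split s j : #|faces s j| = #|ifaces s j| + #|bfaces s j|.
Proof. exact: (pred_split _ (fun t => t \subset F)). Qed.

(* The three ways of counting incidences between a vertex and an edge of a link. *)
Lemma link_sums s : s \subset F ->
  [/\ \sum_(u in lk s :\: F) #|lk (u |: s)| + \sum_(u in lk s :&: F) #|lk (u |: s) :\: F| =
        2 * #|ifaces s 2| &
      \sum_(u in lk s :&: F) #|lk (u |: s)| =
        \sum_(u in lk s :&: F) #|lk (u |: s) :\: F| + 2 * #|bfaces s 2|].
Proof.
move=> sF; have sp (f : T -> nat) : \sum_(u in lk s) f u =
    \sum_(u in lk s :\: F) f u + \sum_(u in lk s :&: F) f u.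
  by rewrite (big_setID F) /= addnC.
have E1 : \sum_(u in lk s :\: F) #|lk (u |: s)| + \sum_(u in lk s :&: F) #|lk (u |: s) :\: F| =
    2 * #|ifaces s 2|.
  rewrite -ifaces_link_sum sp; congr (_ + _); apply: eq_bigr => u.
    move=> /setDP[_ uF]; rewrite ifaces_out ?faces1 //.
    by rewrite subUset sub1set (negbTE uF).
  by move=> /setIP[_ uF]; rewrite ifaces1 // subUset sub1set uF.
split => //; apply/eqP; rewrite -(eqn_add2l (\sum_(u in lk s :\: F) #|lk (u |: s)|)).
rewrite -sp addnA E1 -mulnDr -faces_split -link_faces_sumT; apply/eqP.
by apply: eq_bigr => u _; rewrite faces1.
Qed.

End Counting.

(* The boundary complex of the facet [F] is the link of [x] in the pyramid [x |: F]. *)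
Section Boundary.
Variables (R : realFieldType) (d : nat) (T : finType) (v : T -> 'rV[R]_d.+1).
Variables (S F : {set T}).
Hypothesis full : rk v S = d.+1.
Hypothesis simp : forall G, facet v S G -> G <> F -> #|G| = d.
Hypothesis fF : facet v S F.
Variable x : T.
Hypothesis xS : x \in S.
Hypothesis xF : x \notin F.
Local Notation S' := (x |: F).
Local Notation fs' := (fs v S' F).
Local Notation fs := (fs v S F).
Implicit Types (G H s : {set T}).

Let S'S : S' \subset S.
Proof. by rewrite subUset sub1set xS (facet_sub fF). Qed.

Let ex_lF : exists l, [/\ valid v S l, zs v S l = F, ev v x l != 0%R &
  forall t, t \in F -> ev v t l = 0%R].
Proof.
have [l [vl lF _]] := fF; exists l; split => //.
  by apply: contra xF => /eqP h; rewrite -lF; apply/zsP.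
by move=> t; rewrite -{1}lF => /zsP[].
Qed.

Lemma pyramid_full : rk v S' = d.+1.
Proof.
have [l [_ _ lx lF]] := ex_lF; by rewrite (rk_add lF lx) (facet_rk full fF).
Qed.

Lemma pyramid_facet : facet v S' F.
Proof.
have [l [vl lF lx lz]] := ex_lF; exists l; split.
- by move=> t tS; apply: vl; apply: (subsetP S'S).
- apply/setP => t; apply/zsP/idP => [[]|tF]; last by rewrite in_setU1 tF orbT lz.
  by rewrite in_setU1 => /orP[/eqP->/eqP|//]; rewrite (negbTE lx).
- by rewrite pyramid_full (facet_rk full fF).
Qed.

(** The base [H :\ x] is a ridge of [F]. Adding a large multiple of the functional of [F] exposes it
    in [S], hence it lies in a facet other than [F] and is independent. *)
Lemma pyramid_other H : facet v S' H -> H <> F ->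
  [/\ x \in H, H :\ x \subset F, Dl fs (H :\ x) & #|H| = d].
Proof.
move=> fH HF; have HS := facet_sub fH.
have xH : x \in H.
  apply: contraT => xH; case: HF; apply: (facet_inj fH pyramid_facet).
  apply/subsetP => t tH; have := subsetP HS t tH; rewrite in_setU1 => /orP[/eqP E|//].
  by rewrite E (negbTE xH) in tH.
have rF : H :\ x \subset F.
  apply/subsetP => t /setD1P[tx tH]; have := subsetP HS t tH.
  by rewrite in_setU1 (negbTE tx).
have [k [vk kF kx kz]] := ex_lF.
have [l [vl lH rH]] := fH.
have rr : (rk v (H :\ x)).+1 = d.
  have h0 : forall t, t \in H :\ x -> ev v t k = 0%R by move=> t /(subsetP rF)/kz.
  rewrite -(rk_add h0 kx) setD1K //; move: rH; rewrite pyramid_full; exact: succn_inj.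
have [c c0 hc] := large_mult S (fun t => ev v t l) (fun t => ev v t k).
have E t : ev v t (l + c *: k)%R = (ev v t l + c * ev v t k)%R by rewrite /ev !prE.
have EF t : t \in F -> ev v t (l + c *: k)%R = ev v t l by move=> tF; rewrite E kz // mulr0 addr0.
have nF t : t \in S -> t \notin F -> (ev v t (l + c *: k) < 0)%R.
  move=> tS tF; rewrite E; apply: hc => //; rewrite lt_neqAle vk // andbT.
  by apply: contra tF => /eqP h; rewrite -kF; apply/zsP.
have z0 : zs v S (l + c *: k)%R = H :\ x.
  apply/setP => t; apply/zsP/setD1P.
    move=> [tS h]; have tF : t \in F by apply: contraT => /(nF t tS); rewrite h ltxx.
    split; first by apply: contraNneq xF => <-.
    by rewrite -lH; apply/zsP; rewrite in_setU1 tF orbT -EF.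
  move=> [tx tH]; have tF : t \in F by apply: (subsetP rF); apply/setD1P.
  split; first exact: (subsetP (facet_sub fF)).
  by rewrite EF //; move: tH; rewrite -{1}lH => /zsP[].
have [|||G fG [zG GF]] := @ext_facet_neq _ _ _ v S (l + c *: k)%R F.
- move=> t tS; have [tF|tF] := boolP (t \in F); last exact/ltW/nF.
  by rewrite EF //; apply: vl; rewrite in_setU1 tF orbT.
- by exists x => //; rewrite lt_eqF // nF.
- by rewrite z0 rr full.
rewrite z0 in zG.
have Gf : G \in fs by apply/fsP; split => //; apply/eqP.
split => //; first by apply/DlP; exists G.
by rewrite (cardsD1 x H) xH -(indepS (fs_indep full simp Gf) zG) add1n.
Qed.

Lemma pyramid_simp H : facet v S' H -> H <> F -> #|H| = d.
Proof. by move=> fH HF; case: (pyramid_other fH HF). Qed.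

Lemma pyramid_Dl (t : {set T}) : t \subset F -> Dl fs' (x |: t) = Dl fs t.
Proof.
move=> tF; apply/idP/idP => /DlP[G /fsP[fG GF] tG].
  have [_ _ D _] := pyramid_other fG GF; apply: Dl_sub D.
  rewrite subsetD1; apply/andP; split; first exact: subset_trans (subsetUr _ _) tG.
  by apply: contra xF; apply: (subsetP tF).
have [k [vk kF kx kz]] := ex_lF; have [l [vl lG _]] := fG.
(* A multiple of the functional of [F] makes [l] vanish at the apex without changing it on [F]. *)
pose m := (l - (ev v x l / ev v x k) *: k)%R.
have E u : ev v u m = (ev v u l - (ev v x l / ev v x k) * ev v u k)%R by rewrite /ev !prE.
have mx : ev v x m = 0%R by rewrite E divfK // subrr.
have mF u : u \in F -> ev v u m = ev v u l by move=> uF; rewrite E (kz u uF) mulr0 subr0.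
have [||H fH zH] := @ext_facet _ _ _ v S' m.
- move=> u; rewrite in_setU1 => /orP[/eqP->|uF]; first by rewrite mx.
  by rewrite mF // vl // (subsetP (facet_sub fF)).
- have [u uF uG] : exists2 u, u \in F & u \notin G.
    apply/subsetPn/negP => FG; apply: GF; exact/esym/(facet_inj fF fG).
  exists u; first by rewrite in_setU1 uF orbT.
  rewrite mF //; apply: contra uG => /eqP h; rewrite -lG; apply/zsP; split => //.
  exact: (subsetP (facet_sub fF)).
have xtH : x |: t \subset H.
  apply: subset_trans zH; rewrite subUset sub1set; apply/andP; split.
    by apply/zsP; rewrite setU11.
  apply/subsetP => u ut; have uF := subsetP tF u ut; apply/zsP; rewrite in_setU1 uF orbT; split => //.
  by rewrite mF //; have := subsetP tG u ut; rewrite -{1}lG => /zsP[].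
apply/DlP; exists H => //; apply/fsP; split => // HF.
by case/negP: xF; rewrite -HF; apply: (subsetP xtH); rewrite setU11.
Qed.

Lemma pyramid_faces s j : s \subset F -> #|faces fs' (x |: s) j| = #|bfaces fs F s j|.
Proof.
move=> sF; have xn (t : {set T}) : t \subset F -> x \notin t by move=> tF; apply: contra xF; apply: (subsetP tF).
have inj : {in bfaces fs F s j &, injective (fun t => x |: t)}.
  move=> t t' /setIdP[_ tF] /setIdP[_ tF'] E.
  by rewrite -(setU1K (xn t tF)) E setU1K // xn.
rewrite -(card_in_imset inj); apply: eq_card => t; apply/idP/imsetP.
  move=> /facesP[Dt xst ct]; have xt : x \in t by apply: (subsetP xst); rewrite setU11.
  have tF : t :\ x \subset F.
    case/DlP: Dt => H /fsP[/facet_sub HS _] tH; apply/subsetP => u /setD1P[ux ut].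
    by have := subsetP HS u (subsetP tH u ut); rewrite in_setU1 (negbTE ux).
  exists (t :\ x); last by rewrite setD1K.
  apply/setIdP; split => //; apply/facesP; split.
  - by rewrite -pyramid_Dl // setD1K.
  - by rewrite subsetD1 xn // andbT; apply: subset_trans xst; apply: subsetUr.
  - by have := cardsD1 x t; rewrite xt ct cardsU1 xn // !add1n addSn => -[<-].
move=> [r /setIdP[/facesP[Dr sr cr] rF] ->]; apply/facesP; split.
- by rewrite pyramid_Dl.
- exact: setUS.
- by rewrite !cardsU1 !xn // cr addnA.
Qed.

Lemma pyramid_lk s : s \subset F -> lk fs' (x |: s) = lk fs s :&: F.
Proof.
move=> sF; apply/setP => u; apply/lkP/setIP.
  rewrite in_setU1 negb_or => -[/andP[ux us] D].
  have uF : u \in F.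
    case/DlP: D => H /fsP[/facet_sub HS _]; rewrite subUset sub1set => /andP[/(subsetP HS)].
    by rewrite in_setU1 (negbTE ux).
  split => //; apply/lkP; split => //.
  by rewrite -pyramid_Dl ?subUset ?sub1set ?uF // setUCA.
move=> [/lkP[us D] uF]; have ux : u != x by apply: contraNneq xF => <-.
split; first by rewrite in_setU1 negb_or ux.
by rewrite setUCA pyramid_Dl // subUset sub1set uF.
Qed.

End Boundary.

Lemma cardsDK (T : finType) (A B : {set T}) : A \subset B -> #|B| = #|B :\: A| + #|A|.
Proof. by move=> AB; rewrite cardsDS // subnK // subset_leq_card. Qed.

(** * Minimal edge numbers of links, and inheritance of equality *)

Section EdgeBounds.
Variables (R : realFieldType) (d : nat) (T : finType) (v : T -> 'rV[R]_d.+1).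
Variables (S F : {set T}).
Hypothesis full : rk v S = d.+1.
Hypothesis simp : forall G, facet v S G -> G <> F -> #|G| = d.
Local Notation fs' x := (fs v (x |: F) F).
Local Notation fs := (fs v S F).
Local Notation Dl0 := Dl.
Local Notation Dl := (Dl fs).
Local Notation faces := (faces fs).
Local Notation ifaces := (ifaces fs F).
Local Notation lk := (lk fs).
Implicit Types (G H s W : {set T}) (u x : T).

Let fsd : forall G, G \in fs -> #|G| = d := @fs_card _ _ _ _ _ _ simp.

Lemma card_lkD s q G : #|s| + q = d -> G \in fs -> s \subset G -> #|lk s :\: G| + q = #|lk s|.
Proof.
move=> sq Gf sG; rewrite -[RHS](cardsID G) addnC; congr (_ + _).
have cG : #|G :\: s| = q by rewrite cardsDS // (fsd Gf) -sq addKn.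
rewrite -cG; apply: eq_card => x.
apply/setDP/setIP => [[xG xs]|[/lkP[xs _] xG]]; split => //.
by apply: (lk_mem _ sG) => //; apply/DlP; exists G.
Qed.

Lemma edges_in_facet s q G : #|s| + q = d -> 2 <= q -> G \in fs -> s \subset G ->
  #|[set t in faces s 2 | t \subset G]| = 'C(q, 2).
Proof.
move=> sq q2 Gf sG; have c := card_interval sG (k := #|s| + 2).
rewrite (fsd Gf) -{1}sq leq_add2l in c; have {c} := c q2.
have -> : d - #|s| = q by rewrite -sq addKn.
have -> : d - (#|s| + 2) = q - 2 by rewrite -sq subnDl.
rewrite bin_sub // => <-.
apply: eq_card => t; apply/setIdP/idP; rewrite in_set.
  by move=> [/facesP[_ st ct] tG]; rewrite st tG ct eqxx.
move=> /and3P[st tG /eqP ct]; split => //; apply/facesP; split => //.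
by apply/DlP; exists G.
Qed.

(** One facet accounts for [q] vertices and C(q, 2) edges of the link, and each remaining vertex
    brings [q] edges: f >= q m - q(q+1)/2, stated here without division. *)
Lemma edge_lb s q : #|s| + q = d -> 3 <= q -> (s \subset F -> facet v S F) ->
  (q = 3 -> ~~ (s \subset F)) -> Dl s -> 2 * q * #|lk s| <= 2 * #|faces s 2| + q * q.+1.
Proof.
move=> sq q3 sF q3F /DlP[G Gf sG].
have r := rigid full simp sq q3 sF q3F Gf sG (subxx G).
have c := card_lkD sq Gf sG.
have := pred_split (faces s 2) (fun t => t \subset G).
rewrite (edges_in_facet sq (ltnW q3) Gf sG) -/(newedges fs xpredT s G).
move: r c (mul_bin_diag q 1); rewrite bin1.
move: #|lk s :\: G| #|lk s| #|newedges _ _ _ _| #|faces s 2| 'C(q, 2) => a b e f c.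
by case: (q) q3 => // k _ /=; nia.
Qed.

Lemma star_newedges (pr : pred {set T}) s u : u \in lk s ->
  #|[set x in lk (u |: s) | pr (x |: (u |: s))]| + #|[set t in faces (u |: s) 2 | pr (t :\ u)]| <=
  #|[set t in faces s 2 | pr t && (t \subset (u |: s) :|: lk (u |: s))]|.
Proof.
move=> /lkP[us _].
have := star_count_gen fs pr us (subsetUr [set u] s) (setU11 u s) (subxx (u |: s)).
set A := #|_| + _; set B := #|_| + _ => h; suff -> : B = A.
  apply: leq_trans h _; apply/subset_leq_card/subsetP => t /setIdP[tf /and3P[p _ tL]].
  by apply/setIdP; rewrite p tL.
rewrite /A /B; congr (_ + _); apply: eq_card => t.
  apply/setIdP/setIdP => [[tl p]|[/setDP[tl _] p]]; split => //; apply/setDP; split => //.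
  by case/lkP: tl.
apply/setIdP/setIdP => [[tf p]|[/setIdP[tf _] p]]; split => //; apply/setIdP; split => //=.
have [_ _ ct] := facesP _ _ _ _ tf; apply/negP => /subset_leq_card.
by rewrite ct addn2 ltnNge leqnSn.
Qed.

Lemma lk_starD s u : u \in lk s ->
  lk s :\: ((u |: s) :|: lk (u |: s)) = (lk s :\ u) :\: lk (u |: s).
Proof.
move=> ul; apply/setP => x; rewrite !in_setD in_setU in_setU1 in_set1 !negb_or.
case xl: (x \in lk s); rewrite ?andbF // !andbT.
by have [-> _] := lkP _ _ _ xl; rewrite andbT andbC.
Qed.

Lemma lk_starS s u : lk (u |: s) \subset lk s :\ u.
Proof.
apply/subsetP => x xl; have := subsetP (lk_add fs s u) x xl => xl'.
by rewrite in_setD1 xl' andbT; case/lkP: xl; rewrite in_setU1 negb_or => /andP[].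
Qed.

Lemma star_facet s u : u \in lk s -> exists G, [/\ G \in fs, u |: s \subset G, s \subset G &
  G \subset (u |: s) :|: lk (u |: s)].
Proof.
move=> /lkP[_ /DlP[G Gf usG]]; exists G; split => //; first by apply: subset_trans usG; apply: subsetUr.
apply/subsetP => x xG; rewrite in_setU; apply/orP.
have [xs|xs] := boolP (x \in u |: s); [by left|right].
by apply: lk_mem xG xs => //; apply/DlP; exists G.
Qed.

Lemma link_lb s q u : #|s| + q = d -> u \in lk s -> #|u |: s| + q.-1 = d \/ q = 0.
Proof.
move=> sq /lkP[us _]; case: q sq => [|q] sq; [by right|left].
by rewrite cardsU1 us -sq addnS add1n.
Qed.

(** Start the gluing from the star of [u] instead of a facet. The edges outside the star already
    number at least [q] per vertex, so a tight total leaves the link of [u] no edge beyond its own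
    minimum. *)
Lemma edge_eq_link s q u : #|s| + q = d -> 4 <= q -> (s \subset F -> facet v S F) ->
  2 * #|faces s 2| + q * q.+1 = 2 * q * #|lk s| -> u \in lk s -> ~~ (u |: s \subset F) ->
  2 * #|faces (u |: s) 2| + q.-1 * q.-1.+1 = 2 * q.-1 * #|lk (u |: s)|.
Proof.
move=> sq q4 sF eq ul uF; have [us Du] := lkP _ _ _ ul.
have usq : #|u |: s| + q.-1 = d by case: (link_lb sq ul) => // q0; rewrite q0 in q4.
have q13 : 3 <= q.-1 by case: (q) q4.
have lb := edge_lb usq q13 (fun h => False_ind _ (negP uF h)) (fun _ => uF) Du.
have [G [Gf usG sG GL]] := star_facet ul.
have h3 : q = 3 -> ~~ (s \subset F) by move=> h; rewrite h in q4.
have {h3}r := rigid full simp sq (ltnW q4) sF h3 Gf sG GL.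
have := star_newedges xpredT ul.
have := pred_split (faces s 2) (fun t => t \subset (u |: s) :|: lk (u |: s)).
rewrite -/(newedges fs xpredT s _).
have -> : [set x in lk (u |: s) | xpredT (x |: (u |: s))] = lk (u |: s).
  by apply/setP => x; rewrite in_set andbT.
have -> : [set t in faces (u |: s) 2 | xpredT (t :\ u)] = faces (u |: s) 2.
  by apply/setP => x; rewrite in_set andbT.
have c : #|lk s| = (#|lk s :\: ((u |: s) :|: lk (u |: s))| + #|lk (u |: s)|).+1.
  by rewrite lk_starD // cardsDS ?lk_starS // subnK ?subset_leq_card ?lk_starS // (cardsD1 u) ul.
move: c eq r lb; rewrite /=.
move: #|lk s :\: _| #|lk s| #|lk (u |: s)| #|newedges _ _ _ _| #|faces s 2| #|faces (u |: s) 2|.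
move: #|[set t in faces s 2 | _]| => i a m l e f f'.
case: (q) q4 => // k _ /= c eq r lb b st; apply/eqP; rewrite eqn_leq; apply/andP; split; nia.
Qed.

Lemma facet_out : facet v S F -> exists2 x, x \in S & x \notin F.
Proof.
move=> [l [vl lF rF]]; have [x xS xl] := facet_nz lF rF; exists x => //.
by apply: contra xl; rewrite -lF => /zsP[_ ->].
Qed.

(** The neighbour of [F] across a ridge through [s], found with the pyramid over [F]. It is the
    starting facet for interior counts because it has a single vertex outside [F]. *)
Lemma ridge_facet s : facet v S F -> s \subset F -> Dl s -> exists G u,
  [/\ G \in fs, s \subset G, u \in G, u \notin F & G :\ u \subset F].
Proof.
move=> fF sF Ds; have [x xS xF] := facet_out fF.
have : Dl0 (fs' x) (x |: s) by rewrite (pyramid_Dl full simp fF xS xF).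
case/DlP => H /fsP[fH HF] xsH; have [xH HxF /DlP[G Gf HG] cH] := pyramid_other full simp fF xS xF fH HF.
have [fG GF] := fsP _ _ _ _ Gf.
have /subsetPn[u uG uF] : ~~ (G \subset F) by apply/negP => GF'; apply/GF/(facet_inj fG fF).
have GE : H :\ x = G :\ u.
  apply/eqP; rewrite eqEcard subsetD1 HG /=; apply/andP; split.
    by apply: contra uF; apply: (subsetP HxF).
  have := cardsD1 u G; rewrite uG (fsd Gf) -cH (cardsD1 x H) xH.
  by move/(@addnI 1) => ->.
exists G, u; split => //; last by rewrite -GE.
apply: subset_trans HG; rewrite subsetD1; apply/andP; split.
  by apply: subset_trans xsH; apply: subsetUr.
by apply: contra xF; apply: (subsetP sF).
Qed.

Lemma sum_weights (A : {set T}) q :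
  \sum_(x in A) (if x \in F then 1 else q) = #|A :&: F| + q * #|A :\: F|.
Proof.
rewrite (big_setID F) /=; congr (_ + _).
  by rewrite -sum1_card; apply: eq_bigr => x /setIP[_ ->].
by rewrite mulnC -sum_nat_const; apply: eq_bigr => x /setDP[_ /negbTE->].
Qed.

Lemma newedges_interior s W : #|ifaces s 2| =
  #|newedges fs (fun t => ~~ (t \subset F)) s W| +
  #|[set t in faces s 2 | ~~ (t \subset F) && (t \subset W)]|.
Proof.
rewrite (pred_split (ifaces s 2) (fun t => t \subset W)); congr (_ + _); apply: eq_card => t.
  by apply/setIdP/setIdP => [[/setIdP[-> ->] ->]|[tf /andP[tF tW]]] //; split => //; apply/setIdP.
by apply/setIdP/setIdP => [[/setIdP[-> ->] ->]|[tf /andP[tF tW]]] //; split => //; apply/setIdP.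
Qed.

(** The starting facet has exactly one vertex outside [F] and contributes the [q - 1] edges at it;
    every other vertex contributes 1 or [q] according to [rigid_interior]. *)
Lemma iedge_lb s q : #|s| + q = d -> 4 <= q -> facet v S F -> s \subset F -> Dl s ->
  q.-1 * #|lk s :\: F| + #|lk s| <= #|ifaces s 2| + q.
Proof.
move=> sq q4 fF sF Ds; have [G [u [Gf sG uG uF GuF]]] := ridge_facet fF sF Ds.
have us : u \notin s by apply: contra uF; apply: (subsetP sF).
have := rigid_interior full simp sq q4 sF fF Gf sG (subxx G); rewrite sum_weights.
have c := card_lkD sq Gf sG.
have ul : u \in lk s by apply: lk_mem uG us => //; apply/DlP; exists G.
have c1 : #|lk s :\: F| = (#|(lk s :\: G) :\: F|).+1.
  rewrite (cardsD1 u) in_setD ul uF add1n; congr _.+1; apply: eq_card => x.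
  apply/setD1P/setDP => [[xu /setDP[xl xF]]|[/setDP[xl xG] xF]].
    split => //; apply/setDP; split => //; apply: contra xF => xG.
    by apply: (subsetP GuF); apply/setD1P.
  by split; [apply: contraNneq xG => ->|apply/setDP].
have c2 : #|lk s :\: G| = #|(lk s :\: G) :&: F| + #|(lk s :\: G) :\: F| by rewrite cardsID.
have ins : q.-1 <= #|[set t in faces s 2 | ~~ (t \subset F) && (t \subset G)]|.
  have usG : u |: s \subset G by rewrite subUset sub1set uG.
  have h := card_interval usG (k := #|s| + 2).
  rewrite (fsd Gf) -{1}sq leq_add2l in h; have {h} := h (ltnW (ltnW q4)).
  have -> : d - #|u |: s| = q.-1 by rewrite cardsU1 us -sq add1n subnS addKn.
  have -> : d - (#|s| + 2) = q.-1 - 1 by rewrite -sq subnDl subn1 subn2.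
  rewrite bin_sub ?bin1 => [<-|]; last by case: (q) q4 => [//|[]].
  apply/subset_leq_card/subsetP => t; rewrite in_set => /and3P[ust tG /eqP ct].
  have [ut st] : u \in t /\ s \subset t by move: ust; rewrite subUset sub1set => /andP.
  apply/setIdP; split; last by rewrite tG andbT; apply/subsetPn; exists u.
  by apply/facesP; split => //; apply/DlP; exists G.
rewrite (newedges_interior s G) c1 -c c2.
move: ins; move: #|newedges _ _ _ _| #|[set t in faces s 2 | _]| #|_ :&: F| #|(lk s :\: G) :\: F|.
by case: (q) q4 => // k _ /= A B C D; nia.
Qed.

(** As in [edge_eq_link], with interior edges and a vertex [u] of [F]. *)
Lemma iedge_eq_link s q u : #|s| + q = d -> 5 <= q -> facet v S F -> s \subset F ->
  #|ifaces s 2| + q = q.-1 * #|lk s :\: F| + #|lk s| -> u \in lk s -> u \in F ->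
  #|ifaces (u |: s) 2| + q.-1 = q.-1.-1 * #|lk (u |: s) :\: F| + #|lk (u |: s)|.
Proof.
move=> sq q5 fF sF eq ul uF; have [us Du] := lkP _ _ _ ul.
have usq : #|u |: s| + q.-1 = d by case: (link_lb sq ul) => // q0; rewrite q0 in q5.
have q14 : 4 <= q.-1 by case: (q) q5.
have usF : u |: s \subset F by rewrite subUset sub1set uF.
have lb := iedge_lb usq q14 fF usF Du.
have [G [Gf usG sG GL]] := star_facet ul.
have := rigid_interior full simp sq (ltnW q5) sF fF Gf sG GL; rewrite sum_weights lk_starD //.
set L := (lk s :\ u) :\: _.
have := star_newedges (fun t => ~~ (t \subset F)) ul.
have -> : [set x in lk (u |: s) | ~~ (x |: (u |: s) \subset F)] = lk (u |: s) :\: F.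
  by apply/setP => x; rewrite in_set in_setD subUset sub1set usF andbT andbC.
have -> : [set t in faces (u |: s) 2 | ~~ (t :\ u \subset F)] = ifaces (u |: s) 2.
  apply/setP => t; apply/setIdP/setIdP => -[tf tF]; split => //; move: tF; apply: contra.
    by apply: subset_trans (subsetDl _ _).
  move=> tF; apply/subsetP => x xt; have [->//|xu] := eqVneq x u.
  by apply: (subsetP tF); apply/setD1P.
have := newedges_interior s ((u |: s) :|: lk (u |: s)).
have c1 : #|lk s :\: F| = #|L :\: F| + #|lk (u |: s) :\: F|.
  have -> : lk s :\: F = (lk s :\ u) :\: F.
    apply/setP => x; rewrite !in_setD in_set1; have [->|//] := eqVneq x u; by rewrite uF.
  have -> : L :\: F = ((lk s :\ u) :\: F) :\: (lk (u |: s) :\: F).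
    by apply/setP => x; rewrite /L !in_setD; case: (x \in F); rewrite ?andbF //= andbT.
  by apply: cardsDK; rewrite setSD // lk_starS.
have c2 : #|lk s| = (#|L| + #|lk (u |: s)|).+1.
  by rewrite (cardsD1 u) ul add1n; congr _.+1; apply: cardsDK; exact: lk_starS.
have c3 : #|L| = #|L :&: F| + #|L :\: F| by rewrite cardsID.
move: eq lb; rewrite c2 c3 c1.
move: #|L :&: F| #|L :\: F| #|lk (u |: s) :\: F| #|lk (u |: s)|.
move: #|newedges _ _ _ _| #|[set t in faces s 2 | _]| #|ifaces s 2| #|ifaces (u |: s) 2|.
case: (q) q5 => // -[//|k] _ /= nw ins f f' B A a m e1 e2 e3 e4 e5.
by apply/eqP; rewrite eqn_leq e2 andbT; nia.
Qed.

End EdgeBounds.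

(** * The lower bound *)

(* Coefficients of the lower bounds: on a [q]-dimensional link, [q = k + 3], with [m] vertices,
   [a] of them outside [F], the numbers of [j]-element faces and of interior faces are at
   least [alpha * m - beta] and [gamma * a + delta * m - epsilon]. *)
Section Coefficients.
Local Open Scope ring_scope.

(** The start is Euler's relation on a 2-sphere. In the recursion, summing the bounds a m_u - b over
    vertex links gives j f_j >= 2 a f_2 - b m, into which f_2 >= q m - q(q+1)/2 is substituted. *)
Fixpoint sc (k j : nat) : rat * rat :=
  match k with
  | 0 => if j == 2%N then (3, 6) else (2, 4)
  | k'.+1 => let q := k'.+4%:R in
    if j == 2%N then (q, q * (q + 1) / 2)
    else let: (a, b) := sc k' j.-1 in ((2 * q * a - b) / j%:R, a * q * (q + 1) / j%:R)
  end.

(** The start is Euler's relation on a disk. In the recursion, vertices outside [F] use the bound of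
    [sc] and vertices in [F] that of [ic]. By [link_sums] the total is 2a times the interior edges
    plus 2d times the edges inside [F], minus b per vertex outside [F] and e per vertex in [F]; the
    edge bounds are then inserted. *)
Fixpoint ic (k j : nat) : rat * rat * rat :=
  match k with
  | 0 => if j == 2%N then (2, 1, 3) else (1, 1, 2)
  | k'.+1 => let q := k'.+4%:R in
    if j == 2%N then (q - 1, 1, q)
    else let: (a, b) := sc k' j.-1 in let: (g, d, e) := ic k' j.-1 in
      ((2 * a * (q - 1) - 2 * d * (q - 1) - b + e) / j%:R,
       (2 * a + 2 * d * (q - 1) - e) / j%:R,
       (2 * a * q + d * q * (q - 1)) / j%:R)
  end.

Lemma sc2 k : sc k 2 = (k.+3%:R, k.+3%:R * (k.+3%:R + 1) / 2).
Proof. by case: k => [|k] //=; congr pair. Qed.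

Lemma ic2 k : ic k 2 = (k.+3%:R - 1, 1, k.+3%:R).
Proof. by case: k. Qed.

(** Positivity lets lower bounds on edges be substituted and equalities be read backwards. The
    identity in the middle makes the two kinds of links combine in [interior_sum_alg]. The remaining
    inequalities keep the signs through the recursion. *)
Lemma coef_inv k j : (2 <= j)%N ->
  [/\ 0 < (sc k j).1, (sc k j).2 < (k.+3%:R + 1) * (sc k j).1,
      (ic k j).1.1 + (ic k j).1.2 = (sc k j).1,
      0 < (ic k j).1.2 & (ic k j).2 <= k.+3%:R * (ic k j).1.2].
Proof.
elim: k j => [|k IH] j j2 /=; first by case: ifP.
have [_|j2'] := eqVneq j 2%N.
  have q0 : 0 < k.+4%:R :> rat by rewrite ltr0n.
  split => //=; nra.
have {}j2 : (2 <= j.-1)%N by move/eqP: j2' => j2'; clear IH; lia.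
have j0 : 0 < j%:R^-1 :> rat by rewrite invr_gt0 ltr0n; case: (j) j2.
have := IH j.-1 j2.
case: (sc k j.-1) => a b; case: (ic k j.-1) => -[g d] e /= [a0 ba gda d0 ed].
have qE : k.+4%:R = k.+3%:R + 1 :> rat by rewrite -[in LHS]addn1 natrD.
have q0 : 0 < k.+3%:R :> rat by rewrite ltr0n.
rewrite qE; set q := k.+3%:R in ba ed q0 *.
split.
- by rewrite mulr_gt0 //; nra.
- rewrite mulrA ltr_pM2r //; nra.
- rewrite -mulrDl; congr (_ * _); rewrite -gda; ring.
- by rewrite mulr_gt0 //; nra.
- rewrite mulrA ler_pM2r //; nra.
Qed.

Lemma edge_bound_rat (q m f : nat) :
  (2 * q * m <= 2 * f + q * q.+1)%N = (q%:R * m%:R - q%:R * (q%:R + 1) / 2 <= f%:R :> rat).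
Proof.
rewrite -(ler_nat rat) [X in (_ <= X) = _]natrD !natrM -[q.+1%:R]natr1.
by apply/idP/idP => h; lra.
Qed.

Lemma edge_eq_rat (q m f : nat) :
  (2 * f + q * q.+1 = 2 * q * m)%N <-> f%:R = q%:R * m%:R - q%:R * (q%:R + 1) / 2 :> rat.
Proof.
split=> [/(congr1 (fun n => n%:R : rat))|h].
  rewrite [X in X = _]natrD !natrM -[q.+1%:R]natr1 => h; lra.
apply/eqP; rewrite -(eqr_nat rat) [X in X == _]natrD !natrM -[q.+1%:R]natr1 h; apply/eqP; lra.
Qed.

Lemma iedge_bound_rat (q a m f : nat) : (0 < q)%N ->
  (q.-1 * a + m <= f + q)%N = ((q%:R - 1) * a%:R + m%:R - q%:R <= f%:R :> rat).
Proof.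
case: q => // q _; rewrite -(ler_nat rat) !natrD natrM -[q.+1%:R]natr1 /= addrK.
by apply/idP/idP => h; lra.
Qed.

Lemma iedge_eq_rat (q a m f : nat) : (0 < q)%N ->
  (f + q = q.-1 * a + m)%N <-> f%:R = (q%:R - 1) * a%:R + m%:R - q%:R :> rat.
Proof.
case: q => // q _; split=> [/(congr1 (fun n => n%:R : rat))|h].
  rewrite !natrD natrM -[q.+1%:R]natr1 /= addrK => h; lra.
by apply/eqP; rewrite -(eqr_nat rat) !natrD natrM h -[q.+1%:R]natr1 /=; apply/eqP; ring.
Qed.

Lemma sum_affine (T : finType) (X : {set T}) (f : T -> rat) (A B : rat) :
  \sum_(u in X) (A * f u - B) = A * (\sum_(u in X) f u) - #|X|%:R * B.
Proof. by rewrite big_split /= -mulr_sumr sumr_const mulr_natl mulNrn. Qed.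

Lemma sum_affine2 (T : finType) (X : {set T}) (f h : T -> rat) (A B C : rat) :
  \sum_(u in X) (A * f u + B * h u - C) =
  A * (\sum_(u in X) f u) + B * (\sum_(u in X) h u) - #|X|%:R * C.
Proof. by rewrite big_split big_split /= -!mulr_sumr sumr_const mulr_natl mulNrn. Qed.

Lemma interior_sum_alg (A B g e c x1 x2 ni nb na b : rat) :
  x1 + x2 = 2 * ni -> g + e = A ->
  A * x1 - na * B + (g * x2 + e * (x2 + 2 * nb) - b * c) =
  2 * A * ni + 2 * e * nb - B * na - c * b.
Proof.
move=> h <-; have -> : x1 = 2 * ni - x2 by rewrite -h addrK.
ring.
Qed.

End Coefficients.

(** * Lower bounds for all face numbers of links *)

Section LowerBound.
Local Open Scope ring_scope.
Variables (R : realFieldType) (d : nat) (T : finType) (v : T -> 'rV[R]_d.+1).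
Variables (F : {set T}).
Implicit Types (S G H s W : {set T}) (u x : T).
Local Notation nf S s j := (#|faces (fs v S F) s j|%:R : rat).
Local Notation ni S s j := (#|ifaces (fs v S F) F s j|%:R : rat).
Local Notation nb S s j := (#|bfaces (fs v S F) F s j|%:R : rat).
Local Notation nl S s := (#|lk (fs v S F) s|%:R : rat).

Definition config S := rk v S = d.+1 /\ (forall G, facet v S G -> G <> F -> #|G| = d).

Lemma sphere_lbt S k s j : config S -> (#|s| + k.+3)%N = d -> ~~ (s \subset F) ->
  Dl (fs v S F) s -> (2 <= j <= k.+3)%N ->
  [/\ (sc k j).1 * nl S s - (sc k j).2 <= nf S s j,
      nf S s 2 = (sc k 2).1 * nl S s - (sc k 2).2 -> nf S s j = (sc k j).1 * nl S s - (sc k j).2 &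
      nf S s j = (sc k j).1 * nl S s - (sc k j).2 -> nf S s 2 = (sc k 2).1 * nl S s - (sc k 2).2].
Proof.
move=> [full simp]; have fsd := @fs_card _ _ _ _ _ _ simp.
elim: k s j => [|k IH] s j sq sF Ds /andP[j2 jk].
  have sF' : s \subset F -> facet v S F by rewrite (negbTE sF).
  have [P sw] := sweep0 full simp sF'.
  have [f1 f2 f3] := faces3 simp sw sq; have h0 := hn0_sphere fsd sw sq Ds.
  have h12 : hn _ P s 1 = hn _ P s 2 := hn_sym fsd sw sq sF (isT : (1 <= 3)%N).
  have h03 : hn _ P s 0 = hn _ P s 3 := hn_sym fsd sw sq sF (isT : (0 <= 3)%N).
  rewrite faces1 in f1.
  have e2 : nf S s 2 = (sc 0 2).1 * nl S s - (sc 0 2).2.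
    rewrite f2 f1 h0 -h12 !natrD !natrM /=; ring.
  have e3 : nf S s 3 = (sc 0 3).1 * nl S s - (sc 0 3).2.
    rewrite f3 f1 -h03 h0 -h12 !natrD !natrM /=; ring.
  have [->|->] : j = 2%N \/ j = 3%N by lia.
    by rewrite e2 lexx.
  by rewrite e2 e3 lexx.
have sF' : s \subset F -> facet v S F by rewrite (negbTE sF).
have lb2 : (sc k.+1 2).1 * nl S s - (sc k.+1 2).2 <= nf S s 2.
  rewrite sc2 -edge_bound_rat; exact: (edge_lb full simp sq isT sF' (fun _ => sF) Ds).
have [->|j2'] := eqVneq j 2%N; first by split.
set j' := j.-1; have jE : j = j'.+1 by rewrite prednK // (ltnW j2).
have j'2 : (2 <= j' <= k.+3)%N by move: j2 j2' jk; rewrite jE; lia.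
have [a0 _ _ _ _] := coef_inv k (proj1 (andP j'2)).
have E1 : j%:R * nf S s j = \sum_(u in lk (fs v S F) s) nf S (u |: s) j'.
  by rewrite -natr_sum link_faces_sumT -jE natrM.
have E2 : \sum_(u in lk (fs v S F) s) nl S (u |: s) = 2 * nf S s 2.
  rewrite -natr_sum -natrM -link_faces_sumT; congr _%:R.
  by apply: eq_bigr => u _; rewrite faces1.
have lkD u : u \in lk (fs v S F) s -> [/\ (#|u |: s| + k.+3)%N = d, ~~ (u |: s \subset F) &
    Dl (fs v S F) (u |: s)].
  move=> /lkP[us Du]; split => //; first by rewrite cardsU1 us -sq add1n addSnnS.
  by apply: contra sF; apply: subset_trans; apply: subsetUr.
set A := (sc k j').1 in a0 *; set B := (sc k j').2.
have E3 : \sum_(u in lk (fs v S F) s) (A * nl S (u |: s) - B) = 2 * A * nf S s 2 - B * nl S s.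
  rewrite sum_affine E2; ring.
have lbj : 2 * A * nf S s 2 - B * nl S s <= j%:R * nf S s j.
  rewrite E1 -E3; apply: ler_sum => u ul; have [h1 h2 h3] := lkD u ul.
  by have [] := IH (u |: s) j' h1 h2 h3 j'2.
have jp : 0 < j%:R :> rat by rewrite jE ltr0n.
have scE : sc k.+1 j = ((2 * k.+4%:R * A - B) / j%:R, A * k.+4%:R * (k.+4%:R + 1) / j%:R).
  by rewrite /= (negbTE j2') -/j' (surjective_pairing (sc k j')).
have target (y : rat) : y = (sc k.+1 j).1 * nl S s - (sc k.+1 j).2 <->
    j%:R * y = (2 * k.+4%:R * A - B) * nl S s - A * k.+4%:R * (k.+4%:R + 1).
  rewrite scE /=; split => [->|h]; first by field; rewrite gt_eqF.
  by apply: (mulfI (lt0r_neq0 jp)); rewrite h; field; rewrite gt_eqF.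
rewrite sc2 /= in lb2.
split.
- rewrite scE /= -(ler_pM2l jp); apply: le_trans lbj.
  have -> : j%:R * ((2 * k.+4%:R * A - B) / j%:R * nl S s - A * k.+4%:R * (k.+4%:R + 1) / j%:R) =
    (2 * k.+4%:R * A - B) * nl S s - A * k.+4%:R * (k.+4%:R + 1) by field; rewrite gt_eqF.
  by move: (ler_wpM2l (ltW a0) lb2); lra.
- rewrite sc2 /= => eq; apply/target; rewrite E1.
  rewrite (eq_bigr (fun u => A * nl S (u |: s) - B)) => [|u ul].
    by rewrite E3 eq; field.
  have [h1 h2 h3] := lkD u ul; have [_ h _] := IH (u |: s) j' h1 h2 h3 j'2; apply: h.
  rewrite sc2; apply/edge_eq_rat.
  move/edge_eq_rat: eq => eq; exact: (edge_eq_link full simp sq isT sF' eq ul h2).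
- move/target => h; rewrite sc2 /=.
  have le : A * nf S s 2 <= A * (k.+4%:R * nl S s - k.+4%:R * (k.+4%:R + 1) / 2).
    move: lbj; rewrite h; lra.
  by apply/eqP; rewrite eq_le lb2 andbT -(ler_pM2l a0).
Qed.

Section Interior.
Variable S : {set T}.
Hypothesis cS : config S.
Hypothesis fF : facet v S F.
Local Notation lk := (lk (fs v S F)).
Local Notation Dl0 := Dl.
Local Notation Dl := (Dl (fs v S F)).
Local Notation na s := (#|lk s :\: F|%:R : rat).
Local Notation nm s := (#|lk s|%:R : rat).
Local Notation nin s := (#|lk s :&: F|%:R : rat).

Let full : rk v S = d.+1 := proj1 cS.
Let simp : forall G, facet v S G -> G <> F -> #|G| = d := proj2 cS.
Let fsd := @fs_card _ _ _ _ _ _ simp.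

Lemma config_pyramid x : x \in S -> x \notin F -> config (x |: F).
Proof.
move=> xS xF; split; first exact: (pyramid_full full fF xS xF).
by move=> G fG GF; exact: (pyramid_simp full simp fF xS xF fG GF).
Qed.

Lemma boundary_lbt k s j : (#|s| + k.+4)%N = d -> s \subset F -> Dl s -> (2 <= j <= k.+3)%N ->
  [/\ (sc k j).1 * nin s - (sc k j).2 <= nb S s j,
      nb S s 2 = (sc k 2).1 * nin s - (sc k 2).2 -> nb S s j = (sc k j).1 * nin s - (sc k j).2 &
      nb S s j = (sc k j).1 * nin s - (sc k j).2 -> nb S s 2 = (sc k 2).1 * nin s - (sc k 2).2].
Proof.
move=> sq sF Ds jk; have [x xS xF] := facet_out fF.
have xs : x \notin s by apply: contra xF; apply: (subsetP sF).
have h1 : (#|x |: s| + k.+3)%N = d by rewrite cardsU1 xs -sq add1n addSnnS.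
have h2 : ~~ (x |: s \subset F) by rewrite subUset sub1set (negbTE xF).
have h3 : Dl0 (fs v (x |: F) F) (x |: s) by rewrite (pyramid_Dl full simp fF xS xF).
have := sphere_lbt (config_pyramid xS xF) h1 h2 h3 jk.
by rewrite !(pyramid_faces full simp fF xS xF _ sF) (pyramid_lk full simp fF xS xF sF).
Qed.

Lemma boundary_eq_link k s u : (#|s| + k.+4.+1)%N = d -> s \subset F ->
  nb S s 2 = (sc k.+1 2).1 * nin s - (sc k.+1 2).2 -> u \in lk s :&: F ->
  nb S (u |: s) 2 = (sc k 2).1 * nin (u |: s) - (sc k 2).2.
Proof.
move=> sq sF eq ul; have [x xS xF] := facet_out fF; have [_ uF] := setIP ul.
have xs : x \notin s by apply: contra xF; apply: (subsetP sF).
have h1 : (#|x |: s| + k.+4)%N = d by rewrite cardsU1 xs -sq add1n addSnnS.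
have nF t : ~~ (x |: t \subset F) by rewrite subUset sub1set (negbTE xF).
have [full' simp'] := config_pyramid xS xF.
have usF : u |: s \subset F by rewrite subUset sub1set uF.
move: eq ul; rewrite -(pyramid_faces full simp fF xS xF _ sF) -(pyramid_lk full simp fF xS xF sF).
rewrite -(pyramid_faces full simp fF xS xF _ usF) -(pyramid_lk full simp fF xS xF usF).
rewrite !sc2 => /edge_eq_rat eq ul; apply/edge_eq_rat; rewrite setUCA in ul *.
have h := edge_eq_link full' simp' h1 isT (fun h => False_ind _ (negP (nF s) h)) eq ul _.
by apply: h; rewrite setUCA nF.
Qed.

(** At [k = 0] the link is a disk, where Euler's relation already gives equality, hence the form of
    the conditions on [k']. For [j >= 3] the bound also uses the edges inside [F], so equality
    constrains them too; at [j = 2] it does not. *)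
Lemma interior_lbt k s j : (#|s| + k.+3)%N = d -> s \subset F -> Dl s -> (2 <= j <= k.+3)%N ->
  [/\ (ic k j).1.1 * na s + (ic k j).1.2 * nm s - (ic k j).2 <= ni S s j,
      (forall k', k = k'.+1 ->
        ni S s 2 = (ic k 2).1.1 * na s + (ic k 2).1.2 * nm s - (ic k 2).2 /\
        nb S s 2 = (sc k' 2).1 * nin s - (sc k' 2).2) ->
      ni S s j = (ic k j).1.1 * na s + (ic k j).1.2 * nm s - (ic k j).2 &
      forall k', k = k'.+1 ->
      ni S s j = (ic k j).1.1 * na s + (ic k j).1.2 * nm s - (ic k j).2 ->
      ni S s 2 = (ic k 2).1.1 * na s + (ic k 2).1.2 * nm s - (ic k 2).2 /\
      ((3 <= j)%N -> nb S s 2 = (sc k' 2).1 * nin s - (sc k' 2).2)].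
Proof.
elim: k s j => [|k IH] s j sq sF Ds /andP[j2 jk].
  have [P sw] := sweep0 full simp (fun _ : s \subset F => fF).
  have [f1 f2 f3] := faces3 simp sw sq; have [g1 g2 g3] := ifaces3 simp sw sq.
  have h0 := hn0_sphere fsd sw sq Ds.
  have h3 : hn (fs v S F) P s 3 = 0%N.
    have := ifaces_hn fsd sw sq (leq0n 3); rewrite (sum4z (fun i => hn (fs v S F) P s (3 - i)%N)).
    move=> <-; apply/eqP; rewrite cards_eq0; apply/eqP/setP => t; rewrite in_set0.
    apply/negP => /setIdP[/facesP[_ st ct] /negP]; apply.
    suff -> : t = s by [].
    by apply/esym/eqP; rewrite eqEcard st ct addn0 leqnn.
  rewrite faces1 in f1; rewrite ifaces1 // in g1.
  have e2 : ni S s 2 = (ic 0 2).1.1 * na s + (ic 0 2).1.2 * nm s - (ic 0 2).2.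
    rewrite g2 f1 g1 h0 h3 !natrD !natrM /=; ring.
  have e3 : ni S s 3 = (ic 0 3).1.1 * na s + (ic 0 3).1.2 * nm s - (ic 0 3).2.
    rewrite g3 f1 g1 h0 h3 !natrD !natrM /=; ring.
  have [->|->] : j = 2%N \/ j = 3%N by lia.
    by rewrite e2 lexx.
  by rewrite e3 lexx.
have lb2 : (ic k.+1 2).1.1 * na s + (ic k.+1 2).1.2 * nm s - (ic k.+1 2).2 <= ni S s 2.
  rewrite ic2 /= mul1r -iedge_bound_rat //.
  exact: (iedge_lb full simp sq isT fF sF Ds).
have [j2E|j2'] := eqVneq j 2%N.
  rewrite j2E; split => [//|h|k' _ eq]; last by split.
  by case: (h k erefl).
set j' := j.-1; have jE : j = j'.+1 by rewrite prednK // (ltnW j2).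
have j3 : (2 < j)%N by rewrite ltn_neqAle eq_sym j2'.
have j'2 : (2 <= j' <= k.+3)%N by move: j3 jk; rewrite jE !ltnS => -> ->.
have [a0 _ gda d0 _] := coef_inv k (proj1 (andP j'2)).
have [lbb _ _] := boundary_lbt sq sF Ds (isT : (2 <= 2 <= k.+3)%N).
have sp (f : T -> rat) : \sum_(u in lk s) f u =
    \sum_(u in lk s :\: F) f u + \sum_(u in lk s :&: F) f u.
  by rewrite (big_setID F) /= addrC.
have E1 : j%:R * ni S s j = \sum_(u in lk s :\: F) nf S (u |: s) j' +
    \sum_(u in lk s :&: F) ni S (u |: s) j'.
  rewrite -natrM jE -ifaces_link_sum natr_sum sp; congr (_ + _); apply: eq_bigr => u.
  by move=> /setDP[_ uF]; rewrite ifaces_out // subUset sub1set (negbTE uF).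
have [/(congr1 (fun n => n%:R : rat)) L1 /(congr1 (fun n => n%:R : rat)) L2] := link_sums (fs v S F) sF.
rewrite natrD natrM !natr_sum in L1; rewrite natrD natrM !natr_sum in L2.
have usq u : u \in lk s -> (#|u |: s| + k.+3)%N = d.
  by move=> /lkP[us _]; rewrite cardsU1 us -sq add1n addSnnS.
have uout u : u \in lk s :\: F -> [/\ (#|u |: s| + k.+3)%N = d, ~~ (u |: s \subset F) & Dl (u |: s)].
  by move=> /setDP[ul uF]; split; [exact: usq|rewrite subUset sub1set (negbTE uF)|case/lkP: ul].
have uin u : u \in lk s :&: F -> [/\ (#|u |: s| + k.+3)%N = d, u |: s \subset F & Dl (u |: s)].
  by move=> /setIP[ul uF]; split; [exact: usq|rewrite subUset sub1set uF|case/lkP: ul].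
set A := (sc k j').1 in a0 gda *; set B := (sc k j').2.
set g := (ic k j').1.1 in gda *; set e := (ic k j').1.2 in gda d0 *; set c := (ic k j').2.
have E3 : \sum_(u in lk s :\: F) (A * nm (u |: s) - B) +
    \sum_(u in lk s :&: F) (g * na (u |: s) + e * nm (u |: s) - c) =
    2 * A * ni S s 2 + 2 * e * nb S s 2 - B * na s - c * nin s.
  rewrite (sum_affine (lk s :\: F)) (sum_affine2 (lk s :&: F)) L2.
  exact: interior_sum_alg L1 gda.
have mE : nm s = na s + nin s by rewrite -natrD -(cardsID F) addnC.
have lbj : 2 * A * ni S s 2 + 2 * e * nb S s 2 - B * na s - c * nin s <= j%:R * ni S s j.
  rewrite E1 -E3; apply: lerD; apply: ler_sum => u ul.
    have [h1 h2 h3] := uout u ul; by have [] := sphere_lbt cS h1 h2 h3 j'2.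
  by have [h1 h2 h3] := uin u ul; have [] := IH _ _ h1 h2 h3 j'2.
have jp : 0 < j%:R :> rat by rewrite jE ltr0n.
pose q : rat := k.+4%:R.
have icE : ic k.+1 j = ((2 * A * (q - 1) - 2 * e * (q - 1) - B + c) / j%:R,
   (2 * A + 2 * e * (q - 1) - c) / j%:R, (2 * A * q + e * q * (q - 1)) / j%:R).
  by rewrite /= (negbTE j2') -/j' (surjective_pairing (sc k j')) (surjective_pairing (ic k j'))
    (surjective_pairing (ic k j').1).
have qE : k.+3%:R = q - 1 :> rat by rewrite /q -[k.+4%:R]natr1 addrK.
have target : j%:R * ((ic k.+1 j).1.1 * na s + (ic k.+1 j).1.2 * nm s - (ic k.+1 j).2) =
   2 * A * ((q - 1) * na s + nm s - q) + 2 * e * ((q - 1) * nin s - (q - 1) * q / 2) - B * na s - c * nin s.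
  by rewrite icE /= mE; field; rewrite gt_eqF.
rewrite ic2 /= mul1r -/q in lb2; rewrite sc2 /= qE subrK in lbb.
split.
- rewrite -(ler_pM2l jp) target //; apply: le_trans lbj.
  have := ler_wpM2l (ltW a0) lb2; have := ler_wpM2l (ltW d0) lbb; lra.
- move=> /(_ k erefl) [eq2 eqb]; rewrite ic2 /= mul1r -/q in eq2; rewrite sc2 /= qE subrK in eqb.
  apply: (mulfI (lt0r_neq0 jp)); rewrite target // -eq2 -eqb -E3 E1.
  (* The minima for interior edges and for edges inside [F] add up to the minimum of [edge_lb], so
     [edge_eq_link] applies at the vertices outside [F]. *)
  have eqt : nf S s 2 = (sc k.+1 2).1 * nm s - (sc k.+1 2).2.
    rewrite (faces_split _ F) natrD eq2 eqb sc2 /= -/q mE; lra.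
  congr (_ + _); apply: eq_bigr => u ul.
    have [h1 h2 h3] := uout u ul; have [_ h _] := sphere_lbt cS h1 h2 h3 j'2; apply: h.
    rewrite sc2 /= in eqt; rewrite sc2; apply/edge_eq_rat; move/edge_eq_rat: eqt => eqt.
    have ul' : u \in lk s by case/setDP: ul.
    exact: (edge_eq_link full simp sq isT (fun _ => fF) eqt ul' h2).
  have [h1 h2 h3] := uin u ul; have [_ h _] := IH _ _ h1 h2 h3 j'2; apply: h => k' kE.
  subst k; split; last first.
    by apply: boundary_eq_link => //; rewrite sc2 /= qE subrK.
  rewrite ic2 /= mul1r; apply/iedge_eq_rat => //.
  have [ul' uF] := setIP ul.
  have eqn : (#|ifaces (fs v S F) F s 2| + k'.+4.+1 = k'.+4.+1.-1 * #|lk s :\: F| + #|lk s|)%N.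
    by apply/iedge_eq_rat.
  exact: (iedge_eq_link full simp sq isT fF sF eqn ul' uF).
- move=> k' [<-] eq.
  have le : 2 * A * ni S s 2 + 2 * e * nb S s 2 <=
    2 * A * ((q - 1) * na s + nm s - q) + 2 * e * ((q - 1) * nin s - (q - 1) * q / 2).
    by move: lbj; rewrite eq target //; lra.
  have l1 := ler_wpM2l (ltW a0) lb2; have l2 := ler_wpM2l (ltW d0) lbb.
  split => [|_].
    rewrite ic2 /= mul1r -/q.
    by apply/eqP; rewrite eq_le lb2 andbT -(ler_pM2l a0); lra.
  by rewrite sc2 /= qE subrK; apply/eqP; rewrite eq_le lbb andbT -(ler_pM2l d0); lra.
Qed.

End Interior.
End LowerBound.

Definition asp_config (R : realFieldType) (d s : nat) (T : finType) (v : T -> 'rV[R]_d.+1)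
    (F : {set T}) :=
  [/\ config v F setT, facet v setT F, #|F| = d + s & forall t, Dl (fs v setT F) [set t]].

Section AspConfig.
Variables (R : realFieldType) (d s : nat) (T : finType) (v : T -> 'rV[R]_d.+1) (F : {set T}).
Hypothesis cfg : asp_config s v F.
Local Notation fs := (fs v setT F).

Let full : rk v setT = d.+1. Proof. by case: cfg => -[]. Qed.
Let simp : forall G, facet v setT G -> G <> F -> #|G| = d. Proof. by case: cfg => -[]. Qed.
Let fF : facet v setT F. Proof. by case: cfg. Qed.

Lemma asp_lk0 : lk fs set0 = setT.
Proof.
by case: cfg => _ _ _ h; apply/setP => t; rewrite !inE setU0; exact: h.
Qed.

Lemma asp_faces1 : #|faces fs set0 1| = #|T|.
Proof. by rewrite faces1 asp_lk0 cardsT. Qed.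

Lemma asp_Dl0 : Dl fs set0.
Proof.
have [x xS xF] := facet_out fF; case: cfg => _ _ _ /(_ x).
by apply: Dl_sub; apply: sub0set.
Qed.

Lemma asp_bfaces_top : #|bfaces fs F set0 d| = 0.
Proof.
apply/eqP; rewrite cards_eq0; apply/eqP/setP => t; rewrite in_set0; apply/negP.
move=> /setIdP[/facesP[/DlP[G Gf tG] _]]; rewrite cards0 add0n => ct tF.
have [fG GF] := fsP _ _ _ _ Gf; apply: GF; apply: (facet_inj fG fF).
have -> : G = t; last exact: tF.
by apply/esym/eqP; rewrite eqEcard tG ct (fs_card simp Gf) leqnn.
Qed.

Lemma asp_cards : #|lk fs set0 :\: F| = #|T| - (d + s) /\ #|lk fs set0 :&: F| = d + s.
Proof.
case: cfg => _ _ cF _; rewrite asp_lk0 setTI setTD; split => //.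
by rewrite -cF -(cardsC F) addKn.
Qed.

(** Here Delta is a disk with [#|T| - (d + s)] interior vertices, so its face numbers are
    determined. *)
Lemma asp3_faces : d = 3 ->
  #|faces fs set0 2| + 3 = 2 * #|T| + (#|T| - (d + s)) /\
  #|faces fs set0 3| + 2 = #|T| + (#|T| - (d + s)).
Proof.
move=> d3; have [P sw] := sweep0 full simp (fun _ : set0 \subset F => fF).
have fsd := @fs_card _ _ _ _ _ _ simp.
have sq : #|@set0 T| + 3 = d by rewrite cards0 d3.
have [f1 f2 f3] := faces3 simp sw sq; have [g1 _ _] := ifaces3 simp sw sq.
have h0 := hn0_sphere fsd sw sq asp_Dl0.
have h3 : hn fs P set0 3 = 0.
  by rewrite -[X in hn _ _ _ X]d3; exact: (hn_last simp sw).
move: f1 f2 f3 g1; rewrite asp_faces1 (ifaces1 _ (sub0set F)) (proj1 asp_cards) h0 h3.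
by clear; lia.
Qed.

End AspConfig.

Section LowerBoundCore.
Local Open Scope ring_scope.
Variables (k n s : nat).
Local Notation d := k.+4.

Definition imin j := (ic k.+1 j).1.1 * (n - (d + s))%N%:R + (ic k.+1 j).1.2 * n%:R - (ic k.+1 j).2.
Definition bmin j := (sc k j).1 * (d + s)%N%:R - (sc k j).2.

Section OneConfig.
Variables (R : realFieldType) (T : finType) (v : T -> 'rV[R]_d.+1) (F : {set T}).
Hypothesis cX : asp_config s v F.
Hypothesis Tn : #|T| = n.
Local Notation fsX := (fs v setT F).

Let sq : (#|@set0 T| + d)%N = d. Proof. by rewrite cards0. Qed.

Lemma asp_ilb j : (2 <= j <= d)%N ->
  [/\ imin j <= #|ifaces fsX F set0 j|%:R,
      #|ifaces fsX F set0 2|%:R = imin 2 -> #|bfaces fsX F set0 2|%:R = bmin 2 ->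
        #|ifaces fsX F set0 j|%:R = imin j &
      #|ifaces fsX F set0 j|%:R = imin j -> #|ifaces fsX F set0 2|%:R = imin 2 /\
        ((3 <= j)%N -> #|bfaces fsX F set0 2|%:R = bmin 2)].
Proof.
move=> jd; have [cS fF cF _] := cX.
have := interior_lbt cS fF sq (sub0set F) (asp_Dl0 cX) jd.
rewrite (proj1 (asp_cards cX)) (proj2 (asp_cards cX)) (asp_lk0 cX) cardsT Tn => -[h1 h2 h3].
split => //; last exact: (h3 k erefl).
by move=> e1 e2; apply: h2 => k' [<-].
Qed.

Lemma asp_blb j : (2 <= j <= d.-1)%N ->
  [/\ bmin j <= #|bfaces fsX F set0 j|%:R,
      #|bfaces fsX F set0 2|%:R = bmin 2 -> #|bfaces fsX F set0 j|%:R = bmin j &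
      #|bfaces fsX F set0 j|%:R = bmin j -> #|bfaces fsX F set0 2|%:R = bmin 2].
Proof.
move=> jd; have [cS fF cF _] := cX.
have := boundary_lbt cS fF sq (sub0set F) (asp_Dl0 cX) jd.
by rewrite (proj2 (asp_cards cX)).
Qed.

Lemma asp_all_min : #|ifaces fsX F set0 2|%:R = imin 2 -> #|bfaces fsX F set0 2|%:R = bmin 2 ->
  (forall j, (2 <= j <= d)%N -> #|ifaces fsX F set0 j|%:R = imin j) /\
  (forall j, (2 <= j <= d.-1)%N -> #|bfaces fsX F set0 j|%:R = bmin j).
Proof.
move=> e1 e2; split => j jd; first by have [_ h _] := asp_ilb jd; exact: h.
by have [_ h _] := asp_blb jd; exact: h.
Qed.

(** Upper bounds on the two edge numbers suffice for the minimizer, since the general lower bounds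
    turn them into equalities. *)
Lemma asp_edge_min :
  (#|ifaces fsX F set0 2| + d <= d.-1 * (n - (d + s)) + n)%N ->
  (2 * #|bfaces fsX F set0 2| + d.-1 * d <= 2 * d.-1 * (d + s))%N ->
  #|ifaces fsX F set0 2|%:R = imin 2 /\ #|bfaces fsX F set0 2|%:R = bmin 2.
Proof.
move=> h1 h2; have [i1 _ _] := asp_ilb (isT : (2 <= 2 <= d)%N).
have [b1 _ _] := asp_blb (isT : (2 <= 2 <= d.-1)%N).
move: i1 b1; rewrite /imin /bmin ic2 sc2 /= mul1r => i1 b1; split.
  apply/iedge_eq_rat => //; apply/eqP; rewrite eqn_leq h1.
  by have := iedge_bound_rat; move=> ->.
apply/edge_eq_rat; apply/eqP; rewrite eqn_leq h2.
by have := edge_bound_rat; move=> ->.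
Qed.

End OneConfig.

Variables (R R' : realFieldType) (T T' : finType).
Variables (v : T -> 'rV[R]_d.+1) (v' : T' -> 'rV[R']_d.+1) (F : {set T}) (F' : {set T'}).
Hypothesis cX : asp_config s v F.
Hypothesis cY : asp_config s v' F'.
Hypothesis Tn : #|T| = n.
Hypothesis Tn' : #|T'| = n.
Local Notation fsX := (fs v setT F).
Local Notation fsY := (fs v' setT F').
Hypothesis minY : (#|ifaces fsY F' set0 2| + d <= d.-1 * (n - (d + s)) + n)%N.
Hypothesis minBY : (2 * #|bfaces fsY F' set0 2| + d.-1 * d <= 2 * d.-1 * (d + s))%N.

Lemma asp_lower_bound_aux :
  (forall j, (2 <= j <= d)%N -> (#|faces fsY set0 j| <= #|faces fsX set0 j|)%N) /\
  ((exists2 j, (2 <= j <= d)%N & #|faces fsX set0 j| = #|faces fsY set0 j|) ->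
   forall j, (2 <= j <= d)%N -> #|faces fsX set0 j| = #|faces fsY set0 j|).
Proof.
have [e1 e2] := asp_edge_min cY Tn' minY minBY.
have [iY bY] := asp_all_min cY Tn' e1 e2.
have split_j j : (2 <= j <= d)%N -> j = d \/ (2 <= j <= d.-1)%N.
  by move=> /andP[j2]; rewrite leq_eqVlt => /orP[/eqP|jd]; [left|right; rewrite j2].
have top : #|bfaces fsX F set0 d| = 0%N /\ #|bfaces fsY F' set0 d| = 0%N.
  by rewrite (asp_bfaces_top cX) (asp_bfaces_top cY).
split => [j jd|[j0 jd0 eq0]].
  rewrite -(ler_nat rat) (faces_split _ F) (faces_split _ F') !natrD.
  have [l1 _ _] := asp_ilb cX Tn jd; rewrite -(iY j jd) in l1; apply: lerD => //.
  have [->|jd'] := split_j j jd; first by rewrite (proj1 top) (proj2 top).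
  by have [l2 _ _] := asp_blb cX jd'; rewrite (bY j jd').
have [x1 x2] : #|ifaces fsX F set0 2|%:R = imin 2 /\ #|bfaces fsX F set0 2|%:R = bmin 2.
  have [l1 _ l3] := asp_ilb cX Tn jd0.
  move/(congr1 (fun m => m%:R : rat)): eq0; rewrite (faces_split _ F) (faces_split _ F') !natrD.
  (* In the top dimension no face lies inside [F], and minimality of the edges inside [F] comes from
     the interior estimate at [j = d >= 3]. Below it, equality of the sums makes both parts
     tight. *)
  rewrite (iY j0 jd0); have [E|jd'] := split_j j0 jd0.
    subst j0; rewrite (proj1 top) (proj2 top) !addr0 => /l3[h1 h2].
    by split => //; apply: h2.
  have [b1 _ b3] := asp_blb cX jd'; rewrite (bY j0 jd') => eq0.
  have ei : #|ifaces fsX F set0 j0|%:R = imin j0.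
    by apply/eqP; rewrite eq_le l1 andbT; move: b1 eq0; lra.
  have eb : #|bfaces fsX F set0 j0|%:R = bmin j0 by move: eq0; rewrite ei => /addrI.
  by split; [case: (l3 ei)|exact: b3].
have [iX bX] := asp_all_min cX Tn x1 x2.
move=> j jd; apply/eqP; rewrite -(eqr_nat rat) (faces_split _ F) (faces_split _ F') !natrD.
rewrite iX // iY //; apply/eqP; congr (_ + _).
have [->|jd'] := split_j j jd; first by rewrite (proj1 top) (proj2 top).
by rewrite bX // bY.
Qed.

End LowerBoundCore.

Lemma asp_lower_bound (R R' : realFieldType) (d s : nat) (T T' : finType)
  (v : T -> 'rV[R]_d.+1) (v' : T' -> 'rV[R']_d.+1) (F : {set T}) (F' : {set T'}) :
  3 <= d -> asp_config s v F -> asp_config s v' F' -> #|T| = #|T'| ->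
  (4 <= d -> #|ifaces (fs v' setT F') F' set0 2| + d <= d.-1 * (#|T'| - (d + s)) + #|T'|) ->
  (4 <= d -> 2 * #|bfaces (fs v' setT F') F' set0 2| + d.-1 * d <= 2 * d.-1 * (d + s)) ->
  (forall j, 1 <= j <= d ->
     #|faces (fs v' setT F') set0 j| <= #|faces (fs v setT F) set0 j|) /\
  (4 <= d ->
   (exists2 j, 2 <= j <= d & #|faces (fs v setT F) set0 j| = #|faces (fs v' setT F') set0 j|) ->
   forall j, 1 <= j <= d -> #|faces (fs v setT F) set0 j| = #|faces (fs v' setT F') set0 j|).
Proof.
case: d v v' => [|[|[|[|k]]]] v v' // _ cX cY TT mI mB.
  split => // j /andP[]; rewrite leq_eqVlt => /orP[/eqP<- _|j2 j3].
    by rewrite (asp_faces1 cX) (asp_faces1 cY) TT.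
  have [] := asp3_faces cX erefl; have [] := asp3_faces cY erefl; rewrite TT.
  have [->|->] : j = 2 \/ j = 3 by move: j2 j3; clear; lia.
    by move=> <- _ /addIn <- _.
  by move=> _ <- _ /addIn <-.
have [h1 h2] := asp_lower_bound_aux cX cY TT erefl (mI isT) (mB isT).
split => [j /andP[]|_ ex j /andP[]]; rewrite leq_eqVlt => /orP[/eqP<- _|j2 jd].
- by rewrite (asp_faces1 cX) (asp_faces1 cY) TT.
- by apply: h1; rewrite j2.
- by rewrite (asp_faces1 cX) (asp_faces1 cY) TT.
- by apply: h2 => //; rewrite j2.
Qed.

(** * Polytopes as vertex configurations *)

Lemma card_fset_set_image (T : finType) (U : choiceType) (X : {set T}) (f : T -> U)
    (D : set U) : {in X &, injective f} ->
  (forall y, D y <-> exists2 x, x \in X & y = f x) -> #|` fset_set D |%fset = #|X|.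
Proof.
move=> inj DE; have -> : D = [set` [seq f x | x <- enum X]]%classic.
  apply/seteqP; split => y /=.
    by move/DE => [x xX ->]; apply: map_f; rewrite mem_enum.
  by move=> /mapP[x]; rewrite mem_enum => xX ->; apply/DE; exists x.
have -> : fset_set [set` [seq f x | x <- enum X]]%classic = [fset y in [seq f x | x <- enum X]]%fset.
  apply/fsetP => y; rewrite in_fset_set; last exact: finite_seq.
  by rewrite mem_setE in_fset.
rewrite card_fseq undup_id ?size_map -?cardE //.
rewrite map_inj_in_uniq ?enum_uniq // => x y; rewrite !mem_enum; exact: inj.
Qed.

Section Independence.
Local Open Scope ring_scope.
Variables (R : realFieldType) (N : nat) (T : finType) (v : T -> 'rV[R]_N).
Implicit Types (A B : {set T}).

Lemma mem_spanmP A (x : 'rV_N) :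
  (x <= spanm v A)%MS <-> exists c : T -> R, x = \sum_(t in A) c t *: v t.
Proof.
split=> [/sub_sumsmxP[c ->]|[c ->]]; last first.
  by apply: summx_sub => t tA; apply: scalemx_sub; exact: mem_spanm.
have : forall t, exists a : R, c t *m <<v t>>%MS = a *: v t.
  move=> t; have /sub_rVP[a h] : (c t *m <<v t>>%MS <= v t)%MS.
    by apply: submx_trans (submxMl _ _) _; rewrite genmxE.
  by exists a.
by move/choice => [a aP]; exists a; apply: eq_bigr => t _; exact: aP.
Qed.

Lemma indep_rk B : (forall c : T -> R, \sum_(t in B) c t *: v t = 0 -> forall t, t \in B -> c t = 0) ->
  rk v B = #|B|.
Proof.
have [n] := ubnP #|B|; elim: n B => // n IH B Bn h.
have [->|[t tB]] := set_0Vmem B; first by rewrite rk0 cards0.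
have tn : ~~ (v t <= spanm v (B :\ t))%MS.
  apply/negP => /mem_spanmP[c ct].
  have := h (fun s => if s == t then -1 else c s).
  rewrite (big_setD1 t) //= eqxx scaleN1r (eq_bigr (fun s => c s *: v s)) => [|s].
    rewrite -ct addNr => /(_ erefl t tB); rewrite eqxx => /eqP.
    by rewrite oppr_eq0 oner_eq0.
  by rewrite !inE => /andP[/negbTE->].
have [l l0 lt] := sepfun tn.
rewrite -(setD1K tB) (rk_add l0 lt) IH ?(cardsU1 t) ?setD11 //.
  by move: Bn; rewrite (cardsD1 t) tB.
move=> c c0 s sB; have := h (fun s => if s == t then 0 else c s).
rewrite (big_setD1 t) //= eqxx scale0r add0r (eq_bigr (fun s => c s *: v s)) => [|r].
  move=> /(_ c0 s); case/setD1P: sB => /negbTE -> sB; exact.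
by rewrite !inE => /andP[/negbTE->].
Qed.

Lemma eq_span_rk (T' : finType) (v' : T' -> 'rV[R]_N) A (A' : {set T'}) :
  (forall t, t \in A -> (v t <= spanm v' A')%MS) ->
  (forall t, t \in A' -> (v' t <= spanm v A)%MS) -> rk v A = rk v' A'.
Proof.
move=> h1 h2; apply/eqP; rewrite eqn_leq; apply/andP; split; apply: mxrankS;
  by apply/sumsmx_subP => t tA; rewrite genmxE; auto.
Qed.

Definition faceset (S A : {set T}) := exists2 l, valid v S l & zs v S l = A.

End Independence.

(** * Homogeneous coordinates and faces as vertex sets *)

Section Hom.
Local Open Scope ring_scope.
Variables (R : realType) (m : nat).
Implicit Types (x y c : 'rV[R]_m).

Definition hom x : 'rV[R]_(1 + m) := row_mx 1 x.
Definition hom0 x : 'rV[R]_(1 + m) := row_mx 0 x.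
(* The affine functional [dot c x - b] in homogeneous coordinates. *)
Definition cof c (b : R) : 'cV[R]_(1 + m) := col_mx (- b)%:M c^T.

Lemma pr_cof x c b : pr (hom x) (cof c b) = dot c x - b.
Proof.
rewrite /pr /hom /cof mul_row_col mul1mx !mxE addrC eqxx mulr1n; congr (_ + _).
by apply: eq_bigr => i _; rewrite !mxE mulrC.
Qed.

Lemma cofP (l : 'cV[R]_(1 + m)) : exists c b, l = cof c b.
Proof.
exists (dsubmx l)^T, (- (usubmx l) 0 0); rewrite /cof opprK trmxK -[LHS]vsubmxK.
by congr col_mx; apply/matrixP => i j; rewrite !ord1 [RHS]mxE eqxx mulr1n.
Qed.

Lemma homB x y : hom x - hom y = hom0 (x - y).
Proof. by rewrite /hom /hom0 opp_row_mx add_row_mx subrr. Qed.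

Lemma hom0Z a x : hom0 (a *: x) = a *: hom0 x.
Proof. by rewrite /hom0 scale_row_mx scaler0. Qed.

Lemma hom0D x y : hom0 (x + y) = hom0 x + hom0 y.
Proof. by rewrite /hom0 add_row_mx addr0. Qed.

Lemma hom0_0 : hom0 0 = 0. Proof. exact: row_mx0. Qed.

Lemma hom0_sum (I : Type) (r : seq I) (P : pred I) (f : I -> 'rV_m) :
  hom0 (\sum_(i <- r | P i) f i) = \sum_(i <- r | P i) hom0 (f i).
Proof. exact: (big_morph hom0 hom0D hom0_0). Qed.

Lemma hom_comb (I : Type) (r : seq I) (P : pred I) (a : I -> R) (f : I -> 'rV_m) :
  \sum_(i <- r | P i) a i *: hom (f i) =
  row_mx (\sum_(i <- r | P i) a i)%:M (\sum_(i <- r | P i) a i *: f i).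
Proof.
apply: (big_rec3 (fun (x : 'rV_(1 + m)) (y : R) (z : 'rV_m) => x = row_mx y%:M z)).
  have -> : (0 : R)%:M = 0 :> 'M_1 by apply/matrixP => i j; rewrite !mxE mul0rn.
  by rewrite row_mx0.
move=> i x y z _ ->; rewrite /hom scale_row_mx add_row_mx; congr row_mx.
by apply/matrixP => j k; rewrite !mxE !ord1 eqxx mulr1.
Qed.

Lemma hom_combE (I : Type) (r : seq I) (P : pred I) (a : I -> R) (f : I -> 'rV_m) x :
  hom x = \sum_(i <- r | P i) a i *: hom (f i) <->
  \sum_(i <- r | P i) a i = 1 /\ x = \sum_(i <- r | P i) a i *: f i.
Proof.
rewrite hom_comb /hom; split=> [/eq_row_mx[/matrixP/(_ 0 0) h xE]|[-> ->] //].
by split => //; move: h; rewrite !mxE eqxx !mulr1n => <-.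
Qed.

End Hom.

Section Hull.
Local Open Scope ring_scope.
Variables (R : realType) (m : nat) (T : finType) (p : T -> 'rV[R]_m).
Implicit Types (S A B G : {set T}) (x y : 'rV[R]_m).

Definition hv (t : T) : 'rV[R]_(1 + m) := hom (p t).
Definition pts A : set 'rV[R]_m := fun x => exists2 t, t \in A & x = p t.
Definition hull A : set 'rV[R]_m := convex_hull (pts A).
Local Notation ev := (ev hv).
Local Notation rk := (rk hv).

Lemma hullP A x : hull A x <-> exists2 a : T -> R, (forall t, 0 <= a t) &
  hom x = \sum_(t in A) a t *: hv t.
Proof.
split=> [[k [q [a [qA a0 a1 xE]]]]|[a a0 /hom_combE[a1 xE]]].
  have : forall i, exists t, t \in A /\ q i = p t by move=> i; have [t tA qt] := qA i; exists t.
  move/choice => [f fP]; exists (fun t => \sum_(i | f i == t) a i).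
    by move=> t; apply: sumr_ge0 => i _; exact: a0.
  have -> : hom x = \sum_i a i *: hom (q i) by apply/hom_combE.
  rewrite (partition_big f (mem A)) => [|i _]; last by case: (fP i).
  apply: eq_bigr => t tA; rewrite scaler_suml; apply: eq_bigr => i /eqP fi.
  by rewrite /hv -fi; have [_ ->] := fP i.
exists #|A|, (fun i => p (enum_val i)), (fun i => a (enum_val i)); split.
- by move=> i; exists (enum_val i) => //; apply: enum_valP.
- by [].
- by rewrite -[RHS]a1 [RHS]big_enum_val.
- by rewrite {1}xE big_enum_val.
Qed.

Lemma hull_mem A t : t \in A -> hull A (p t).
Proof.
move=> tA; apply/hullP; exists (fun s => (s == t)%:R); first by move=> s; rewrite ler0n.
rewrite (bigD1 t) //= eqxx scale1r big1 ?addr0 // => s /andP[_ /negbTE->].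
by rewrite scale0r.
Qed.

Lemma hull_sub_span A x : hull A x -> (hom x <= spanm hv A)%MS.
Proof. by move/hullP => [a _ xE]; apply/mem_spanmP; exists a. Qed.

Lemma affine_hullE A x : affine_hull (hull A) x <-> (hom x <= spanm hv A)%MS.
Proof.
split=> [[k [q [a [qA a1 xE]]]]|/mem_spanmP[c /hom_combE[c1 xE]]].
  have -> : hom x = \sum_i a i *: hom (q i) by apply/hom_combE.
  by apply: summx_sub => i _; apply: scalemx_sub; apply: hull_sub_span.
exists #|A|, (fun i => p (enum_val i)), (fun i => c (enum_val i)); split.
- by move=> i; apply: hull_mem; apply: enum_valP.
- by rewrite -[RHS]c1 [RHS]big_enum_val.
- by rewrite {1}xE big_enum_val.
Qed.

Lemma dim_rk A k : has_dim (hull A) k -> rk A = k.+1.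
Proof.
move=> [x0 [W [dW aW]]].
have inW x : (hom x <= spanm hv A)%MS <-> x - x0 \in W.
  by rewrite -affine_hullE aW.
pose w : 'I_(\dim W) -> 'rV[R]_m := fun i => (vbasis W)`_i.
pose v' (o : 'I_(\dim W).+1) := if unlift ord0 o is Some i then hom0 (w i) else hom x0.
have v'0 : v' ord0 = hom x0 by rewrite /v' unlift_none.
have v'S i : v' (lift ord0 i) = hom0 (w i) by rewrite /v' liftK.
have wW i : w i \in W by apply: vbasis_mem; apply: mem_nth; rewrite size_tuple.
have x0A : (hom x0 <= spanm hv A)%MS by apply/inW; rewrite subrr mem0v.
have A' o : (v' o <= spanm v' setT)%MS by apply: mem_spanm; rewrite in_setT.
rewrite (eq_span_rk (v' := v') (A' := setT)).
- rewrite indep_rk ?cardsT ?card_ord ?dW // => c.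
  rewrite big_mkcond big_ord_recl in_setT v'0 => c0.
  have {}c0 : c ord0 *: hom x0 + hom0 (\sum_i c (lift ord0 i) *: w i) = 0.
    rewrite -[RHS]c0 hom0_sum; congr (_ + _); apply: eq_bigr => i _.
    by rewrite in_setT v'S hom0Z.
  move: c0; rewrite /hom /hom0 scale_row_mx add_row_mx addr0 -[RHS]row_mx0 => /eq_row_mx[h1 h2].
  have c0 : c ord0 = 0 by move/matrixP/(_ 0 0): h1; rewrite !mxE eqxx mulr1.
  move: h2; rewrite c0 scale0r add0r => h2.
  have /freeP fr := basis_free (vbasisP W).
  have {}h2 i : c (lift ord0 i) = 0 by apply: (fr (fun i => c (lift ord0 i))).
  by move=> o _; case: (unliftP ord0 o) => [i ->|->].
- move=> t tA; have : p t - x0 \in W by apply/inW; exact: mem_spanm tA.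
  move/coord_vbasis => E.
  have -> : hv t = v' ord0 + \sum_i coord (vbasis W) i (p t - x0) *: v' (lift ord0 i).
    rewrite v'0; apply/eqP; rewrite -subr_eq0 opprD addrA /hv homB E hom0_sum subr_eq0; apply/eqP.
    apply: eq_bigr => i _; rewrite v'S hom0Z; congr (_ *: _).
    by rewrite -E.
  by rewrite addmx_sub // summx_sub // => i _; apply: scalemx_sub.
- move=> o _; case: (unliftP ord0 o) => [i ->|->]; last by rewrite v'0.
  rewrite v'S; have -> : hom0 (w i) = hom (w i + x0) - hom x0 by rewrite homB addrK.
  rewrite addmx_sub //; last by rewrite eqmx_opp.
  by apply/inW; rewrite addrK.
Qed.

Lemma rk_dim A k : rk A = k.+1 -> has_dim (hull A) k.
Proof.
move=> rA; have [t0 t0A] : exists t0, t0 \in A.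
  by apply/set0Pn; apply/negP => /eqP A0; move: rA; rewrite A0 rk0.
pose X := in_tuple [seq p t - p t0 | t <- enum A].
pose W := <<X>>%VS.
suff hd : has_dim (hull A) (\dim W) by have := dim_rk hd; rewrite rA => -[->].
exists (p t0), W; split => //; apply/seteqP; split => x /=.
  move=> /affine_hullE/mem_spanmP[c /hom_combE[c1 xE]].
  have -> : x - p t0 = \sum_(t in A) c t *: (p t - p t0).
    rewrite (eq_bigr (fun t => c t *: p t - c t *: p t0)) => [|t _]; last by rewrite scalerBr.
    by rewrite sumrB -scaler_suml c1 scale1r -xE.
  apply: memv_suml => t tA; apply: memvZ; apply: memv_span.
  by apply: map_f; rewrite mem_enum.
move=> /coord_span E; apply/affine_hullE.
have -> : hom x = hv t0 + \sum_i coord X i (x - p t0) *: hom0 X`_i.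
  apply/eqP; rewrite -subr_eq0 opprD addrA /hv homB {1}E hom0_sum subr_eq0; apply/eqP.
  by apply: eq_bigr => i _; rewrite hom0Z.
apply: addmx_sub; first exact: mem_spanm.
apply: summx_sub => i _; apply: scalemx_sub.
have : X`_i \in [seq p t - p t0 | t <- enum A] by apply: mem_nth.
case/mapP => t; rewrite mem_enum => tA ->.
rewrite -homB; apply: addmx_sub; first exact: (mem_spanm hv tA).
by rewrite eqmx_opp; apply: (mem_spanm hv t0A).
Qed.

Lemma has_dimE A k : has_dim (hull A) k <-> rk A = k.+1.
Proof. by split; [apply: dim_rk|apply: rk_dim]. Qed.

Lemma hull_le S l x : valid hv S l -> hull S x -> pr (hom x) l <= 0.
Proof.
move=> vl /hullP[a a0 ->]; rewrite pr_suml; apply: sumr_le0 => t tS.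
by rewrite prZl mulr_ge0_le0 // vl.
Qed.

Lemma hull_zs S l x : valid hv S l -> hull (zs hv S l) x <-> hull S x /\ pr (hom x) l = 0.
Proof.
move=> vl; split.
  move=> /hullP[a a0 xE]; split; last first.
    by rewrite xE pr_suml big1 // => t /zsP[_ tl]; rewrite prZl -/(ev t l) tl mulr0.
  apply/hullP; exists (fun t => if t \in zs hv S l then a t else 0) => [t|]; first by case: ifP.
  rewrite xE [RHS](big_setID (zs hv S l)) /= [X in _ = _ + X]big1 ?addr0.
    rewrite (setIidPr (zs_sub hv S l)); by apply: eq_bigr => t ->.
  by move=> t /setDP[_ /negbTE->]; rewrite scale0r.
move=> [/hullP[a a0 xE] x0]; apply/hullP; exists a => //.
rewrite xE (big_setID (zs hv S l)) /= (setIidPr (zs_sub hv S l)) [X in _ + X]big1 ?addr0 // => t /setDP[tS tz].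
have : a t * ev t l = 0.
  have h s : s \in S -> 0 <= - (a s * ev s l) by move=> sS; rewrite oppr_ge0 mulr_ge0_le0 // vl.
  have e : \sum_(s in S) - (a s * ev s l) = 0.
    rewrite sumrN; apply/eqP; rewrite oppr_eq0 -[X in _ == X]x0 xE pr_suml; apply/eqP.
    by apply: eq_bigr => s _; rewrite prZl.
  by apply/eqP; rewrite -oppr_eq0; have := psumr_eq0P h e tS => /eqP.
move/eqP; rewrite mulf_eq0 => /orP[/eqP->|/eqP h]; first by rewrite scale0r.
by case/negP: tz; apply/zsP.
Qed.

Lemma hull_zs_mem S l t : valid hv S l -> t \in S -> hull (zs hv S l) (p t) -> t \in zs hv S l.
Proof. by move=> vl tS /(hull_zs _ vl)[_ h]; apply/zsP. Qed.

Lemma hull_zs_inj S l l' : valid hv S l -> valid hv S l' ->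
  hull (zs hv S l) = hull (zs hv S l') -> zs hv S l = zs hv S l'.
Proof.
move=> vl vl' E; apply/eqP; rewrite eqEsubset; apply/andP; split; apply/subsetP => t tz.
  by apply: (hull_zs_mem vl'); rewrite ?(subsetP (zs_sub _ _ _) _ tz) // -E; apply: hull_mem.
by apply: (hull_zs_mem vl); rewrite ?(subsetP (zs_sub _ _ _) _ tz) // E; apply: hull_mem.
Qed.

Lemma supports_valid S Fc c b : supports (hull S) Fc c b <->
  valid hv S (cof c b) /\ Fc = hull (zs hv S (cof c b)).
Proof.
split=> [[h FE]|[vl FE]].
  have vl : valid hv S (cof c b).
    by move=> t tS; rewrite /ev pr_cof subr_le0; apply: h; apply: hull_mem.
  split => //; rewrite FE; apply/seteqP; split => x /=.
    by move=> [xS xb]; apply/hull_zs => //; split => //; rewrite pr_cof xb subrr.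
  move/(hull_zs _ vl) => [xS]; rewrite pr_cof => /eqP; rewrite subr_eq0 => /eqP xb.
  by split.
split=> [x xS|]; first by have := hull_le vl xS; rewrite pr_cof subr_le0.
rewrite FE; apply/seteqP; split => x /=.
  move/(hull_zs _ vl) => [xS]; rewrite pr_cof => /eqP; rewrite subr_eq0 => /eqP xb.
  by split.
by move=> [xS xb]; apply/hull_zs => //; split => //; rewrite pr_cof xb subrr.
Qed.

Lemma is_faceE S Fc : is_face (hull S) Fc <-> exists2 A, faceset hv S A & Fc = hull A.
Proof.
split=> [[c [b /supports_valid[vl FE]]]|[A [l vl lA] FE]].
  by exists (zs hv S (cof c b)) => //; exists (cof c b).
have [c [b lE]] := cofP l; exists c, b; apply/supports_valid; rewrite -lE; split => //.
by rewrite lA.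
Qed.

Lemma fnumE S i : fnum i (hull S) = #|[set A | `[< faceset hv S A >] && (rk A == i.+1)]|.
Proof.
apply: (card_fset_set_image (f := hull)).
  move=> A B; rewrite !inE => /andP[/asboolP[l vl <-] _] /andP[/asboolP[l' vl' <-] _].
  exact: hull_zs_inj.
move=> Fc; split=> [[/is_faceE[A fA ->] hd]|[A]].
  by exists A; rewrite // inE; apply/andP; split; [apply/asboolP|apply/eqP/has_dimE].
rewrite inE => /andP[/asboolP fA /eqP rA] ->; split; last exact/has_dimE.
by apply/is_faceE; exists A.
Qed.

(** The rank condition excludes a single point, whose empty face satisfies [facet] but has no
    dimension in the sense of [has_dim]. *)
Lemma is_facetE S Fc : is_facet (hull S) Fc <-> (exists2 A, facet hv S A & Fc = hull A) /\ (1 < rk S)%N.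
Proof.
split=> [[/is_faceE[A [l vl lA] ->] [k /has_dimE hS /has_dimE hA]]|[[A [l [vl lA rA]] ->] r1]].
  by split; [exists A => //; exists l; split => //; rewrite hA|rewrite hS].
split; first by apply/is_faceE; exists A => //; exists l.
exists (rk S - 2)%N; apply/has_dimE; last by move: rA r1; case: (rk S) => [|[|n]] //= -[->] _; rewrite subSS subn1.
by rewrite -subSn // subSS subn1 prednK // ltnW.
Qed.

End Hull.

Section Coordinates.
Local Open Scope ring_scope.
Variables (R : realFieldType) (N : nat) (T : finType) (v : T -> 'rV[R]_N).

(** The combinatorial part works in a space of dimension exactly [d + 1], while the polytope may lie
    in a larger one. This is what survives the passage to coordinates on the span. *)
Definition same_faces D (v' : T -> 'rV[R]_D) :=
  [/\ forall A, rk v' A = rk v A, forall l, exists l', forall t, ev v t l = ev v' t l' &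
      forall l', exists l, forall t, ev v t l = ev v' t l'].

Lemma coordinates D : rk v setT = D -> exists v' : T -> 'rV[R]_D, same_faces v'.
Proof.
move=> <-; rewrite /rk; set B := row_base (spanm v setT).
have vB t : v t *m pinvmx B *m B = v t.
  by rewrite mulmxKpV // eq_row_base; apply: mem_spanm; rewrite in_setT.
exists (fun t => v t *m pinvmx B); split.
- move=> A; rewrite /rk -(mxrankMfree (spanm _ A) (row_base_free (spanm v setT))) -/B.
  rewrite /spanm (sumsmxMr_gen _ _ B); congr mxrank.
  by apply: eq_bigr => t _; apply: eq_genmx; rewrite -{2}(vB t); apply: eqmxMr; apply: genmxE.
- by move=> l; exists (B *m l) => t; rewrite /ev /pr mulmxA vB.
- by move=> l'; exists (pinvmx B *m l') => t; rewrite /ev /pr mulmxA.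
Qed.

Variables (D : nat) (v' : T -> 'rV[R]_D).
Hypothesis sf : same_faces v'.

Lemma same_faceset S A : faceset v S A <-> faceset v' S A.
Proof.
have [_ h1 h2] := sf.
have E l l' : (forall t, ev v t l = ev v' t l') ->
    (valid v S l <-> valid v' S l') /\ zs v S l = zs v' S l'.
  move=> h; split; first by split=> vl t tS; [rewrite -h|rewrite h]; apply: vl.
  by apply/setP => t; rewrite !inE h.
split=> -[l vl <-].
  have [l' h] := h1 l; have [e1 e2] := E l l' h; exists l'; first exact/e1.
  by rewrite e2.
have [k h] := h2 l; have [e1 e2] := E k l h; exists k; first exact/e1.
by rewrite e2.
Qed.

Lemma facetE S A : facet v S A <-> faceset v S A /\ (rk v A).+1 = rk v S.
Proof. by split=> [[l [h1 h2 h3]]|[[l h1 h2] h3]]; [split => //; exists l|exists l]. Qed.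

End Coordinates.

Lemma same_facet (R : realFieldType) (N D : nat) (T : finType) (v : T -> 'rV[R]_N)
  (v' : T -> 'rV[R]_D) S A : same_faces v v' -> facet v S A <-> facet v' S A.
Proof.
move=> sf; have [h _ _] := sf.
by rewrite !facetE (same_faceset sf) !h.
Qed.

Section SubFacet.
Local Open Scope ring_scope.
(** Minus the sum of the functionals dual to the vertices of [G :\: A] is right on [G]; a large
    multiple of the functional of [G] takes care of the points outside. *)
Lemma faceset_subfacet (R : realFieldType) (N : nat) (T : finType) (v : T -> 'rV[R]_N)
  (A G : {set T}) : facet v setT G -> rk v G = #|G| -> A \subset G -> faceset v setT A.
Proof.
move=> [l [vl lG rG]] iG AG.
have lz t : t \in G -> ev v t l = 0 by rewrite -{1}lG => /zsP[].
have : forall u, exists m, u \in G -> (forall s, s \in G :\ u -> ev v s m = 0) /\ ev v u m = 1.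
  move=> u; have [uG|uG] := boolP (u \in G); last by exists 0.
  by have [m m0 mu] := dualfun iG uG; exists m.
move/choice => [f fP]; pose m := - \sum_(u in G :\: A) f u.
have mE t : t \in G -> ev v t m = - (t \notin A)%:R.
  move=> tG; rewrite /m /ev prNr; congr (- _).
  have -> : pr (v t) (\sum_(u in G :\: A) f u) = \sum_(u in G :\: A) ev v t (f u).
    exact: (big_morph (pr (v t)) (prDr (v t)) (pr0r (v t))).
  have [tA|tA] := boolP (t \in A); last first.
    rewrite (big_setD1 t) /=; last by rewrite inE tA.
    rewrite (fP t tG).2 big1 ?addr0 // => u /setD1P[ut /setDP[uG _]].
    by apply: (fP u uG).1; rewrite in_setD1 eq_sym ut.
  rewrite big1 // => u /setDP[uG uA]; apply: (fP u uG).1; rewrite in_setD1 tG andbT.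
  by apply: contraNneq uA => <-.
have [c c0 hc] := large_mult setT (fun t => ev v t m) (fun t => ev v t l).
have E t : ev v t (m + c *: l) = ev v t m + c * ev v t l by rewrite /ev !prE.
have nG t : t \notin G -> ev v t (m + c *: l) < 0.
  move=> tG; rewrite E; apply: hc; rewrite ?in_setT // lt_neqAle vl ?in_setT // andbT.
  by apply: contra tG => /eqP h; rewrite -lG; apply/zsP; rewrite in_setT.
have EG t : t \in G -> ev v t (m + c *: l) = - (t \notin A)%:R by move=> tG; rewrite E lz // mulr0 addr0 mE.
exists (m + c *: l).
  move=> t _; have [tG|tG] := boolP (t \in G); last exact/ltW/nG.
  by rewrite EG // oppr_le0 ler0n.
apply/setP => t; apply/zsP/idP => [[_ h]|tA].
  have tG : t \in G by apply: contraT => /nG; rewrite h ltxx.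
  by apply: contraT => tA; move: h; rewrite EG // tA => /eqP; rewrite oppr_eq0 oner_eq0.
by split; rewrite ?in_setT // EG ?(subsetP AG) // tA oppr0.
Qed.

End SubFacet.

Section ConfigFaces.
Local Open Scope ring_scope.
Variables (R : realFieldType) (d : nat) (T : finType) (v : T -> 'rV[R]_d.+1) (F : {set T}).
Hypothesis cS : config v F setT.
Local Notation fs := (fs v setT F).

Let full : rk v setT = d.+1 := proj1 cS.
Let simp : forall G, facet v setT G -> G <> F -> #|G| = d := proj2 cS.

Lemma faceset_small A : faceset v setT A -> (rk v A < d)%N -> Dl fs A /\ #|A| = rk v A.
Proof.
move=> [l vl lA] rA.
have [||G fG [zG GF]] := @ext_facet_neq _ _ _ v setT l F vl.
- apply: contrapT => h; have : A = setT.
    apply/setP => t; rewrite in_setT -lA; apply/zsP; split; first exact: in_setT.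
    by apply/eqP/negPn/negP => nz; apply: h; exists t; rewrite ?in_setT.
  by move=> E; move: rA; rewrite E full ltnNge leqnSn.
- by rewrite lA full ltnS.
have Gf : G \in fs by apply/fsP; split => //; apply/eqP.
rewrite lA in zG; split; first by apply/DlP; exists G.
by rewrite (indepS (fs_indep full simp Gf) zG).
Qed.

Lemma config_faces j : (j < d)%N ->
  [set A | `[< faceset v setT A >] && (rk v A == j)] = faces fs set0 j.
Proof.
move=> jd; apply/setP => A; rewrite inE; apply/andP/facesP.
  move=> [/asboolP fA /eqP rA]; have [|h1 h2] := faceset_small fA; first by rewrite rA.
  by split; rewrite ?sub0set // h2 rA cards0.
move=> [/DlP[G Gf AG] _ cA]; split; first by apply/asboolP; have [fG _] := fsP _ _ _ _ Gf; apply: faceset_subfacet fG (fs_indep full simp Gf) AG.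
by rewrite (indepS (fs_indep full simp Gf) AG) cA cards0.
Qed.

Lemma config_facets : facet v setT F ->
  #|[set A | `[< faceset v setT A >] && (rk v A == d)]| = #|faces fs set0 d|.+1.
Proof.
move=> fF.
have -> : faces fs set0 d = fs.
  apply/setP => A; apply/facesP/idP => [[/DlP[G Gf AG] _ cA]|Af].
    suff -> : A = G by [].
    by apply/eqP; rewrite eqEcard AG cA (fs_card simp Gf) cards0 leqnn.
  by rewrite (fs_card simp Af) cards0 sub0set; split => //; apply/DlP; exists A.
have FF : F \notin fs by apply/negP => /fsP[].
rewrite -[RHS]add1n -[X in (X + _)%N]/((~~ false : nat)) -(negbTE FF) -cardsU1.
apply: eq_card => A; rewrite inE in_setU1; apply/andP/orP.
  move=> [/asboolP fA /eqP rA]; have fA' : facet v setT A by apply/facetE; rewrite full rA.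
  by have [->|AF] := eqVneq A F; [left|right; apply/fsP; split => //; apply/eqP].
have h B : facet v setT B -> `[< faceset v setT B >] /\ rk v B == d.
  by move=> fB; split; [apply/asboolP; case/facetE: fB|rewrite (facet_rk full fB)].
by case=> [/eqP->|/fsP[fA _]]; exact: h.
Qed.

End ConfigFaces.

Section FnumConfig.
Local Open Scope ring_scope.
Variables (R : realType) (m d : nat) (T : finType) (p : T -> 'rV[R]_m).
Variables (v : T -> 'rV[R]_d.+1) (F : {set T}).
Hypothesis sf : same_faces (hv p) v.
Hypothesis cS : config v F setT.
Hypothesis fF : facet v setT F.

Lemma fnum_config i : (i.+1 < d)%N -> fnum i (hull p setT) = #|faces (fs v setT F) set0 i.+1|.
Proof.
move=> id; rewrite fnumE -(config_faces cS id); apply: eq_card => A; rewrite !inE.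
by have [-> _ _] := sf; congr (_ && _); apply/asboolP/asboolP => /(same_faceset sf).
Qed.

Lemma fnum_config_top : (0 < d)%N -> fnum d.-1 (hull p setT) = #|faces (fs v setT F) set0 d|.+1.
Proof.
move=> d0; rewrite fnumE -(config_facets cS fF); apply: eq_card => A; rewrite !inE prednK //.
by have [-> _ _] := sf; congr (_ && _); apply/asboolP/asboolP => /(same_faceset sf).
Qed.

End FnumConfig.

Lemma hull_sub_hull (R : realType) m (T T' : finType) (p : T -> 'rV[R]_m) (p' : T' -> 'rV[R]_m)
    (A : {set T}) (A' : {set T'}) :
  (forall t, t \in A -> hull p' A' (p t)) -> (hull p A `<=` hull p' A')%classic.
Proof.
move=> h x /hullP[a a0 xE].
have : forall t, exists c : T' -> R, (forall s, 0 <= c s)%R /\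
    (t \in A -> hv p t = \sum_(s in A') c s *: hv p' s)%R.
  move=> t; have [tA|tA] := boolP (t \in A); last by exists (fun=> 0%R).
  by have /hullP[c c0 cE] := h t tA; exists c.
move/choice => [c cP]; apply/hullP; exists (fun s => \sum_(t in A) a t * c t s)%R.
  by move=> s; apply: sumr_ge0 => t _; apply: mulr_ge0 => //; case: (cP t).
rewrite xE; under [RHS]eq_bigr => s _ do rewrite scaler_suml.
rewrite exchange_big /=; apply: eq_bigr => t tA; have [_ /(_ tA) ->] := cP t.
by rewrite scaler_sumr; apply: eq_bigr => s _; rewrite scalerA.
Qed.

Lemma affinely_independent_rk (R : realType) m k (q : 'I_k -> 'rV[R]_m) :
  affinely_independent q -> rk (hv q) setT = k.
Proof.
move=> qi; rewrite indep_rk ?cardsT ?card_ord // => c; rewrite hom_comb -[RHS]row_mx0 => /eq_row_mx[/matrixP/(_ 0 0)%R].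
rewrite !mxE eqxx mulr1n => c0 cq i _; apply: qi.
  by rewrite -[RHS]c0; apply: eq_bigl => j; rewrite in_setT.
by rewrite -[RHS]cq; apply: eq_bigl => j; rewrite in_setT.
Qed.

Section Vertices.
Local Open Scope ring_scope.
Variables (R : realType) (m : nat) (T : finType) (p : T -> 'rV[R]_m).
Implicit Types (S A B G : {set T}) (x y : 'rV[R]_m).
Local Notation hvp := (hv p).
Local Notation hullp := (hull p).

Definition in_convex_position S := forall t, t \in S -> faceset hvp S [set t].

Lemma hv_nz t : exists l, ev hvp t l != 0.
Proof.
exists (cof 0 (-1)); rewrite /ev pr_cof /dot big1 ?opprK ?add0r ?oner_eq0 // => i _.
by rewrite mxE mul0r.
Qed.

Lemma rk1 t : rk hvp [set t] = 1%N.
Proof.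
have [l lt] := hv_nz t; rewrite -(setU0 [set t]) (rk_add (l := l)) ?rk0 //.
by move=> s; rewrite inE.
Qed.

Lemma hull_set1 t x : hullp [set t] x -> x = p t.
Proof.
move=> /hullP[a _ /hom_combE[]]; rewrite !big_set1 => -> ->.
by rewrite scale1r.
Qed.

Lemma convex_position_face S A : in_convex_position S -> A \subset S -> in_convex_position A.
Proof.
move=> cp AS t tA; have [l vl lz] := cp t (subsetP AS t tA).
exists l; first by move=> s /(subsetP AS); apply: vl.
apply/setP => s; apply/zsP/set1P => [[sA sl]|-> ]; last first.
  by split => //; have /zsP[] : t \in zs hvp S l by rewrite lz set11.
by apply/set1P; rewrite -lz; apply/zsP; rewrite (subsetP AS).
Qed.

Lemma convex_position_sep S t s : in_convex_position S -> t \in S -> s \in S -> s != t ->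
  exists2 l, ev hvp t l = 0 & ev hvp s l < 0.
Proof.
move=> cp tS sS st; have [l vl lz] := cp t tS; exists l.
  by have /zsP[] : t \in zs hvp S l by rewrite lz set11.
rewrite lt_neqAle vl // andbT; apply: contra st => /eqP sl.
by rewrite -in_set1 -lz; apply/zsP.
Qed.

Lemma faceset_rk1 S A : in_convex_position S -> faceset hvp S A -> rk hvp A = 1%N ->
  exists2 t, t \in S & A = [set t].
Proof.
move=> cp [l vl lA] rA; have AS : A \subset S by rewrite -lA zs_sub.
have [t tA] : exists t, t \in A.
  by apply/set0Pn/eqP => A0; move: rA; rewrite A0 rk0.
exists t; first exact: (subsetP AS).
apply/eqP; rewrite eq_sym eqEsubset sub1set tA; apply/subsetP => s sA; rewrite in_set1.
apply: contraT => st.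
have [k kt ks] := convex_position_sep cp (subsetP AS t tA) (subsetP AS s sA) st.
have : (rk hvp (s |: [set t]) <= rk hvp A)%N by apply: rkS; rewrite subUset !sub1set sA tA.
rewrite (rk_add (l := k)) ?rk1 ?rA ?ltnn //; last by rewrite lt_eqF.
by move=> u /set1P->.
Qed.

Lemma fnum0_hull S : in_convex_position S -> fnum 0 (hullp S) = #|S|.
Proof.
move=> cp; rewrite fnumE -(card_imset _ (@set1_inj T)); apply: eq_card => A; rewrite inE.
apply/andP/imsetP => [[/asboolP fA /eqP rA]|[t tS ->]]; first exact: (faceset_rk1 cp fA rA).
by rewrite rk1; split => //; apply/asboolP; apply: cp.
Qed.

(** [is_simplex] supplies its own points [q]. Each [p t] is exposed, so in a convex combination of
    the [q i] every point with positive weight equals [p t]; hence there are at most as many labels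
    as points [q]. *)
Lemma simplex_rk A : in_convex_position A -> is_simplex (hullp A) -> rk hvp A = #|A|.
Proof.
move=> cp [k [q [qi qA]]].
have qE : hullp A = hull q setT.
  rewrite qA /hull; congr convex_hull; apply/seteqP; split => x /=.
    by move=> [i _ <-]; exists i; rewrite ?in_setT.
  by move=> [i _ ->]; exists i.
have rq : rk (hv q) setT = k := affinely_independent_rk qi.
have rA : rk hvp A = k.
  rewrite -rq; apply: eq_span_rk => [t tA|i _].
    by apply: hull_sub_span; rewrite -qE; apply: hull_mem.
  by apply: hull_sub_span; rewrite qE; apply: hull_mem; rewrite in_setT.
apply/eqP; rewrite eqn_leq rk_card rA -[X in (_ <= X)%N]card_ord.
have -> : #|'I_k| = size (codom q) by rewrite size_codom.
rewrite cardE -(size_map p); apply: uniq_leq_size.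
  rewrite map_inj_in_uniq ?enum_uniq // => s t; rewrite !mem_enum => sA tA st.
  apply/eqP/negPn/negP => /(convex_position_sep cp tA sA)[l tl].
  by rewrite /ev /hv st -/(hv p t) -/(ev (hv p) t l) tl ltxx.
move=> y /mapP[t]; rewrite mem_enum => tA ->.
have [l vl lz] := cp t tA.
have tl : ev hvp t l = 0 by have /zsP[] : t \in zs hvp A l by rewrite lz set11.
have : hullp A (p t) by apply: hull_mem.
rewrite qE => /hullP[a a0 xE].
have qlA i : hullp A (q i) by rewrite qE; apply: hull_mem; rewrite in_setT.
have ql i : pr (hv q i) l <= 0 by apply: (hull_le vl).
have al i : a i * pr (hv q i) l = 0.
  have e : \sum_(i in [set: 'I_k]) - (a i * pr (hv q i) l) = 0.
    rewrite sumrN; apply/eqP; rewrite oppr_eq0 -[X in _ == X]tl /ev /hv xE pr_suml; apply/eqP.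
    by apply: eq_bigr => j _; rewrite prZl.
  apply/eqP; rewrite -oppr_eq0; apply/eqP; apply: (psumr_eq0P _ e); last by rewrite in_setT.
  by move=> j _; rewrite oppr_ge0 mulr_ge0_le0.
have [i ai] : exists i, a i != 0.
  apply: contrapT => h; have /hom_combE[] := xE; rewrite big1 => [/esym/eqP|i _].
    by rewrite oner_eq0.
  by apply/eqP/negPn/negP => ai; apply: h; exists i.
suff -> : p t = q i by apply: codom_f.
apply/esym/hull_set1; rewrite -lz; apply/(hull_zs _ vl); split => //.
by apply/eqP; have /eqP := al i; rewrite mulf_eq0 (negbTE ai).
Qed.

(** In homogeneous coordinates constants are functionals: [e] is constantly 1, and subtracting the
    value of [l] at [t] exposes [t]. *)
Lemma sep_faceset S t l : t \in S -> 0 < pr (hv p t) l ->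
  (forall s, s \in S :\ t -> ev hvp s l <= 0) -> faceset hvp S [set t].
Proof.
move=> tS tl h; pose e : 'cV[R]_(1 + m) := cof 0 (-1).
have e1 s : ev hvp s e = 1.
  rewrite /ev pr_cof /dot big1 ?opprK ?add0r // => i _; by rewrite mxE mul0r.
have E s : ev hvp s (l + (- ev hvp t l) *: e) = ev hvp s l - ev hvp t l.
  by rewrite /ev !prE -!/(ev _ _ _) e1 mulr1.
have neg s : s \in S -> s != t -> ev hvp s (l + (- ev hvp t l) *: e) < 0.
  move=> sS st; rewrite E subr_lt0; apply: le_lt_trans tl; apply: h.
  by rewrite in_setD1 st.
exists (l + (- ev hvp t l) *: e).
  by move=> s sS; have [->|st] := eqVneq s t; [rewrite E subrr|apply/ltW/neg].
apply/setP => s; apply/zsP/set1P => [[sS sl]|->]; last by rewrite E subrr.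
by apply/eqP; apply: contraT => st; have := neg s sS st; rewrite sl ltxx.
Qed.

End Vertices.

(** Take a generating family of least size. By [farkas], a point that cannot be separated from the
    others is a convex combination of them and could be dropped. *)
Lemma polytope_vertices (R : realType) m (P : set 'rV[R]_m) : is_polytope P ->
  exists k (p : 'I_k -> 'rV[R]_m), P = hull p setT /\ in_convex_position p setT.
Proof.
move=> [X /finite_seqP[s ->] PE].
pose Q k := exists p : 'I_k -> 'rV[R]_m, P = hull p setT.
have exQ : exists k, `[<Q k>].
  exists (size s); apply/asboolP; exists (fun i => s`_i)%R.
  rewrite PE /hull; congr convex_hull; apply/seteqP; split => x /=.
    by move=> xs; exists (Ordinal (etrans (index_mem x s) xs)) => //=; rewrite ?nth_index ?in_setT.
  by move=> [i _ ->]; apply: mem_nth.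
case: (ex_minnP exQ) => k /asboolP[p pE] kmin; exists k, p; split => // t _.
have [[c [c0 ct]]|[l [l0 lt]]] := farkas (setT :\ t) (hv p) (hv p t); last first.
  by apply: sep_faceset lt _; rewrite ?in_setT.
exfalso; case: k => [|k] in p t c c0 ct pE kmin *; first by case: t {ct}.
suff /kmin : `[<Q k>] by rewrite ltnn.
apply/asboolP; exists (fun i => p (lift t i)); rewrite pE; apply/seteqP; split.
  have mem i : i != t -> hull (fun i => p (lift t i)) setT (p i).
    rewrite eq_sym => /unlift_some[j -> _].
    by apply: (hull_mem (fun i => p (lift t i))); rewrite in_setT.
  apply: (classical_sets.subset_trans (B := hull p (setT :\ t))).
    apply: hull_sub_hull => i _; have [->|it] := eqVneq i t; last by apply: hull_mem; rewrite !inE it.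
    by apply/hullP; exists c.
  by apply: hull_sub_hull => i; rewrite !inE andbT; apply: mem.
by apply: hull_sub_hull => i _; apply: hull_mem; rewrite in_setT.
Qed.

Lemma asp_pair_config (R : realType) (d n s m : nat) (P Fc : set 'rV[R]_m) : 1 < d ->
  asp_pair d n s P Fc -> exists (p : 'I_n -> 'rV[R]_m) (v : 'I_n -> 'rV[R]_d.+1) F,
    [/\ P = hull p setT, same_faces (hv p) v & asp_config s v F].
Proof.
move=> d1 [/polytope_vertices[k [p [-> cp]]] /has_dimE rp].
rewrite fnum0_hull // cardsT card_ord => kn; subst k.
move=> [/is_facetE[[F fF ->] _] Fs Gs].
have [v sf] := coordinates rp; exists p, v, F; split => //.
have [rE _ _] := sf.
have cS : config v F setT.
  split=> [|G /(same_facet setT G sf) fG GF]; first by rewrite rE.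
  have cG := convex_position_face cp (facet_sub fG).
  rewrite -(simplex_rk cG) => [|]; first by have [l [_ _]] := fG; rewrite rp => -[].
  have [l [vl lG rG]] := fG; have [k [vk kF rF]] := fF.
  apply: Gs => [|E]; first by apply/is_facetE; split; [exists G|rewrite rp ltnS ltnW].
  by apply: GF; rewrite -lG -kF; apply: hull_zs_inj => //; rewrite lG kF.
have cF := convex_position_face cp (facet_sub fF).
split; first exact: cS.
- exact/(same_facet setT F sf).
- by rewrite -Fs fnum0_hull.
move=> t; have [||//] := faceset_small cS (A := [set t]); last by rewrite rE rk1.
by apply/(same_faceset sf)/cp; rewrite in_setT.
Qed.

(** * The polytope C(d,n,s) *)

Section Heights.
Local Open Scope ring_scope.
Variables (R : realFieldType) (d n : nat) (x h : 'I_n -> R) (v : 'I_n -> 'rV[R]_d.+1).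
Variables (M : R) (F : {set 'I_n}).
Implicit Types (I J K : {set 'I_n}) (i j t z : 'I_n).
Hypothesis d0 : (0 < d)%N.
Hypothesis h0 : forall i, 0 <= h i.
Hypothesis hF : forall i, (h i == 0) = (i \in F).
Hypothesis Flow : forall i j, (i <= j)%N -> j \in F -> i \in F.
Hypothesis cF : (d <= #|F|)%N.
Hypothesis FT : exists z, z \notin F.
Hypothesis gap1 : forall i j, (j < i)%N -> 1 <= x i - x j.
Hypothesis gapM : forall i j, (j < i)%N -> x i - x j <= M.
Hypothesis growth : forall z, z \notin F -> M ^+ d.-1 * \sum_(i : 'I_n | (i < z)%N) h i < h z.
Hypothesis lift : forall (q : {poly R}) c, (size q <= d)%N ->
  exists l, forall i, ev v i l = q.[x i] + c * h i.

Let nodes J i := \prod_(j in J) (x i - x j).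

Definition divided_difference J := \sum_(i in J) h i / nodes (J :\ i) i.

Let x_neq i j : i != j -> x i - x j != 0.
Proof.
rewrite -val_eqE neq_ltn => /orP[]/gap1; last by move=> ?; rewrite gt_eqF //; lra.
by move=> ?; rewrite lt_eqF //; lra.
Qed.

Let nodes_neq0 J i : i \notin J -> nodes J i != 0.
Proof.
by move=> iJ; apply/prodf_neq0 => j jJ; apply: x_neq; apply: contraNneq iJ => ->.
Qed.

Let nodes1 J i j : j \in J -> nodes J i = (x i - x j) * nodes (J :\ j) i.
Proof. by move=> jJ; rewrite /nodes (big_setD1 j). Qed.

(* By [growth], the term of the last node outweighs all the others together. *)
Lemma divided_difference_gt0 J : #|J| = d.+1 -> ~~ (J \subset F) -> 0 < divided_difference J.
Proof.
move=> cJ /subsetPn[z0 z0J z0F].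
pose z := [arg max_(z > z0 in J) (z : nat)].
have [zJ zmax] : z \in J /\ forall j, j \in J -> (j <= z)%N by rewrite /z; case: arg_maxnP.
have zF : z \notin F by apply: contra z0F; apply: Flow; apply: zmax.
have lz j : j \in J :\ z -> (j < z)%N.
  by move=> /setD1P[jz jJ]; rewrite ltn_neqAle val_eqE jz zmax.
have Dz : 0 < nodes (J :\ z) z.
  by apply: prodr_gt0 => j /lz/gap1 ?; lra.
(* Both products contain the distance between [i] and [z]. Each of the remaining [d - 1] factors is
   at most [M] at [z] and at least 1 in absolute value at [i]. *)
have bound i : i \in J :\ z -> `|h i / nodes (J :\ i) i| <= h i * M ^+ d.-1 / nodes (J :\ z) z.
  move=> iJz; have /setD1P[iz iJ] := iJz.
  have Di : 0 < `|nodes (J :\ i) i| by rewrite normr_gt0 nodes_neq0 // setD11.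
  rewrite normrM normfV (ger0_norm (h0 i)) -mulrA ler_wpM2l //.
  rewrite ler_pdivlMr // mulrC ler_pdivrMr //.
  have zJi : z \in J :\ i by rewrite in_setD1 eq_sym iz.
  rewrite (nodes1 z iJz) (nodes1 i zJi) normrM distrC.
  have ziP := gap1 (lz i iJz); rewrite (ger0_norm (x := x z - x i)); last lra.
  have -> : J :\ z :\ i = J :\ i :\ z by rewrite setDDl setUC -setDDl.
  set A := J :\ i :\ z; have cA : #|A| = d.-1.
    by have := cardsD1 z (J :\ i); have := cardsD1 i J; rewrite iJ zJi cJ -/A; move: #|J :\ i| #|A| => p q; clear; lia.
  have lA j : j \in A -> (j < z)%N.
    by move=> /setD1P[jz /setD1P[_ jJ]]; apply: lz; rewrite in_setD1 jz.
  rewrite mulrCA ler_wpM2l //; first lra.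
  have zM : nodes A z <= M ^+ d.-1.
    rewrite -cA -prodr_const; apply: ler_prod => j /lA jz.
    by rewrite gapM // andbT; have := gap1 jz; lra.
  apply: le_trans zM _; apply: ler_peMr.
    apply: exprn_ge0; have := gapM (lz i iJz); lra.
  rewrite normr_prod; apply: (big_ind (fun a : R => 1 <= a)) => [//|a b a1 b1|j /setD1P[_ /setD1P[ji _]]].
    by rewrite -[1]mulr1 ler_pM.
  move: ji; rewrite -val_eqE neq_ltn => /orP[]/gap1 g.
    by rewrite ger0_norm; lra.
  by rewrite distrC ger0_norm; lra.
rewrite /divided_difference (big_setD1 z) //= -[X in _ + X]opprK subr_gt0 -sumrN.
have le : \sum_(i in J :\ z) - (h i / nodes (J :\ i) i) <=
    (\sum_(i in J :\ z) h i) * M ^+ d.-1 / nodes (J :\ z) z.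
  rewrite !mulr_suml; apply: ler_sum => i /bound; apply: le_trans.
  by rewrite -normrN ler_norm.
apply: le_lt_trans le _; rewrite ltr_pM2r ?invr_gt0 //.
apply: le_lt_trans (growth zF); rewrite mulrC ler_wpM2l //.
  apply: exprn_ge0.
  have [j jJz] : exists j, j \in J :\ z.
    apply/set0Pn; rewrite -card_gt0; have := cardsD1 z J; rewrite zJ cJ; move: #|J :\ z| d0 => q; clear; lia.
  by have := gapM (lz j jJz); have := gap1 (lz j jJz); lra.
rewrite [X in _ <= X](bigID (mem (J :\ z))) /= -[X in X <= _]addr0; apply: lerD.
  rewrite [X in _ <= X](eq_bigl (mem (J :\ z))) // => i.
  by apply/andP/idP => [[]|/= iJ] //; split => //; exact: lz.
by apply: sumr_ge0.
Qed.

(** The error of Lagrange interpolation of [h] at the nodes in [I]; [interpE] is Newton's formula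
    for this remainder. *)
Let interp I t := h t - \sum_(i in I) h i / nodes (I :\ i) i * nodes (I :\ i) t.

Lemma interpE I t : t \notin I -> interp I t = nodes I t * divided_difference (t |: I).
Proof.
move=> tI; rewrite /divided_difference big_setU1 //= setU1K // mulrDr.
rewrite mulrCA mulfV ?mulr1 ?nodes_neq0 // /interp; congr (_ + _).
rewrite -sumrN mulr_sumr; apply: eq_bigr => i iI.
have ti : t != i by apply: contraNneq tI => ->.
have tJ : t \in (t |: I) :\ i by rewrite in_setD1 ti setU11.
rewrite (nodes1 i tJ) (nodes1 t iI).
have -> : (t |: I) :\ i :\ t = I :\ i.
  by rewrite setDDl (setUC [set i]) -setDDl setU1K.
have h1 := x_neq ti; have : x i - x t != 0 by rewrite x_neq // eq_sym.
have : nodes (I :\ i) i != 0 by rewrite nodes_neq0 // setD11.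
rewrite -[x t - x i]opprB; move: (x i - x t) (nodes _ i) (nodes _ t) => a b c b0 a0.
by field; rewrite ?a0 ?b0.
Qed.

Lemma interp0 I t : t \in I -> interp I t = 0.
Proof.
move=> tI; rewrite /interp (big_setD1 t) //= big1 ?addr0.
  by rewrite divfK ?subrr // nodes_neq0 // setD11.
move=> i /setD1P[it iI]; rewrite (nodes1 t (j := t)) ?subrr ?mul0r ?mulr0 //.
by rewrite in_setD1 eq_sym it.
Qed.

Let npoly J : {poly R} := \prod_(j in J) ('X - (x j)%:P).

Let npolyE J t : (npoly J).[x t] = nodes J t.
Proof. by rewrite horner_prod; apply: eq_bigr => j _; rewrite hornerXsubC. Qed.

Let size_npoly J : size (npoly J) = #|J|.+1.
Proof. by rewrite /npoly -big_enum size_prod_XsubC -cardE. Qed.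

Lemma ev_interp I : #|I| = d -> exists l, forall t, ev v t l = interp I t.
Proof.
move=> cI; have [|l lE] := @lift (- \sum_(i in I) (h i / nodes (I :\ i) i) *: npoly (I :\ i)) 1.
  rewrite size_polyN; apply: leq_trans (size_sum _ _ _) _; apply/bigmax_leqP => i iI.
  apply: leq_trans (size_scale_leq _ _) _.
  by rewrite size_npoly -cI (cardsD1 i I) iI.
exists l => t; rewrite lE hornerN horner_sum mul1r addrC; congr (_ - _).
by apply: eq_bigr => i _; rewrite hornerZ npolyE.
Qed.

Lemma ev_nodes J : (#|J| < d)%N -> exists l, forall t, ev v t l = nodes J t.
Proof.
move=> cJ; have [|l lE] := @lift (npoly J) 0; first by rewrite size_npoly.
by exists l => t; rewrite lE mul0r addr0 npolyE.
Qed.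

Lemma small_rk J : (#|J| <= d)%N -> rk v J = #|J|.
Proof.
have [k] := ubnP #|J|; elim: k J => // k IH J Jk Jd.
have [->|[t tJ]] := set_0Vmem J; first by rewrite rk0 cards0.
have cJ := cardsD1 t J; rewrite tJ in cJ.
have [|l lE] := @ev_nodes (J :\ t); first by move: #|J :\ t| cJ => q E; move: Jd; rewrite E; clear; lia.
rewrite -(setD1K tJ) (rk_add (l := l)) ?IH ?cardsU1 ?setD11 //; last first.
- by rewrite lE nodes_neq0 // setD11.
- by move=> s sJ; rewrite lE (nodes1 s sJ) subrr mul0r.
- by move: Jd; rewrite cJ; move: #|J :\ t| => q; clear; lia.
by move: Jk; rewrite cJ; move: #|J :\ t| => q; clear; lia.
Qed.

Lemma big_rk J : #|J| = d.+1 -> ~~ (J \subset F) -> rk v J = d.+1.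
Proof.
move=> cJ JF; have /subsetPn[t tJ tF] := JF.
have cI : #|J :\ t| = d by move: cJ; rewrite (cardsD1 t) tJ => -[].
have [l lE] := ev_interp cI.
rewrite -(setD1K tJ) (rk_add (l := l)) ?small_rk ?cI //.
  by move=> s sI; rewrite lE interp0.
rewrite lE interpE ?setD11 // setD1K // mulf_neq0 ?nodes_neq0 ?setD11 //.
by rewrite gt_eqF // divided_difference_gt0.
Qed.

Lemma heights_F : exists l, [/\ valid v setT l, zs v setT l = F & rk v F = d].
Proof.
have [|l lE] := @lift 0 (-1); first by rewrite size_poly0.
have {}lE t : ev v t l = - h t by rewrite lE horner0 add0r mulN1r.
have zF : zs v setT l = F.
  by apply/setP => t; rewrite inE in_setT lE oppr_eq0 hF.
exists l; split => //; first by move=> t _; rewrite lE oppr_le0.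
have [z zNF] := FT; apply/eqP; rewrite eqn_leq; apply/andP; split.
  rewrite -ltnS -(rk_add (v := v) (t := z) (A := F) (l := l)) ?lE ?oppr_eq0 ?hF //.
    exact: rank_leq_row.
  by move=> t; rewrite -{1}zF => /zsP[].
have [J JF cJ] : exists2 J : {set 'I_n}, J \subset F & #|J| = d.
  have /card_gt0P[J] : (0 < #|[set J : {set 'I_n} | J \subset F & #|J| == d]|)%N.
    by rewrite cards_draws bin_gt0.
  by rewrite inE => /andP[JF /eqP]; exists J.
by rewrite -{1}cJ -(small_rk (J := J)) ?cJ // rkS.
Qed.

Lemma heights_config : config v F setT /\ facet v setT F.
Proof.
have [l [vl lF rF]] := heights_F; have [z zF] := FT.
have full : rk v setT = d.+1.
  apply/eqP; rewrite eqn_leq rank_leq_row /= -{1}rF -(rk_add (v := v) (t := z) (A := F) (l := l)).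
  - by apply: rkS; apply: subsetT.
  - by move=> t; rewrite -{1}lF => /zsP[].
  by apply: contra zF => /eqP lz; rewrite -lF; apply/zsP; rewrite in_setT.
have fF : facet v setT F by exists l; rewrite full rF.
split => //; split => // G fG GF.
have rG := facet_rk full fG.
apply/eqP; rewrite eqn_leq -{2}rG rk_card andbT leqNgt; apply/negP => Gd.
have /subsetPn[t tG tF] : ~~ (G \subset F) by apply/negP => GF'; apply: GF; exact: (facet_inj fG fF).
have [J] : exists2 J : {set 'I_n}, J \subset G :\ t & #|J| = d.
  have /card_gt0P[J] : (0 < #|[set J : {set 'I_n} | J \subset G :\ t & #|J| == d]|)%N.
    by rewrite cards_draws bin_gt0; move: Gd; rewrite (cardsD1 t G) tG.
  by rewrite inE => /andP[JF /eqP]; exists J.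
rewrite subsetD1 => /andP[JG tJ] cJ.
have : (rk v (t |: J) <= rk v G)%N by apply: rkS; rewrite subUset sub1set tG.
rewrite big_rk ?rG ?ltnn //; first by rewrite cardsU1 tJ cJ.
by apply/subsetPn; exists t => //; rewrite setU11.
Qed.

Let full : rk v setT = d.+1. Proof. by case: heights_config => -[]. Qed.

(** As for cyclic polytopes: minus the square of the node polynomial of [K] has degree below [d] and
    vanishes exactly on [K]. *)
Lemma heights_face K : (#|K|.*2 < d)%N -> Dl (fs v setT F) K.
Proof.
move=> Kd; have [|l lE] := @lift (- (npoly K) ^+ 2) 0.
  rewrite size_polyN; apply: leq_trans (size_poly_exp_leq _ _) _.
  by rewrite size_npoly /= muln2.
have {}lE t : ev v t l = - (nodes K t) ^+ 2 by rewrite lE mul0r addr0 hornerN horner_exp npolyE.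
have zK : zs v setT l = K.
  apply/setP => t; rewrite inE in_setT lE oppr_eq0 sqrf_eq0 /=.
  apply/idP/idP => [|tK]; last by rewrite (nodes1 t tK) subrr mul0r.
  by apply: contraTT => /nodes_neq0.
have [|||G fG [zG GF]] := @ext_facet_neq _ _ _ v setT l F.
- by move=> t _; rewrite lE oppr_le0 sqr_ge0.
- apply: contrapT => hl; have : K = setT.
    apply/setP => t; rewrite in_setT -zK; apply/zsP; split; first exact: in_setT.
    by apply/eqP/negPn/negP => nz; apply: hl; exists t; rewrite ?in_setT.
  move=> KT; have := rk_card v K; rewrite {1}KT full; move: #|K| Kd => q; clear; lia.
- by rewrite zK full small_rk; move: #|K| Kd => q; clear; lia.
by apply/DlP; exists G; rewrite -?zK //; apply/fsP; split => //; exact/eqP.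
Qed.

(** The interpolation error at [I] is the node product times a positive divided difference, so
    Gale's condition makes [I] itself a facet. *)
Lemma heights_face_gale I K : #|I| = d -> K \subset I -> ~~ (K \subset F) ->
  (forall t, 0 <= nodes I t) -> Dl (fs v setT F) K.
Proof.
move=> cI KI KF Ige; have [l lE] := ev_interp cI.
have IF : ~~ (I \subset F) by apply: contra KF => IF; exact: subset_trans KI IF.
have dd t : t \notin I -> 0 < divided_difference (t |: I).
  move=> tI; apply: divided_difference_gt0; first by rewrite cardsU1 tI cI.
  by apply: contra IF => /subUsetP[].
have vl t : ev v t (- l) <= 0.
  rewrite /ev prNr -/(ev v t l) lE oppr_le0; have [tI|tI] := boolP (t \in I).
    by rewrite interp0.
  by rewrite interpE // mulr_ge0 // ltW // dd.
have zI : zs v setT (- l) = I.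
  apply/setP => t; rewrite inE in_setT /ev prNr -/(ev v t l) lE oppr_eq0 /=.
  have [tI|tI] := boolP (t \in I); first by rewrite interp0 // eqxx.
  by rewrite interpE // mulf_eq0 (negbTE (nodes_neq0 tI)) gt_eqF // dd.
apply/DlP; exists I => //; apply/fsP; split; last by apply: contraNnot IF => ->.
by exists (- l); rewrite small_rk ?cI // full; split.
Qed.

End Heights.

(* Gale's evenness condition: a union of pairs of neighbours and of full end segments. *)
Lemma gale_extension (n k : nat) (K : pred nat) : (k.*2 <= n)%N -> (\sum_(i < n) K i <= k)%N ->
  exists I : pred nat, [/\ forall i, (i < n)%N -> K i -> I i, (\sum_(i < n) I i = k.*2)%N &
    forall t, (t < n)%N -> (0 <= \prod_(i < n | I i) (t%:Z - i%:Z))%R].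
Proof.
have [N] := ubnP n; elim: N n k K => // N IH n k K nN kn Kk.
case: n => [|n] in nN kn Kk *.
  exists pred0; split => //; rewrite big_ord0.
  by move: kn; rewrite leqn0 => /eqP ->.
have [Kn|Kn] := boolP (K n); last first.
  move: Kk; rewrite big_ord_recr /= (negbTE Kn) addn0 => Kk.
  have [kn'|kn'] := leqP k.*2 n; last first.
    (* Here 2k equals the number of indices, so all are taken and every product contains a zero
       factor. *)
    exists predT; split => //.
      by rewrite sum1_card card_ord; apply/eqP; rewrite eqn_leq kn kn'.
    by move=> t tn; rewrite (bigD1 (Ordinal tn)) //= subrr mul0r.
  have [I [KI cI Ige]] := IH n k K nN kn' Kk.
  exists [pred i | I i && (i < n)%N]; split.
  - move=> i; rewrite ltnS leq_eqVlt => /orP[/eqP->|ltin Ki]; first by rewrite (negbTE Kn).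
    by rewrite /= ltin KI.
  - by rewrite big_ord_recr /= ltnn andbF addn0 -cI; apply: eq_bigr => i _; rewrite ltn_ord andbT.
  move=> t tn; rewrite big_mkcond big_ord_recr /= ltnn andbF mulr1 -big_mkcond /=.
  rewrite (eq_bigl (fun i : 'I_n => I i)) => [|i]; last by rewrite ltn_ord andbT.
  move: tn; rewrite ltnS leq_eqVlt => /orP[/eqP->|]; last exact: Ige.
  by apply: prodr_ge0 => i _; have := ltn_ord i; lia.
case: n => [|n] in nN kn Kk Kn *.
  by move: kn Kk; rewrite big_ord_recr big_ord0 /= Kn; lia.
case: k => [|k] in kn Kk *; first by move: Kk; rewrite big_ord_recr /= Kn; lia.
have [|||I [KI cI Ige]] := IH n k K; first lia.
- by move: kn; rewrite doubleS.
- by move: Kk; rewrite !big_ord_recr /= Kn; lia.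
(* The last index, which belongs to [K], is paired with its left neighbour; no integer lies strictly
   between them, so their two factors have nonnegative product. *)
exists [pred i | I i || (n <= i)%N]; split.
- move=> i _ Ki /=; have [//|ltin] := leqP n i; first by rewrite orbT.
  by rewrite KI.
- rewrite !big_ord_recr /= leqnn leqnSn !orbT -addnA addn2 doubleS -cI; congr _.+2.
  by apply: eq_bigr => i _; rewrite leqNgt ltn_ord orbF.
move=> t tn; rewrite big_mkcond !big_ord_recr /= leqnn leqnSn !orbT -big_mkcond /=.
rewrite (eq_bigl (fun i : 'I_n => I i)) => [|i]; last by rewrite leqNgt ltn_ord orbF.
have [tn'|tn'] := ltnP t n.
  rewrite -mulrA; apply: mulr_ge0; first exact: Ige.
  have -> : ((t%:Z - n%:Z) * (t%:Z - n.+1%:Z) = (n%:Z - t%:Z) * (n.+1%:Z - t%:Z))%R by ring.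
  by apply: mulr_ge0; lia.
have : t = n \/ t = n.+1 by lia.
by case=> ->; rewrite subrr ?mulr0 ?mul0r.
Qed.

Lemma big_ord_recr_pred (V : nmodType) d (f : nat -> V) : 0 < d ->
  (\sum_(j < d) f j = \sum_(j < d.-1) f j + f d.-1)%R.
Proof. by case: d => // d _; rewrite big_ord_recr. Qed.

Lemma big_ord_recl_pred (V : nmodType) d (f : nat -> V) : 0 < d ->
  (\sum_(j < d) f j = f 0 + \sum_(j < d.-1) f j.+1)%R.
Proof. by case: d => // d _; rewrite big_ord_recl. Qed.

(** * The defining points as nodes and heights *)

Section CyclicConfig.
Local Open Scope ring_scope.
Variables (R : realType) (d s n : nat).
Hypothesis d3 : (3 <= d)%N.
Hypothesis dn : (d + s + 1 <= n)%N.

Let y (i : 'I_n) := C_point R d n s (C_param d s i).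
Let x (i : 'I_n) : R := (C_param d s i)%:~R.
Let h (i : 'I_n) : R := C_height R d n s (C_param d s i).
Let v : 'I_n -> 'rV[R]_d.+1 := hv y.
Let F : {set 'I_n} := [set i : 'I_n | (i < d + s)%N].

(** The height of the point with index [d + s + b], whose parameter is [b + 1]; points of smaller
    index have height zero and form [F]. *)
Let P b := (n.-1 ^ (b * d.-1) * \prod_(j < d + s) (b + 1 + j))%N.

Lemma C_polytopeE : C_polytope R d n s = hull y setT.
Proof.
rewrite /C_polytope /hull; congr convex_hull; apply/seteqP; split => z /=.
  by move=> [i _ <-]; exists i; rewrite ?in_setT.
by move=> [i _ ->]; exists i.
Qed.

Let xB i j : x i - x j = i%:R - j%:R.
Proof.
rewrite /x -rmorphB /= [X in X%:~R](_ : _ = i%:Z - j%:Z); last by rewrite /C_param; lia.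
by rewrite rmorphB.
Qed.

Let h0F i : i \in F -> h i = 0.
Proof.
rewrite inE => iF; rewrite /h /C_height.
have j0 : (d + s - i.+1 < d + s)%N by lia.
rewrite (bigD1 (Ordinal j0)) //= [X in X%:~R](_ : _ = 0) ?mul0r ?mulr0 //.
by rewrite /C_param; lia.
Qed.

Let hN i : i \notin F -> h i = (P (i - (d + s)))%:R.
Proof.
rewrite inE -leqNgt => iF; rewrite /h /C_height natrM natrX natr_prod; congr (_ * _).
  rewrite [X in _ ^ X](_ : _ = ((i - (d + s)) * d.-1)%N :> int) //.
  by rewrite /C_param PoszM; congr (_ * _); lia.
apply: eq_bigr => j _; rewrite pmulrn; congr _%:~R.
by rewrite /C_param; lia.
Qed.

Let cF : #|F| = (d + s)%N.
Proof.
have le : (d + s <= n)%N by lia.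
have <- : #|[set widen_ord le i | i : 'I_(d + s)]| = (d + s)%N.
  by rewrite card_imset ?card_ord // => i j /(congr1 val) /= ij; apply: val_inj.
apply: eq_card => i; rewrite inE; apply/idP/imsetP => [iF|[j _ ->]]; last exact: (ltn_ord j).
by exists (Ordinal iF) => //; apply: val_inj.
Qed.

(** By [step], the quotient of P(a+1) by (n-1)^(d-1) P(a) is 1 + (d+s)/(a+1). The excess over 1 pays
    for all earlier terms because a+1 <= n-1 <= (n-1)^(d-1). *)
Let growth_nat a : (a <= n.-1)%N ->
  (n.-1 ^ d.-1 * \sum_(b < a) P b < P a)%N.
Proof.
move=> an; have n1 : (0 < n.-1)%N by lia.
have P0 b : (0 < P b)%N.
  rewrite muln_gt0 expn_gt0 n1 /=; apply: prodn_gt0 => j; by rewrite -addnA addnS.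
have step b : (P b.+1 * b.+1 = n.-1 ^ d.-1 * P b * (b.+1 + (d + s)))%N.
  have prodE q : (\prod_(j < q) (b.+1 + 1 + j) * b.+1 = \prod_(j < q) (b + 1 + j) * (b.+1 + q))%N.
    elim: q => [|q IH]; first by rewrite !big_ord0 addn0.
    by rewrite !big_ord_recr /= mulnAC IH -!mulnA; congr (_ * _)%N; lia.
  by rewrite /P mulSn expnD -!mulnA prodE.
elim: a an => [|a IH] an; first by rewrite big_ord0 muln0.
rewrite big_ord_recr /= mulnDr; have {}IH := IH (ltnW an).
have E := step a.
have le : (a.+1 <= n.-1 ^ d.-1)%N.
  apply: leq_trans an _; rewrite -{1}(expn1 n.-1); apply: leq_pexp2l => //; lia.
have Pa := P0 a; move: (P a) (P a.+1) (n.-1 ^ d.-1)%N (\sum_(b < a) P b)%N E IH Pa le => p p' Q S E IH p0 le.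
have dpos : (0 < d + s)%N by lia.
rewrite -(ltn_pmul2r (ltn0Sn a)) E; move: (d + s)%N dpos => e e0.
apply: (@leq_trans ((p + Q * p) * a.+1)); last by nia.
by rewrite ltn_pmul2r // ltn_add2r.
Qed.

Let growth z : z \notin F -> n.-1%:R ^+ d.-1 * (\sum_(i : 'I_n | (i < z)%N) h i) < h z.
Proof.
move=> zF; have zF' : (d + s <= z)%N by move: zF; rewrite inE -leqNgt.
pose g k := if (k < d + s)%N then 0%N else P (k - (d + s)).
have hg i : h i = (g i)%:R.
  by rewrite /g; have [iF|iF] := ltnP i (d + s); [rewrite h0F|rewrite hN] => //; rewrite inE // -leqNgt.
have -> : \sum_(i : 'I_n | (i < z)%N) h i = (\sum_(b < z - (d + s)) P b)%N%:R.
  rewrite (eq_bigr (fun i : 'I_n => (g i)%:R)) => [|i _]; last exact: hg.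
  rewrite -natr_sum -(big_ord_widen n g (ltnW (ltn_ord z))) -(big_mkord predT g).
  rewrite (big_cat_nat (n := d + s)) //= [X in (X + _)%N]big_nat [X in (X + _)%N]big1 ?add0n; last first.
    by move=> k /andP[_ kd]; rewrite /g kd.
  rewrite -{1}[(d + s)%N]add0n big_addn -(big_mkord predT P); congr _%:R.
  by apply: eq_bigr => k _; rewrite /g ltnNge leq_addl /= addnK.
by rewrite -natrX -natrM hN // ltr_nat; apply: growth_nat; have := ltn_ord z; lia.
Qed.

Let lift (q : {poly R}) (c : R) : (size q <= d)%N ->
  exists l, forall i, ev v i l = q.[x i] + c * h i.
Proof.
move=> qd; have d0 : (0 < d)%N by lia.
exists (cof (\row_(j < d) if (j.+1 < d)%N then q`_j.+1 else c) (- q`_0)) => i.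
rewrite /ev /v /hv pr_cof opprK /dot (horner_coef_wide _ qd).
rewrite (big_ord_recl_pred (fun j => q`_j * x i ^+ j) d0) expr0 mulr1 -[RHS]addrA [RHS]addrC; congr (_ + _).
rewrite (eq_bigr (fun j : 'I_d => if (j.+1 < d)%N then x i ^+ j.+1 * q`_j.+1 else h i * c)) => [|j _].
  rewrite (big_ord_recr_pred (fun j => if (j.+1 < d)%N then x i ^+ j.+1 * q`_j.+1 else h i * c) d0).
  rewrite prednK // ltnn mulrC; congr (_ + _).
  apply: eq_bigr => j _; have jd : (j.+1 < d)%N by have := ltn_ord j; lia.
  by rewrite jd mulrC.
by rewrite !mxE; case: ifP => _; rewrite mulrC.
Qed.

Let M : R := n.-1%:R.

Let ndiff (i j : 'I_n) : (j < i)%N -> x i - x j = (i - j)%N%:R.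
Proof. by move=> ji; rewrite xB natrB // ltnW. Qed.

Let hF i : (h i == 0) = (i \in F).
Proof.
have [iF|iF] := boolP (i \in F); first by rewrite h0F // eqxx.
rewrite hN // pnatr_eq0; apply/negbTE; rewrite -lt0n muln_gt0 expn_gt0.
apply/andP; split; first by rewrite (_ : (0 < n.-1)%N) //; lia.
by apply: prodn_gt0 => j; rewrite -addnA addnS.
Qed.

Let h0 i : 0 <= h i.
Proof. by have [iF|iF] := boolP (i \in F); [rewrite h0F|rewrite hN]. Qed.

Let gap1 (i j : 'I_n) : (j < i)%N -> 1 <= x i - x j.
Proof. by move=> ji; rewrite ndiff // ler1n subn_gt0. Qed.

Let gapM (i j : 'I_n) : (j < i)%N -> x i - x j <= M.
Proof. by move=> ji; rewrite ndiff // ler_nat; have := ltn_ord i; lia. Qed.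

Let Flow (i j : 'I_n) : (i <= j)%N -> j \in F -> i \in F.
Proof. by rewrite !inE; exact: leq_ltn_trans. Qed.

Let dF : (d <= #|F|)%N. Proof. by rewrite cF leq_addr. Qed.

Let FT : exists z, z \notin F.
Proof.
have ln : (n.-1 < n)%N by lia.
by exists (Ordinal ln); rewrite inE -leqNgt /=; lia.
Qed.

Let d0 : (0 < d)%N. Proof. by lia. Qed.

Let cfg := heights_config d0 h0 hF Flow dF FT gap1 gapM growth lift.

Lemma cyclic_face (K : {set 'I_n}) : (#|K|.*2 <= d)%N -> (#|K|.*2 < d)%N || ~~ (K \subset F) ->
  Dl (fs v setT F) K.
Proof.
move=> Kd; have [Kl _|dl /= KF] := ltnP #|K|.*2 d.
  exact: (heights_face d0 h0 hF Flow dF FT gap1 gapM growth lift).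
have dE : d = #|K|.*2 by apply/eqP; rewrite eqn_leq Kd dl.
pose K' k := [exists i in K, k == val i].
have KK' (i : 'I_n) : K' i = (i \in K).
  apply/existsP/idP => [[j /andP[jK /eqP/val_inj->]]//|iK].
  by exists i; rewrite iK eqxx.
have cs (Q : pred nat) (A : {set 'I_n}) : (forall i : 'I_n, Q i = (i \in A)) ->
    (\sum_(i < n) Q i = #|A|)%N.
  move=> QA; rewrite -sum1_card [RHS]big_mkcond; apply: eq_bigr => i _ /=.
  by rewrite QA; case: (i \in A).
have [||I [KI cI Ige]] := @gale_extension n #|K| K'.
- rewrite -dE; lia.
- by rewrite (cs _ K).
apply: (heights_face_gale d0 h0 hF Flow dF FT gap1 gapM growth lift (I := [set i : 'I_n | I i])) => //.
- by rewrite [RHS]dE -cI (cs _ [set i : 'I_n | I i]) // => i; rewrite inE.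
- by apply/subsetP => i iK; rewrite inE KI // KK'.
move=> t; have := Ige t (ltn_ord t); rewrite -(ler0z R) rmorph_prod /= => le0.
rewrite [X in 0 <= X](_ : _ = \prod_(i < n | I i) (t%:Z - i%:Z)%:~R) //.
apply: eq_big => [i|i _]; first by rewrite inE.
by rewrite xB rmorphB.
Qed.

Lemma cyclic_config : exists (v' : 'I_n -> 'rV[R]_d.+1) (F' : {set 'I_n}),
  [/\ C_polytope R d n s = hull y setT, same_faces (hv y) v', config v' F' setT & facet v' setT F'] /\
  [/\ #|F'| = (d + s)%N, forall j, (j.*2 < d)%N -> #|faces (fs v' setT F') set0 j| = 'C(n, j) &
    forall j, (j.*2 <= d)%N -> (#|ifaces (fs v' setT F') F' set0 j| + 'C(d + s, j) = 'C(n, j))%N].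
Proof.
exists v, F; have [c fF] := cfg; split; split => //.
- exact: C_polytopeE.
- by split => // l; exists l.
- move=> j jd; rewrite -[X in 'C(X, _)]card_ord -card_draws; apply: eq_card => A; rewrite inE.
  apply/idP/eqP => [/facesP[_ _]|cA]; first by rewrite cards0.
  by apply/facesP; rewrite sub0set cards0 cA; split => //; apply: cyclic_face; rewrite cA ?jd // ltnW.
move=> j jd; rewrite -cF -cards_draws -[X in _ = 'C(X, _)]card_ord -card_draws.
rewrite -[RHS](cardsID [set A : {set 'I_n} | A \subset F]) [RHS]addnC; congr (_ + _)%N.
  apply: eq_card => A; rewrite !inE; apply/andP/andP => [[fA AF]|[AF /eqP cA]].
    by move: fA; rewrite AF cards0 => /and3P[_ _ ->].
  by split => //; rewrite sub0set cards0 cA eqxx !andbT; apply: cyclic_face; rewrite cA // AF orbT.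
by apply: eq_card => A; rewrite !inE andbC.
Qed.

End CyclicConfig.

(** * Pyramids and stacking *)

Section OptionConfig.
Local Open Scope ring_scope.
Variables (R : realFieldType) (N : nat) (T : finType) (v : T -> 'rV[R]_N) (x : 'rV[R]_N).
Implicit Types (A G H : {set T}) (B : {set option T}) (t u : T) (l k : 'cV[R]_N).

Definition oconf (o : option T) : 'rV[R]_N := if o is Some t then v t else x.
Definition olift A : {set option T} := Some @: A.
Definition oproj B : {set T} := [set t | Some t \in B].
Local Notation v' := oconf.

Lemma mem_olift A t : (Some t \in olift A) = (t \in A).
Proof. by rewrite mem_imset // => ? ? []. Qed.

Lemma None_olift A : None \notin olift A.
Proof. by apply/negP => /imsetP[]. Qed.

Lemma card_olift A : #|olift A| = #|A|.
Proof. by apply: card_imset => ? ? []. Qed.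

Lemma oprojK B : None \notin B -> olift (oproj B) = B.
Proof.
move=> NB; apply/setP => -[t|]; first by rewrite mem_olift inE.
by rewrite (negbTE NB) (negbTE (None_olift _)).
Qed.

Lemma oprojU B : None \in B -> None |: olift (oproj B) = B.
Proof.
move=> NB; apply/setP => -[t|]; first by rewrite in_setU1 mem_olift inE.
by rewrite setU11 NB.
Qed.

Lemma olift_sub A H : (olift A \subset olift H) = (A \subset H).
Proof.
apply/idP/idP => [/subsetP AH|AH]; last exact: imsetS.
by apply/subsetP => t tA; rewrite -mem_olift AH // mem_olift.
Qed.

Lemma rk_olift A : rk v' (olift A) = rk v A.
Proof.
apply: eq_span_rk => [o /imsetP[t tA ->] /=|t tA]; first exact: mem_spanm.
by apply: (mem_spanm v' (t := Some t)); rewrite mem_olift.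
Qed.

Lemma span_vanish A l (y : 'rV_N) : (y <= spanm v A)%MS -> (forall t, t \in A -> ev v t l = 0) ->
  pr y l = 0.
Proof.
move=> /mem_spanmP[c ->] l0; rewrite pr_suml big1 // => t /l0 h.
by rewrite prZl -/(ev v t l) h mulr0.
Qed.

Lemma zs_oconf l : zs v setT l = oproj (zs v' setT l).
Proof. by apply/setP => t; rewrite !inE. Qed.

Lemma valid_oconf l : valid v' setT l <-> valid v setT l /\ pr x l <= 0.
Proof.
split=> [h|[h hx] [t|] _]; [|exact: h|exact: hx].
by split=> [t _|]; [apply: (h (Some t))|apply: (h None)]; rewrite in_setT.
Qed.

(** Supporting functionals of a facet are positively proportional on the span, so the side on which
    a point lies does not depend on the functional chosen. *)
Lemma facet_functional G l k (y : 'rV_N) : (rk v G).+1 = rk v setT ->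
  valid v setT l -> zs v setT l = G -> valid v setT k -> zs v setT k = G -> (y <= spanm v setT)%MS ->
  exists2 c, 0 < c & pr y k = c * pr y l.
Proof.
move=> rG vl lG vk kG yS; have [t _ tl] := facet_nz lG rG.
have tG : t \notin G by rewrite -lG; apply/negP => /zsP[_ h]; rewrite h eqxx in tl.
have neg m : valid v setT m -> zs v setT m = G -> ev v t m < 0.
  move=> vm mG; rewrite lt_neqAle vm ?in_setT // andbT; apply: contra tG => /eqP h.
  by rewrite -mG; apply/zsP; rewrite in_setT.
have tl0 := neg l vl lG; have tk0 := neg k vk kG.
exists (ev v t k / ev v t l); first by rewrite -divrNN divr_gt0 // oppr_gt0.
set c := _ / _; apply/eqP; rewrite -subr_eq0; apply/eqP.
have E z : pr z k - c * pr z l = pr z (k - c *: l) by rewrite !prE.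
have G0 m s : zs v setT m = G -> s \in G -> ev v s m = 0 by move=> <- /zsP[].
rewrite E; apply: span_vanish yS _; apply: (@vanish_rk _ _ _ _ (t |: G)) => //.
  by rewrite (rk_add (l := l)) ?rG // => s; apply: G0.
move=> s /setU1P[->|sG]; rewrite /ev -E -!/(ev v _ _); first by rewrite divfK ?subrr // lt_eqF.
by rewrite !(G0 _ s) // mulr0 subrr.
Qed.

End OptionConfig.

(* [F] need not be a facet: for [F = setT] all facets are simplices. *)
Definition almost_simplicial_points (R : realFieldType) (N : nat) (T : finType) (v : T -> 'rV[R]_N)
    (r : nat) (F : {set T}) :=
  [/\ rk v setT = r.+1, forall G, facet v setT G -> G <> F -> #|G| = r &
      forall t, faceset v setT [set t]].

(** * Facets and edges after one stacking *)

Section Stack.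
Local Open Scope ring_scope.
Variables (R : realFieldType) (N : nat) (T : finType) (v : T -> 'rV[R]_N) (x : 'rV[R]_N).
Variables (r : nat) (F G0 : {set T}) (l0 : 'cV[R]_N).
Implicit Types (A G H : {set T}) (B : {set option T}) (t u : T) (l k : 'cV[R]_N).
Local Notation v' := (oconf v x).
Local Notation fs' := (fs v' setT (olift F)).
Local Notation fs := (fs v setT F).
Hypothesis r2 : (2 <= r)%N.
Hypothesis asp : almost_simplicial_points v r F.
Hypothesis xS : (x <= spanm v setT)%MS.
Hypothesis G0f : G0 \in fs.
Hypothesis vl0 : valid v setT l0.
Hypothesis l0G : zs v setT l0 = G0.
Hypothesis l0x : 0 < pr x l0.
Hypothesis below : forall G, facet v setT G -> G <> G0 ->
  exists l, [/\ valid v setT l, zs v setT l = G & pr x l < 0].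
Hypothesis exposed : faceset v' setT [set None].

Let rT : rk v setT = r.+1. Proof. by case: asp. Qed.
Let simp G : facet v setT G -> G <> F -> #|G| = r. Proof. by case: asp => _ h _; exact: h. Qed.
Let fG0 : facet v setT G0. Proof. by case/fsP: G0f. Qed.
Let rG G : facet v setT G -> rk v G = r. Proof. by case=> l [_ _]; rewrite rT => -[]. Qed.
Let cG0 : #|G0| = r. Proof. by case/fsP: G0f => fG GF; apply: simp. Qed.
Let iG0 : rk v G0 = #|G0|. Proof. by rewrite cG0 rG. Qed.

Let rT' : rk v' setT = r.+1.
Proof.
rewrite -rT; apply: eq_span_rk => [[t|] _|t _] //=; first by apply: (mem_spanm v (t := t)); rewrite in_setT.
exact: (mem_spanm v' (t := Some t) (in_setT _)).
Qed.

Let neg G l : facet v setT G -> G <> G0 -> valid v setT l -> zs v setT l = G -> pr x l < 0.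
Proof.
move=> fG GG0 vl lG; have [k [vk kG xk]] := below fG GG0.
have [|c c0 ->] := facet_functional _ vk kG vl lG xS; first by rewrite rG // rT.
by rewrite pmulr_rlt0.
Qed.

Let pos l : valid v setT l -> zs v setT l = G0 -> 0 < pr x l.
Proof.
move=> vl lG; have [|c c0 ->] := facet_functional _ vl0 l0G vl lG xS; first by rewrite rG // rT.
by rewrite mulr_gt0.
Qed.

Lemma stack_old_facet G : facet v setT G -> G <> G0 -> facet v' setT (olift G).
Proof.
move=> fG GG0; have [l [vl lG rl]] := fG; have lx := neg fG GG0 vl lG.
exists l; split; last by rewrite rk_olift rG // rT'.
  by apply/valid_oconf; split => //; exact: ltW.
apply/setP => -[t|]; last first.
  by rewrite (negbTE (None_olift G)); apply/zsP => -[_]; rewrite /ev /= => /eqP; rewrite lt_eqF.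
by rewrite mem_olift -lG !inE.
Qed.

(** [H] is not a facet, since no facet functional vanishes at [x]. If [H] were not inside [G0],
    rotating [k] about a facet through [H] would give a second facet, different from [G0], whose
    functional is nonnegative at [x]. So [H] is a ridge inside the simplex [G0]. *)
Let new_ridge H k : valid v setT k -> zs v setT k = H -> pr x k = 0 -> (r <= (rk v H).+1)%N ->
  (exists2 t, t \in [set: T] & ev v t k != 0) -> exists2 u, u \in G0 & H = G0 :\ u.
Proof.
move=> vk kH xk rH knz.
have notfacet : rk v H != r.
  apply/negP => /eqP rHr; have fH : facet v setT H by exists k; rewrite rHr rT.
  have [HG|HG] := eqVneq H G0; first by have := pos vk (etrans kH HG); rewrite xk ltxx.
  by have := neg fH (fun E => negP HG (introT eqP E)) vk kH; rewrite xk ltxx.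
have HG0 : H \subset G0.
  apply/negPn/negP => /subsetPn[t0 t0H t0G].
  have neqG G : H \subset G -> G <> G0 by move=> HG E; rewrite -E (subsetP HG) in t0G.
  have [G fG] := ext_facet vk knz; rewrite kH => HG.
  have [l [vl lG rlG]] := fG; have lx := neg fG (neqG G HG) vl lG.
  have lz t : t \in H -> ev v t l = 0 by move/(subsetP HG); rewrite -lG => /zsP[].
  have [k1 [vk1 ev1 [c [c0 k1E]] [t1 _ [t1l t1k]]]] := swap vk vl (facet_nz lG rlG).
  have /subsetPn[g gG gH] : ~~ (G \subset H).
    by apply: contra notfacet => GH; rewrite eqn_leq -{2}(rG fG) rkS // andbT -(rG fG) rkS.
  have k1g : ev v g k1 != 0.
    rewrite ev1; last by move: gG; rewrite -lG => /zsP[].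
    by apply: contra gH => /eqP h; rewrite -kH; apply/zsP; rewrite in_setT.
  have Hk1 : t1 |: H \subset zs v setT k1.
    apply/subsetP => s /setU1P[->|sH]; apply/zsP; rewrite in_setT //; split => //.
    by rewrite ev1 ?lz //; move: sH; rewrite -kH => /zsP[].
  have rk1 : rk v (zs v setT k1) = r.
    apply/eqP; rewrite eqn_leq -ltnS -rT zs_rk; last by exists g; rewrite ?in_setT.
    by apply: leq_trans rH _; rewrite -(rk_add lz t1l) rkS.
  have fk1 : facet v setT (zs v setT k1) by exists k1; rewrite rk1 rT.
  have HZ : H \subset zs v setT k1 by apply: subset_trans Hk1; apply: subsetUr.
  have := neg fk1 (neqG _ HZ) vk1 erefl.
  have -> : pr x k1 = - (c * pr x l) by rewrite k1E !prE xk add0r.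
  by rewrite oppr_lt0 ltNge mulr_ge0_le0 // ltW.
have cH : (#|G0 :\: H| = 1)%N.
  have iH := indepS iG0 HG0; rewrite cardsD (setIidPr HG0) cG0; move: notfacet rH.
  have := subset_leq_card HG0; rewrite iH cG0; lia.
have /cards1P[u uE] := introT eqP cH; exists u.
  by have /setDP[] : u \in G0 :\: H by rewrite uE set11.
by rewrite -uE setDDr setDv set0U (setIidPr HG0).
Qed.

Lemma stack_facets B : facet v' setT B ->
  (exists G, [/\ facet v setT G, G <> G0 & B = olift G]) \/
  (exists2 u, u \in G0 & B = None |: olift (G0 :\ u)).
Proof.
move=> [k [/valid_oconf[vk xk] kB rB]]; have rkB : rk v' B = r by move: rB; rewrite rT' => -[].
have kH : zs v setT k = oproj B by rewrite (zs_oconf v x) kB.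
have [NB|NB] := boolP (None \in B); last first.
  left; exists (oproj B); rewrite oprojK //.
  have rH : rk v (oproj B) = r by rewrite -(rk_olift v x) oprojK.
  split => //; first by exists k; rewrite rH rT.
  by move=> E; have := pos vk (etrans kH E); rewrite ltNge xk.
have xk0 : pr x k = 0 by move: NB; rewrite -kB => /zsP[].
right; have [||u uG uE] := new_ridge vk kH xk0; last by exists u; rewrite // -uE oprojU.
  by rewrite -rkB -{1}(oprojU NB) -(rk_olift v x); apply: rkU1_le.
have [[t|] _ tk] := facet_nz kB rB; first by exists t; rewrite ?in_setT.
by rewrite /ev /= xk0 eqxx in tk.
Qed.

Lemma stack_asp : almost_simplicial_points v' r (olift F).
Proof.
split => [//|B fB BF|[t|]]; last exact: exposed.
  have [[G [fG _ BE]]|[u uG ->]] := stack_facets fB.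
    by rewrite BE card_olift; apply: simp => // GF; apply: BF; rewrite BE GF.
  by rewrite cardsU1 None_olift card_olift -cG0 (cardsD1 u G0) uG.
have [_ _ /(_ t)[l vl lt]] := asp.
have tnz : exists2 u, u \in [set: T] & ev v u l != 0.
  apply: contrapT => h; have E : [set t] = setT.
    apply/setP => u; rewrite in_setT -lt; apply/zsP; rewrite in_setT; split => //.
    by apply/eqP/negPn/negP => nz; apply: h; exists u; rewrite ?in_setT.
  by have := rk_card v [set t]; rewrite {1}E rT cards1 ltnS leqNgt ltnW.
(* An old vertex stays exposed: a facet through it other than [G0] has [x] beneath it, and a large
   multiple of its functional makes the new point negative. *)
have [|H fH [tH /eqP HG]] := @ext_facet_neq _ _ _ v setT l G0 vl tnz.
  by rewrite lt rT ltnS; apply: leq_ltn_trans (rk_card _ _) _; rewrite cards1.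
have [k [vk kH xk]] := below fH HG.
have tk : ev v t k = 0 by have /zsP[] : t \in zs v setT k by rewrite kH (subsetP tH) // lt set11.
have tl : ev v t l = 0 by have /zsP[] : t \in zs v setT l by rewrite lt set11.
have [c c0 hc] := large_mult [set: option T] (fun o => ev v' o l) (fun o => ev v' o k).
have E o : ev v' o (l + c *: k) = ev v' o l + c * ev v' o k by rewrite /ev !prE.
have En o : o != Some t -> ev v' o (l + c *: k) < 0.
  rewrite E; case: o => [u ut|_]; last by apply: hc; rewrite ?in_setT.
  have [uk|uk] := eqVneq (ev v u k) 0; last first.
    by apply: hc; rewrite ?in_setT // lt_neqAle uk vk ?in_setT.
  rewrite /ev /= -!/(ev v _ _) uk mulr0 addr0 lt_neqAle vl ?in_setT // andbT.
  apply: contra ut => /eqP ul; have : u \in zs v setT l by apply/zsP; rewrite in_setT.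
  by rewrite lt => /set1P->.
have Et : ev v' (Some t) (l + c *: k) = 0 by rewrite E /ev /= -!/(ev v _ _) tl tk mulr0 addr0.
exists (l + c *: k).
  by move=> o _; have [->|/En/ltW//] := eqVneq o (Some t); rewrite Et.
apply/setP => o; apply/zsP/set1P => [[_ ol]|->]; last by rewrite in_setT.
by apply/eqP; apply: contraT => /En; rewrite ol ltxx.
Qed.

Lemma stack_facet : facet v setT F -> facet v' setT (olift F).
Proof. by move=> fF; apply: stack_old_facet => // E; have [_] := fsP _ _ _ _ G0f; rewrite E. Qed.

Let new_edge (e : {set option T}) : e \in faces fs' set0 2 ->
  (exists2 e0, e0 \in faces fs set0 2 & e = olift e0) \/
  (exists2 g, g \in G0 & e = [set None; Some g]).
Proof.
move=> /facesP[/DlP[B /fsP[fB BF] eB] _]; rewrite cards0 add0n => e2.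
have old (G e0 : {set T}) : G \in fs -> e0 \subset G -> e = olift e0 ->
    exists2 e1, e1 \in faces fs set0 2 & e = olift e1.
  move=> Gf eG eE; exists e0 => //; apply/facesP; rewrite sub0set cards0 -e2 eE card_olift.
  by split => //; apply/DlP; exists G.
have [[G [fG GG0 BE]]|[u uG BE]] := stack_facets fB.
  left; have Ne : None \notin e by apply: contra (None_olift G) => /(subsetP eB); rewrite BE.
  apply: (old G (oproj e)); rewrite ?oprojK //; last by rewrite -(olift_sub (T := T)) oprojK // -BE.
  by apply/fsP; split => // GF; apply: BF; rewrite BE GF.
have [Ne|Ne] := boolP (None \in e).
  right; have := e2; rewrite (cardsD1 None) Ne => -[/eqP/cards1P[o oE]].
  have /setD1P[oN oe] : o \in e :\ None by rewrite oE set11.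
  have := subsetP eB o oe; case: o oE oN {oe} => // g oE _; rewrite BE in_setU1 mem_olift => /= /setD1P[_ gG].
  by exists g => //; rewrite -(setD1K Ne) oE.
left; apply: (old G0 (oproj e)); rewrite ?oprojK //.
apply/subsetP => t; rewrite inE => /(subsetP eB).
by rewrite BE in_setU1 mem_olift /= => /setD1P[].
Qed.

(** By [stack_facets] a new edge joins the new vertex to one of the [r] vertices of [G0]. Only this
    inequality is recorded, the reverse one being part of the general lower bound. *)
Lemma stack_ifaces : (#|ifaces fs' (olift F) set0 2| <= #|ifaces fs F set0 2| + r)%N.
Proof.
rewrite -cG0; apply: leq_trans (leq_add (leq_imset_card (@olift T) _)
  (leq_imset_card (fun g : T => [set None; Some g]) (mem G0))).
apply: leq_trans (leq_card_setU _ _); apply: subset_leq_card; apply/subsetP => e.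
rewrite inE => /andP[/new_edge[[e0 e0f ->]|[g gG ->]] eF]; apply/setUP; [left|right].
  by apply: imset_f; rewrite inE e0f; move: eF; rewrite olift_sub.
exact: imset_f.
Qed.

Lemma stack_bfaces : (#|bfaces fs' (olift F) set0 2| <= #|bfaces fs F set0 2|)%N.
Proof.
apply: leq_trans (leq_imset_card (@olift T) (mem (bfaces fs F set0 2))); apply: subset_leq_card; apply/subsetP => e.
rewrite inE => /andP[/new_edge[[e0 e0f ->]|[g gG ->]] eF].
  by apply: imset_f; rewrite inE e0f; move: eF; rewrite olift_sub.
by have := subsetP eF None; rewrite !inE => /(_ isT); rewrite (negbTE (None_olift F)).
Qed.

End Stack.

Section Pyramid.
Local Open Scope ring_scope.
Variables (R : realFieldType) (N : nat) (T : finType) (v : T -> 'rV[R]_N) (x : 'rV[R]_N) (r : nat).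
Local Notation v' := (oconf v x).
Local Notation fs' := (fs v' setT (olift setT)).
Local Notation fs := (fs v setT setT).
Hypothesis asp : almost_simplicial_points v r setT.
Hypothesis xS : ~~ (x <= spanm v setT)%MS.
Hypothesis exposed : faceset v' setT [set None].

Let rT : rk v setT = r.+1. Proof. by case: asp. Qed.

Let height : exists m, (forall t, ev v t m = 0) /\ pr x m = -1.
Proof.
have [l l0 lx] := sepfun xS; exists (- (pr x l)^-1 *: l); split=> [t|].
  by rewrite /ev !prE -/(ev v t l) l0 ?in_setT // mulr0.
by rewrite !prE mulNr mulVf.
Qed.

Let setTE : [set: option T] = None |: olift [set: T].
Proof. by apply/setP => -[t|]; rewrite in_setT in_setU1 // mem_olift in_setT. Qed.

Let rkN H : rk v' (None |: olift H) = (rk v H).+1.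
Proof.
have [m [m0 mx]] := height; rewrite (rk_add (l := m)) ?rk_olift //.
  by move=> o /imsetP[t _ ->]; apply: m0.
by rewrite /ev /= mx oppr_eq0 oner_eq0.
Qed.

Let rT' : rk v' setT = r.+2. Proof. by rewrite setTE rkN rT. Qed.

Lemma apex_facet : facet v' setT (olift setT).
Proof.
have [m [m0 mx]] := height; exists m; split; last by rewrite rk_olift rT rT'.
  by apply/valid_oconf; split=> [t _|]; rewrite ?m0 // mx lerN10.
apply/setP => -[t|]; first by rewrite mem_olift in_setT; apply/zsP; rewrite in_setT; split => //; apply: m0.
rewrite (negbTE (None_olift _)); apply/zsP => -[_]; rewrite /ev /= mx => /eqP.
by rewrite oppr_eq0 oner_eq0.
Qed.

Lemma apex_facets B : facet v' setT B -> B <> olift setT ->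
  exists2 H, facet v setT H & B = None |: olift H.
Proof.
move=> fB BF; have NB : None \in B.
  apply: contraT => NB; case: BF; apply: (facet_inj fB apex_facet).
  by rewrite -(oprojK NB) olift_sub; apply: finset.subsetT.
exists (oproj B); last by rewrite oprojU.
have [k [/valid_oconf[vk xk] kB rB]] := fB; exists k; split => //; first by rewrite (zs_oconf v x) kB.
by apply/eqP; rewrite rT -rkN oprojU // -eqSS rB rT'.
Qed.

Lemma pyramid_asp : almost_simplicial_points v' r.+1 (olift setT).
Proof.
have [_ simp cp] := asp; split=> [//|B fB BF|[t|]]; last exact: exposed.
  have [H fH ->] := apex_facets fB BF.
  rewrite cardsU1 None_olift card_olift (simp H) // => HT.
  by have [l [_ _]] := fH; rewrite HT => /esym/n_Sn.
have [m [m0 mx]] := height; have [l vl lt] := cp t.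
pose l' := l + (pr x l + 1) *: m.
have lT u : ev v' (Some u) l' = ev v u l.
  by rewrite /ev /= !prE -!/(ev v _ _) m0 mulr0 addr0.
have lN : ev v' None l' = -1 by rewrite /ev /= !prE mx; ring.
exists l'; first by move=> [u|] _; rewrite ?lT ?lN ?lerN10 // vl ?in_setT.
apply/setP => -[u|]; last first.
  by apply/zsP/set1P => // -[_]; rewrite lN => /eqP; rewrite oppr_eq0 oner_eq0.
have : (u \in zs v setT l) = (u == t) by rewrite lt in_set1.
by rewrite !inE lT => ->.
Qed.

Let new_edge (e : {set option T}) : e \in faces fs' set0 2 ->
  (exists2 e0, e0 \in faces fs set0 2 & e = olift e0) \/
  (exists2 g, g \in [set: T] & e = [set None; Some g]).
Proof.
move=> /facesP[/DlP[B /fsP[fB BF] eB] _]; rewrite cards0 add0n => e2.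
have [H fH BE] := apex_facets fB BF.
have [Ne|Ne] := boolP (None \in e).
  right; have := e2; rewrite (cardsD1 None) Ne => -[/eqP/cards1P[o oE]].
  have /setD1P[oN oe] : o \in e :\ None by rewrite oE set11.
  by case: o oE oN {oe} => // g oE _; exists g; rewrite ?in_setT // -(setD1K Ne) oE.
left; exists (oproj e); last by rewrite oprojK.
apply/facesP; rewrite sub0set cards0 -e2 -[in RHS](oprojK Ne) card_olift; split => //.
apply/DlP; exists H.
  by apply/fsP; split => // HT; have [l [_ _]] := fH; rewrite HT => /esym/n_Sn.
by apply/subsetP => t; rewrite inE => /(subsetP eB); rewrite BE in_setU1 mem_olift.
Qed.

Lemma pyramid_ifaces2 : (#|ifaces fs' (olift setT) set0 2| <= #|T|)%N.
Proof.
rewrite -cardsT; apply: leq_trans (leq_imset_card (fun g : T => [set None; Some g]) (mem [set: T])).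
apply: subset_leq_card; apply/subsetP => e.
rewrite inE => /andP[/new_edge[[e0 e0f ->]|[g gG ->]] eF]; last exact: imset_f.
by rewrite olift_sub finset.subsetT in eF.
Qed.

Lemma pyramid_bfaces2 : (#|bfaces fs' (olift setT) set0 2| <= #|faces fs set0 2|)%N.
Proof.
apply: leq_trans (leq_imset_card (@olift T) (mem (faces fs set0 2))); apply: subset_leq_card.
apply/subsetP => e; rewrite inE => /andP[/new_edge[[e0 e0f ->]|[g gG ->]] eF]; first exact: imset_f.
by have := subsetP eF None; rewrite !inE => /(_ isT); rewrite (negbTE (None_olift _)).
Qed.

End Pyramid.

(** A set of full rank is never a facet, so excluding it excludes nothing. This identifies the
    conventions [setT] and [olift setT] for a simplicial polytope. *)
Lemma fs_full (R : realFieldType) (N : nat) (T : finType) (v : T -> 'rV[R]_N) (S F F' : {set T}) :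
  rk v F = rk v S -> rk v F' = rk v S -> fs v S F = fs v S F'.
Proof.
move=> rF rF'; have n A G : rk v A = rk v S -> facet v S G -> G <> A.
  by move=> rA [l [_ _ rG]] GA; move: rG; rewrite GA rA => /esym/n_Sn.
by apply/setP => G; apply/fsP/fsP => -[fG _]; split => //; apply: n fG.
Qed.

(** The inequality allows the C(r+1, 2) edges of a simplex plus [r] edges for each further
    vertex. *)
Definition stacked_points (R : realFieldType) (N : nat) (T : finType) (v : T -> 'rV[R]_N) (r : nat) :=
  almost_simplicial_points v r setT /\
  #|faces (fs v setT setT) set0 2| + r.+1 * r <= 'C(r.+1, 2) + #|T| * r.

Lemma simplex_points (R : realFieldType) (N : nat) (T : finType) (v : T -> 'rV[R]_N) r :
  1 < r -> rk v setT = r.+1 -> #|T| = r.+1 -> stacked_points v r.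
Proof.
move=> r1 rT cT; have iT : rk v setT = #|[set: T]| by rewrite cardsT cT.
have simp G : facet v setT G -> #|G| = r.
  by move=> [l [_ _]]; rewrite rT (indepS iT) ?finset.subsetT // => -[].
split; last first.
  rewrite cT leq_add2r -cT -card_draws; apply: subset_leq_card; apply/subsetP => e.
  by move/facesP => [_ _]; rewrite inE cards0 => /eqP.
split=> [//|G fG _|t]; first exact: simp.
have [u ut] : exists u, u != t.
  have : 0 < #|[set: T] :\ t| by have := cardsD1 t [set: T]; rewrite in_setT cardsT cT; lia.
  by move/card_gt0P => [u /setD1P[ut _]]; exists u.
have [m m0 mu] := dualfun iT (in_setT u).
have rG : rk v (setT :\ u) = r by rewrite indepD1 ?in_setT // cardsT cT.
have fG : facet v setT (setT :\ u).
  exists (- m)%R; split; last by rewrite rG rT.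
    move=> s _; have [->|su] := eqVneq s u; first by rewrite /ev prNr -/(ev v u m) mu lerN10.
    by rewrite /ev prNr -/(ev v s m) m0 ?oppr0 // in_setD1 su in_setT.
  apply/setP => s; rewrite !inE andbT /ev prNr -/(ev v s m) oppr_eq0.
  have [->|su] := eqVneq s u; first by rewrite mu oner_eq0.
  by rewrite m0 ?eqxx // in_setD1 su in_setT.
apply: (faceset_subfacet fG); first by rewrite rG (simp _ fG).
by rewrite sub1set in_setD1 eq_sym ut in_setT.
Qed.

Lemma convex_hull_sub (R : realType) m (A : set 'rV[R]_m) (T : finType) (p : T -> 'rV[R]_m) (S : {set T}) :
  (A `<=` hull p S -> convex_hull A `<=` hull p S)%classic.
Proof.
move=> AS x [k [q [a [qA a0 a1 xE]]]].
apply: (hull_sub_hull (p := q) (A := setT)); first by move=> i _; apply/AS/qA.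
by exists k, q, a; split => // i; exists i; rewrite ?in_setT.
Qed.

Lemma convex_hull_mono (R : realType) m (A B : set 'rV[R]_m) :
  (A `<=` B -> convex_hull A `<=` convex_hull B)%classic.
Proof. by move=> AB x [k [q [a [qA a0 a1 xE]]]]; exists k, q, a; split => // i; apply/AB/qA. Qed.

Section AddPoint.
Local Open Scope ring_scope.
Variables (R : realType) (m : nat) (T : finType) (p : T -> 'rV[R]_m) (x : 'rV[R]_m).

Definition add_point (o : option T) : 'rV[R]_m := if o is Some t then p t else x.

Lemma hv_add_point : hv add_point = oconf (hv p) (hom x).
Proof. by apply/funext => -[]. Qed.

Lemma hull_olift A : hull add_point (olift A) = hull p A.
Proof.
apply/seteqP; split; apply: hull_sub_hull.
  by move=> o /imsetP[t tA ->]; apply: hull_mem.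
by move=> t tA; apply: (hull_mem add_point (t := Some t)); rewrite mem_olift.
Qed.

Lemma hull_add_point : convex_hull (hull p setT `|` [set x])%classic = hull add_point setT.
Proof.
apply/seteqP; split.
  apply: convex_hull_sub => y [|->]; last by apply: (hull_mem add_point (t := None)); rewrite in_setT.
  by apply: hull_sub_hull => t _; apply: (hull_mem add_point (t := Some t)); rewrite in_setT.
apply: convex_hull_mono => y [[t|] _ ->]; last by right.
by left; apply: hull_mem; rewrite in_setT.
Qed.

Lemma add_point_exposed l : 0 < pr (hom x) l -> valid (hv p) setT l ->
  faceset (hv add_point) setT [set None].
Proof.
move=> lx vl; apply: (sep_faceset (t := None) _ lx); first by rewrite in_setT.
by move=> [t|] /setD1P[// _ _]; apply: vl; rewrite in_setT.
Qed.

End AddPoint.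

(** * Instances of S(d,n,s) as configurations *)

Section StackingHull.
Local Open Scope ring_scope.
Variables (R : realType) (m : nat) (T : finType) (p : T -> 'rV[R]_m).

Let supports_facet G c b : facet (hv p) setT G -> supports (hull p setT) (hull p G) c b ->
  valid (hv p) setT (cof c b) /\ zs (hv p) setT (cof c b) = G.
Proof.
move=> [l [vl lG _]] /supports_valid[vc]; rewrite -{1}lG => /(hull_zs_inj vl vc) E.
by rewrite -E.
Qed.

Lemma stackingE Fc P' : stacking (hull p setT) Fc P' -> exists (x : 'rV[R]_m) G0 l0,
  [/\ (hom x <= spanm (hv p) setT)%MS, P' = hull (add_point p x) setT,
    Fc = hull p G0 & facet (hv p) setT G0] /\
  [/\ valid (hv p) setT l0, zs (hv p) setT l0 = G0, 0 < pr (hom x) l0 &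
    forall G, facet (hv p) setT G -> G <> G0 ->
      exists l, [/\ valid (hv p) setT l, zs (hv p) setT l = G & pr (hom x) l < 0]].
Proof.
move=> [/is_facetE[[G0 fG0 ->] r1] [x [[/affine_hullE xS [c [b [sup xb]]]] below ->]]].
have [vc cG] := supports_facet fG0 sup.
exists x, G0, (cof c b); split; first by split => //; exact: hull_add_point.
split => //; first by rewrite pr_cof subr_gt0.
move=> G fG GG0; have [||_ [c' [b' [sup' xb']]]] := below (hull p G).
- by apply/is_facetE; split => //; exists G.
- move=> E; apply: GG0; have [l [vl lG _]] := fG; have [k [vk kG _]] := fG0.
  by rewrite -lG -kG; apply: hull_zs_inj; rewrite ?lG ?kG.
have [vc' cG'] := supports_facet fG sup'.
by exists (cof c' b'); rewrite pr_cof subr_lt0.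
Qed.

(** [F] is quantified after the new point so that one statement serves both for stacked polytopes,
    with [F = setT], and for stacking away from the base of the pyramid. *)
Lemma stacking_points Fc P' : stacking (hull p setT) Fc P' -> exists x,
  let p' := add_point p x in
  [/\ P' = hull p' setT, rk (hv p') setT = rk (hv p) setT &
  forall r F, (1 < r)%N -> almost_simplicial_points (hv p) r F -> Fc <> hull p F ->
  [/\ almost_simplicial_points (hv p') r (olift F),
     facet (hv p) setT F -> facet (hv p') setT (olift F),
     (#|ifaces (fs (hv p') setT (olift F)) (olift F) set0 2| <=
       #|ifaces (fs (hv p) setT F) F set0 2| + r)%N &
     (#|bfaces (fs (hv p') setT (olift F)) (olift F) set0 2| <=
       #|bfaces (fs (hv p) setT F) F set0 2|)%N]].
Proof.
move=> /stackingE[x [G0 [l0 [[xS PE FcE fG0] [vl0 l0G l0x below]]]]].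
have ex := add_point_exposed l0x vl0; exists x => /=; rewrite hv_add_point in ex *.
split => //.
  apply: eq_span_rk => [[t|] _|t _] //=; first by apply: (mem_spanm (hv p)); rewrite in_setT.
  by apply: (mem_spanm (oconf (hv p) (hom x)) (t := Some t)); rewrite in_setT.
move=> r F r1 asp FF.
have G0f : G0 \in fs (hv p) setT F by apply/fsP; split => // E; apply: FF; rewrite FcE E.
split.
- exact: (stack_asp r1 asp xS G0f vl0 l0G l0x below ex).
- exact: (stack_facet asp xS G0f below).
- exact: (stack_ifaces r1 asp xS G0f vl0 l0G l0x below).
exact: (stack_bfaces r1 asp xS G0f vl0 l0G l0x below).
Qed.

End StackingHull.

Lemma stacked_hull (R : realType) m (P : set 'rV[R]_m) : stacked P ->
  exists (T : finType) (p : T -> 'rV[R]_m), P = hull p setT /\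
    forall r, 1 < r -> rk (hv p) setT = r.+1 -> stacked_points (hv p) r.
Proof.
elim=> {P} [P [k [p [pi ->]]]|P Fc P' _ [T [p [-> IH]]] st].
  exists 'I_k, p; split.
    by rewrite /hull; congr convex_hull; apply/seteqP; split => x /= [i _]; [move=> <-|move=> ->]; exists i; rewrite ?in_setT.
  move=> r r1 rT; apply: simplex_points => //.
  by rewrite card_ord -(affinely_independent_rk pi).
have [x /= [PE rE pts]] := stacking_points st; set p' := add_point p x in PE rE pts *.
exists (option T), p'; split => // r r1; rewrite rE => rT; have [asp edges] := IH r r1 rT.
have [|[rT' simp cp] _ i2 b2] := pts r setT r1 asp.
  have [/is_facetE[[G [l [vl lG rG]] ->] _] _] := st => E.
  (* The whole polytope is the face of the zero functional, so injectivity of hulls on faces shows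
     that the stacked facet is not everything. *)
  have : zs (hv p) setT l = zs (hv p) setT 0.
    apply: hull_zs_inj => //; first by move=> t _; rewrite /ev pr0r.
    rewrite lG E; congr hull; apply/setP => t; rewrite in_setT; apply/esym/zsP; rewrite in_setT.
    by split => //; rewrite /ev pr0r.
  rewrite lG => GE; move: rG; rewrite rT => -[rG].
  have GT : G = setT.
    by rewrite GE; apply/setP => t; rewrite in_setT; apply/zsP; rewrite in_setT /ev pr0r.
  by move: rG; rewrite GT rT => /esym/n_Sn.
have fE : fs (hv p') setT (olift setT) = fs (hv p') setT setT.
  by apply: fs_full => //; rewrite hv_add_point rk_olift -hv_add_point rE.
have nf A G : rk (hv p') A = r.+1 -> facet (hv p') setT G -> G <> A.
  by move=> rA [l [_ _ rG]] GA; move: rG; rewrite GA rA rT' => /esym/n_Sn.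
split.
  split => // G fG _; apply: simp => //; apply: nf fG.
  by rewrite hv_add_point rk_olift.
rewrite -fE (faces_split _ (olift setT)) card_option.
have := faces_split (fs (hv p) setT setT) setT set0 2.
move: edges i2 b2; move: #|faces _ _ _| #|ifaces _ _ _ _| #|bfaces _ _ _ _| => e i b.
move: #|ifaces _ _ _ _| #|bfaces _ _ _ _| 'C(_, _) #|T| => i' b' q t; clear; nia.
Qed.

Lemma stacked_away_hull (R : realType) m (F0 Q P : set 'rV[R]_m) k : stacked_away F0 k Q P ->
  forall (T : finType) (p : T -> 'rV[R]_m) F r, 1 < r -> Q = hull p setT -> F0 = hull p F ->
  almost_simplicial_points (hv p) r F -> facet (hv p) setT F ->
  exists (T' : finType) (p' : T' -> 'rV[R]_m) F',
  [/\ P = hull p' setT, almost_simplicial_points (hv p') r F', facet (hv p') setT F' &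
    #|T'| = #|T| + k /\ #|F'| = #|F|] /\
  (#|ifaces (fs (hv p') setT F') F' set0 2| <= #|ifaces (fs (hv p) setT F) F set0 2| + k * r /\
   #|bfaces (fs (hv p') setT F') F' set0 2| <= #|bfaces (fs (hv p) setT F) F set0 2|).
Proof.
elim=> {k Q P} [P|k Q G Q' P GF st _ IH] T p F r r1 QE FE asp fF.
  by exists T, p, F; rewrite mul0n !addn0.
rewrite QE FE in st GF; have [x /= [PE rE pts]] := stacking_points st.
have [asp' fF' i2 b2] := pts r F r1 asp GF.
have [|T' [p' [F' [[PE' asp'' fF'' [cT cF]] [i2' b2']]]]] := IH _ _ _ r r1 PE _ asp' (fF' fF).
  by rewrite hull_olift.
exists T', p', F'; split; first by split => //; split; rewrite ?cF ?card_olift // cT card_option addSnnS.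
split; last exact: leq_trans b2' b2.
by apply: leq_trans i2' _; rewrite mulSn addnA leq_add2r.
Qed.

Lemma same_fs (R : realFieldType) (N D : nat) (T : finType) (v : T -> 'rV[R]_N)
  (v' : T -> 'rV[R]_D) S F : same_faces v v' -> fs v S F = fs v' S F.
Proof.
move=> sf; apply/setP => G.
by apply/fsP/fsP => -[fG GF]; split => //; apply/(same_facet S G sf).
Qed.

Lemma points_asp_config (R : realFieldType) (d s : nat) (T : finType) N (v : T -> 'rV[R]_N)
  (v' : T -> 'rV[R]_d.+1) F : 1 < d -> same_faces v v' -> almost_simplicial_points v d F ->
  facet v setT F -> #|F| = d + s -> asp_config s v' F.
Proof.
move=> d1 sf [rT simp cp] fF cF; have [rE _ _] := sf.
have cS : config v' F setT.
  by split=> [|G /(same_facet setT G sf) fG GF]; [rewrite rE|exact: simp].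
split=> [||//|t]; [exact: cS|exact/(same_facet setT F sf)|].
have [||//] := faceset_small cS (A := [set t]); first exact/(same_faceset sf)/cp.
by apply: leq_ltn_trans (rk_card _ _) _; rewrite cards1.
Qed.

Lemma is_S_config (R : realType) (d n s m : nat) (P : set 'rV[R]_m) : 2 < d -> d + s + 1 <= n ->
  is_S d n s P -> exists (T : finType) (p : T -> 'rV[R]_m) (v : T -> 'rV[R]_d.+1) F,
  [/\ P = hull p setT, same_faces (hv p) v, asp_config s v F & #|T| = n] /\
  [/\ #|ifaces (fs v setT F) F set0 2| + d <= d.-1 * (#|T| - (d + s)) + #|T| &
    2 * #|bfaces (fs v setT F) F set0 2| + d.-1 * d <= 2 * d.-1 * (d + s)].
Proof.
move=> d2 dn [F0 [Q [[/stacked_hull[T [p [-> st]]] /has_dimE rT f0] [x xF QE] away]]].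
have dE : d.-1.+1 = d by rewrite prednK // ltnW // ltnW.
have [asp edges] := st d.-1 (ltac:(lia)) rT.
have xS : ~~ (hom x <= spanm (hv p) setT)%MS by apply/negP => /affine_hullE.
have cT : #|T| = d + s.
  by rewrite -f0 fnum0_hull ?cardsT // => t _; case: asp => _ _; exact.
rewrite hull_add_point in QE.
have ex : faceset (oconf (hv p) (hom x)) setT [set None].
  rewrite -hv_add_point; have [l l0 lx] := sepfun xS.
  apply: (@add_point_exposed _ _ _ _ _ ((pr (hom x) l)^-1 *: l)%R).
    by rewrite prZr mulVf.
  by move=> t tT; rewrite /ev prZr -/(ev (hv p) t l) l0 // mulr0.
have := pyramid_asp asp xS ex; have := apex_facet asp xS.
have := pyramid_ifaces2 asp xS; have := pyramid_bfaces2 asp xS.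
rewrite -hv_add_point dE => b2 i2 fF aspQ.
have [|T' [p' [F' [[PE asp' fF' [cT' cF']] [i2' b2']]]]] :=
  stacked_away_hull away (ltnW d2) QE _ aspQ fF; first by rewrite hull_olift.
have rT' : rk (hv p') setT = d.+1 by case: asp'.
have [v sf] := coordinates rT'; exists T', p', v, F'.
have cn : #|T'| = n by rewrite cT' card_option cT; lia.
split.
  split => //; apply: (points_asp_config _ sf asp' fF'); first exact: ltnW.
  by rewrite cF' card_olift cardsT cT.
rewrite -(same_fs setT F' sf); have eq2 : 'C(d, 2) * 2 = d * d.-1 by have := bin_ffact d 2; rewrite ffactnS ffactn1.
split.
  apply: leq_trans (leq_add i2' (leqnn _)) _.
  apply: leq_trans (leq_add (leq_add i2 (leqnn _)) (leqnn _)) _; rewrite cn cT.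
  clear -d2 dn; nia.
move: edges; rewrite dE cT => edges; have {}b2 := leq_trans b2' b2.
move: #|bfaces _ _ _ _| #|faces _ _ _| 'C(d, 2) b2 edges eq2 => b e q; clear; nia.
Qed.

(** An [i]-dimensional face has [i + 1] vertices; the extra summand in top dimension counts [F], the
    one proper face outside Delta. *)
Lemma fnum_faces (R : realType) (m d : nat) (T : finType) (p : T -> 'rV[R]_m)
  (v : T -> 'rV[R]_d.+1) (F : {set T}) i : same_faces (hv p) v -> config v F setT ->
  facet v setT F -> i < d ->
  fnum i (hull p setT) = #|faces (fs v setT F) set0 i.+1| + (i.+1 == d).
Proof.
move=> sf cS fF; rewrite leq_eqVlt => /orP[/eqP id|id].
  have -> : i = d.-1 by rewrite -id.
  by rewrite (fnum_config_top sf cS fF) ?prednK ?eqxx ?addn1 // -id.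
by rewrite (fnum_config sf cS id) (ltn_eqF id) addn0.
Qed.

Theorem theorem1p2 (R : realType) (d n s m m' : nat)
    (P : set 'rV[R]_m) (S : set 'rV[R]_m') :
  3 <= d -> d + s + 1 <= n ->
  almost_simplicial d n s P -> is_S d n s S ->
  (forall i : nat, i <= d - 1 ->
     fnum i S <= fnum i P /\ fnum i P <= fnum i (C_polytope R d n s)) /\
  (4 <= d ->
   (exists i : nat, (1 <= i <= d - 1) /\ fnum i P = fnum i S) ->
   forall i : nat, i <= d - 1 -> fnum i P = fnum i S).
Proof.
move=> d3 dn [Fc /asp_pair_config[|p [v [F [-> sf cX]]]]]; first exact: ltnW.
move=> /(is_S_config d3 dn)[T [p' [v' [F' [[-> sf' cY cT] [eI eB]]]]]].
have [vC [FC [[-> sfC cC fC] [FCs nC nCi]]]] := cyclic_config R d3 dn.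
have [cP fP Fs _] := cX; have [cS fS _ _] := cY.
have TT : #|'I_n| = #|T| by rewrite card_ord cT.
have [lb eq] := asp_lower_bound d3 cX cY TT (fun _ => eI) (fun _ => eB).
have ub : forall j, j <= d -> #|faces (fs v setT F) set0 j| <= #|faces (fs vC setT FC) set0 j|.
  apply: (asp_upper_bound (s := s) _ _ _ _ fP fC Fs FCs erefl).
  - by case: cP.
  - by case: cC.
  - by case: cP.
  - by case: cC.
  - by move=> j; rewrite card_ord; apply: nC.
  - by move=> j; rewrite card_ord; apply: nCi.
have id i : i <= d - 1 -> i < d by lia.
split=> [i /id ilt|d4 [i [/andP[i1 /id ilt] Ei]] j /id jlt].
  rewrite (fnum_faces sf cP fP ilt) (fnum_faces sf' cS fS ilt) (fnum_faces sfC cC fC ilt).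
  by rewrite !leq_add2r ub // lb.
rewrite (fnum_faces sf cP fP jlt) (fnum_faces sf' cS fS jlt); congr (_ + _).
apply: eq => //; exists i.+1; first by rewrite ltnS i1.
by move: Ei; rewrite (fnum_faces sf cP fP ilt) (fnum_faces sf' cS fS ilt) => /addIn.
Qed.
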